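(* Let $l\ge1$, let $g\in L^2(\mathbb{R}^l)$ and suppose that $G(g)=\{g(x-m)e^{2\pi i n\cdot x}\}_{(m,n)\in\mathbb{Z}^{2l}}$ is a Riesz basis for $L^2(\mathbb{R}^l)$. For any $1\le k\le l$, the following hold. (i) If $1<p<\infty$ and $\frac1p+\frac1q=1$, then either $$\int_{\mathbb{R}^l}|x_k|^p|g(x)|^2\,dx=\infty\quad\text{or}\quad\int_{\mathbb{R}^l}|\xi_k|^q|\widehat g(\xi)|^2\,d\xi=\infty .$$ (ii) If $g$ is compactly supported, then $$\int_{\mathbb{R}^l}|\xi_k||\widehat g(\xi)|^2\,d\xi=\infty .$$ This part also holds with $g$ and $\widehat g$ interchanged: if $\widehat g$ is compactly supported, then $\int_{\mathbb{R}^l}|x_k||g(x)|^2\,dx=\infty$.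
   Context: $\widehat g$ denotes the Fourier transform on $L^2(\mathbb{R}^l)$, normalized as $\widehat g(\xi)=\int_{\mathbb{R}^l}g(x)e^{-2\pi i x\cdot\xi}\,dx$ for $g\in L^1\cap L^2$. $x_k$ and $\xi_k$ denote the $k$-th coordinates. *)

(* Defs.v *)
From HB Require Import structures.
From mathcomp Require Import all_boot all_order all_algebra.
From mathcomp Require Import all_classical all_reals all_analysis.
From mathcomp Require Import complex.

Set Implicit Arguments.
Unset Strict Implicit.
Unset Printing Implicit Defensive.

Import Order.TTheory GRing.Theory Num.Theory.
Import numFieldNormedType.Exports.

Local Open Scope classical_set_scope.
Local Open Scope ring_scope.

(* R^l is [l.-tuple R], which the library equips with the product (Borel)
   sigma-algebra; Lebesgue measure on it is the iterated product measure. *)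
Fixpoint lebesgueT (R : realType) (l : nat) : set (l.-tuple R) -> \bar R :=
  match l with
  | 0 => \d_ ([tuple] : 0.-tuple R)
  | l'.+1 => pushforward (lebesgue_measure \x @lebesgueT R l')%E
               (fun u : R * l'.-tuple R => [tuple of u.1 :: u.2])
  end.

Arguments lebesgueT : clear implicits.

Section lebesgueT_measure.
Context (R : realType).

Lemma measurable_consT (l : nat) :
  measurable_fun [set: R * l.-tuple R]
    (fun u : R * l.-tuple R => [tuple of u.1 :: u.2] : l.+1.-tuple R).
Proof. exact: measurable_cons. Qed.

Lemma measurable_unconsT (l : nat) :
  measurable_fun [set: l.+1.-tuple R]
    (fun t : l.+1.-tuple R => (thead t, [tuple of behead t]) : R * l.-tuple R).
Proof.
apply/measurable_fun_pairP; split; [exact: measurable_tnth|].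
exact: measurable_behead.
Qed.

Lemma lebesgueT_sigma_finite_measure (l : nat) :
  exists mu : {sigma_finite_measure set (l.-tuple R) -> \bar R},
    mu = lebesgueT R l :> (set _ -> _).
Proof.
elim: l => [|l [mu muE]] /=.
  by exists (\d_ ([tuple] : 0.-tuple R)).
rewrite -muE.
pose f := fun u : (measurableTypeR R * l.-tuple R)%type =>
  [tuple of u.1 :: u.2] : l.+1.-tuple R.
pose lam : {sigma_finite_measure set (measurableTypeR R) -> \bar R} :=
  lebesgue_measure.
pose prod : {measure set (measurableTypeR R * l.-tuple R)%type -> \bar R} :=
  (lam \x mu)%E.
have prodsf : sigma_finite setT prod.
  have /sigma_finiteP[F [TF ndF Foo]] := sigma_finiteT lam.
  have /sigma_finiteP[G [TG ndG Goo]] := sigma_finiteT mu.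
  exists (fun n => F n `*` G n).
    rewrite -setXTT TF TG predeqE => -[x y]; split.
      move=> [/= [n _ Fnx] [k _ Gky]]; exists (maxn n k) => //; split.
      - by move: x Fnx; exact/subsetPset/ndF/leq_maxl.
      - by move: y Gky; exact/subsetPset/ndG/leq_maxr.
    by move=> [n _ []/= ? ?]; split; exists n.
  move=> k; have [? ?] := Foo k; have [? ?] := Goo k.
  split; first exact: measurableX.
  by rewrite /prod/= product_measure1E// lte_mul_pinfty// ge0_fin_numE.
have mf : measurable_fun setT f by exact: measurable_consT.
pose pf : measurable_fun setT f -> {measure set (l.+1.-tuple R) -> \bar R} :=
  measure_function_pushforward__canonical__measure_function_Measure prod (f:=f).
pose m := pf mf.
have sf : sigma_finite setT m.
  have [F TF mF] := prodsf.
  pose h := fun t : l.+1.-tuple R =>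
    (thead t, [tuple of behead t]) : (measurableTypeR R * l.-tuple R)%type.
  exists (fun n => h @^-1` F n); first by rewrite -preimage_bigcup -TF.
  move=> n; have [mFn Fn_fin] := mF n; split.
    by rewrite -[X in measurable X]setTI; exact: measurable_unconsT.
  have hf u : h (f u) = u.
    by case: u => a t; rewrite /h /f theadE; congr (_, _); exact: val_inj.
  rewrite /m /= /pushforward -comp_preimage (_ : h \o f = id) ?preimage_id//.
  exact/funext.
pose H := Measure_isSigmaFinite.Build _ _ _ (Measure.sort m) sf.
pose m' : {sigma_finite_measure set (l.+1.-tuple R) -> \bar R} :=
  HB.pack_for {sigma_finite_measure set (l.+1.-tuple R) -> \bar R}
    (Measure.sort m) H.
by exists m'.
Qed.

Lemma lebesgueT0 (l : nat) : lebesgueT R l set0 = 0%E.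
Proof. by have [mu <-] := lebesgueT_sigma_finite_measure l; exact: measure0. Qed.

Lemma lebesgueT_ge0 (l : nat) A : (0 <= lebesgueT R l A)%E.
Proof. by have [mu <-] := lebesgueT_sigma_finite_measure l; exact: measure_ge0. Qed.

Lemma lebesgueT_semi_sigma_additive (l : nat) :
  semi_sigma_additive (lebesgueT R l).
Proof.
have [mu <-] := lebesgueT_sigma_finite_measure l.
exact: measure_semi_sigma_additive.
Qed.

HB.instance Definition _ (l : nat) := isMeasure.Build _ _ _ (lebesgueT R l)
  (lebesgueT0 l) (@lebesgueT_ge0 l) (@lebesgueT_semi_sigma_additive l).

Lemma lebesgueT_sigma_finite (l : nat) : sigma_finite setT (lebesgueT R l).
Proof.
by have [mu <-] := lebesgueT_sigma_finite_measure l; exact: sigma_finiteT.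
Qed.

HB.instance Definition _ (l : nat) := Measure_isSigmaFinite.Build _ _ _
  (lebesgueT R l) (@lebesgueT_sigma_finite l).

End lebesgueT_measure.

Notation normc := ComplexField.Normc.normc.

(* C-valued functions on R^l are handled through their real and imaginary
   parts; elements of L^p are represented by functions, not by classes. *)
Section complex_functions.
Context (R : realType) (l : nat).
Implicit Types (f g h : l.-tuple R -> R[i]) (x xi : l.-tuple R).

Definition cmeasurable f : Prop :=
  measurable_fun [set: l.-tuple R] (fun x => complex.Re (f x)) /\
  measurable_fun [set: l.-tuple R] (fun x => complex.Im (f x)).

Definition cLnorm (p : R) f : \bar R :=
  ('N[lebesgueT R l]_(p%:E)[EFin \o (@normc R \o f)])%E.

Definition memL (p : R) f : Prop := cmeasurable f /\ (cLnorm p f < +oo)%E.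

Definition cintegral f : R[i] :=
  (\int[lebesgueT R l]_x complex.Re (f x) +i*
   \int[lebesgueT R l]_x complex.Im (f x))%C.

Definition expi (t : R) : R[i] := (cos t +i* sin t)%C.

Definition dot x xi : R := \sum_(i < l) tnth x i * tnth xi i.

Definition fourierL1 f xi : R[i] :=
  cintegral (fun x => f x * expi (- (2 * pi * dot x xi))).

(* [h] represents the Fourier transform of [g] in L^2: the L^2 transform is the
   closure of the integral transform on L^1 `&` L^2.  By Plancherel, such an [h]
   exists for every [g] in L^2 and is unique almost everywhere. *)
Definition is_fourierL2 g h : Prop :=
  [/\ memL 2 g, memL 2 h &
    exists u : nat -> l.-tuple R -> R[i],
      [/\ forall n, memL 1 (u n) /\ memL 2 (u n),
          (fun n => cLnorm 2 (fun x => u n x - g x)) @ \oo --> 0%E &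
          (fun n => cLnorm 2 (fun xi => fourierL1 (u n) xi - h xi)) @ \oo
            --> 0%E]].

(* Complete Riesz sequence: dense linear span together with the two-sided l^2
   bounds, required on finitely supported coefficient families. *)
Definition riesz_basis (I : eqType) (e : I -> l.-tuple R -> R[i]) : Prop :=
  [/\ forall i, memL 2 (e i),
      forall f, memL 2 f -> forall eps : R, 0 < eps ->
        exists (s : seq I) (c : I -> R[i]),
          (cLnorm 2 (fun x => (f x - \sum_(i <- s) c i * e i x)%R) < eps%:E)%E &
      exists A B : R, [/\ 0 < A, 0 < B &
        forall (s : seq I) (c : I -> R[i]), uniq s ->
          let S := (\sum_(i <- s) normc (c i) ^+ 2)%R in
          let N := cLnorm 2 (fun x => (\sum_(i <- s) c i * e i x)%R) in
          ((A * S)%:E <= N ^+ 2)%E /\ (N ^+ 2 <= (B * S)%:E)%E]].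

Definition int_tuple (m : l.-tuple int) : l.-tuple R :=
  [tuple (tnth m i)%:~R | i < l].

Definition gabor g (mn : l.-tuple int * l.-tuple int) x : R[i] :=
  g [tuple tnth x i - (tnth mn.1 i)%:~R | i < l] *
  expi (2 * pi * dot (int_tuple mn.2) x).

(* Almost-everywhere version of compact support, as [f] stands for its class;
   compactness is that of the library's topology on row vectors. *)
Definition compactly_supported f : Prop :=
  exists2 K : set 'rV[R]_l, compact K &
    {ae lebesgueT R l, forall x, ~ K (\row_i tnth x i) -> f x = 0}.

End complex_functions.

(* Main.v *)
(* Let G be the Zak transform of g, G(x, y) = sum_m g(x - m) e^(2 pi i m.y).  The
   Riesz bounds of the Gabor system bound |G| away from 0 and from above, while
   G(x + e_k, y) = e^(2 pi i y_k) G(x, y) and G(x, y + e_k) = G(x, y) make the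
   argument of G wind in the (x_k, y_k)-plane.  Hence on a grid of mesh 1/K in x_k
   and 1/L in y_k two neighbouring values of G always differ by at least the lower
   bound of |G|.  Let p(T) and r(S) be averages of translates of G by multiples of
   1/K in x_k and of 1/L in y_k; both vary slowly along the grid, so
   (1 - p(T)) G or (1 - r(S)) G is bounded below at some grid point.  Integrating
   over the unit cube gives, by Plancherel and by Parseval in y,
     c <= (K + 1) (L + 1) (int |ghat|^2 |1 - p(e^(2 pi i xi_k / K))|^2
                            + int |g(t)|^2 W(|t_k| + 2) dt)
   where W is nondecreasing and W(|m|) >= |1 - r(e^(2 pi i m / L))|^2 for integers m.

   For (i), 1 - p and 1 - r vanish to a high order N at 1, and with L ~ K^(q-1) the
   right-hand side tends to 0 as K grows if both moments are finite.  For (ii), r is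
   chosen such that 1 - r vanishes at e^(2 pi i m / L) for all |m| <= D + 2, where D
   bounds |t_k| on the support of g; the last integral is then 0 for a fixed L, and
   the first one is o(1 / K).  The pair (ghat, g) is treated in the same way, as the
   Gabor system of ghat is the image of that of g. *)
From HB Require Import structures.
Require Import Defs.
From mathcomp Require Import all_boot all_order all_algebra.
From mathcomp Require Import all_classical all_reals all_analysis.
From mathcomp Require Import complex measurable_realfun.
From mathcomp Require Import ring lra zify.

Set Implicit Arguments.
Unset Strict Implicit.
Unset Printing Implicit Defensive.

Import Order.TTheory GRing.Theory Num.Theory.
Import numFieldNormedType.Exports.
Local Open Scope classical_set_scope.
Local Open Scope ring_scope.

(** * Complex numbers *)

Section complex_numbers.
Context {R : realType}.
Implicit Types (z w : R[i]) (s t : R).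

(** The Zak transform [G] is only square-integrable, so its argument need not vary continuously and
    no homotopy argument applies. The discrete form of winding survives: on the grid through almost
    every point some step must be as large as the lower bound of |G|, whatever the regularity of
    [G]. The averages make this measurable by integrals. Each uses M steps, with M fixed before K,
    so that p(T) G moves by at most half of that bound per step and the rest of the jump falls on (1
    - p(T)) G. The place of the jump is unknown and varies with the base point, hence the sum over
    all grid points and the factor (K + 1) (L + 1). In (i) the two integrals are o(K^-q) and
    o(L^-p), by dominated convergence rather than by a mere moment bound, which would give O and
    only a bounded right-hand side. Since (p - 1) (q - 1) = 1, the choice L ~ K^(q-1) makes K L
    comparable to K^q and to L^p at once, so the o is exactly what is needed. The Fourier pair
    enters only through Plancherel's identity for finite combinations of time-frequency shifts. *)

Definition nsq z : R := complex.Re z ^+ 2 + complex.Im z ^+ 2.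

Lemma nsqE z : normc z ^+ 2 = nsq z.
Proof. by case: z => a b; rewrite /nsq /= sqr_sqrtr // addr_ge0 // sqr_ge0. Qed.

Lemma nsq_ge0 z : 0 <= nsq z.
Proof. by rewrite addr_ge0 ?sqr_ge0. Qed.

Lemma nsq0 : nsq 0 = 0.
Proof. by rewrite /nsq /= expr0n addr0. Qed.

Lemma nsq1 : nsq 1 = 1.
Proof. by rewrite /nsq /= expr1n expr0n addr0. Qed.

Lemma nsqM z w : nsq (z * w) = nsq z * nsq w.
Proof. by case: z => a b; case: w => c d; rewrite /nsq /=; ring. Qed.

Lemma nsqN z : nsq (- z) = nsq z.
Proof. by case: z => a b; rewrite /nsq /= !sqrrN. Qed.

Lemma nsq_conj z : nsq (conjc z) = nsq z.
Proof. by case: z => a b; rewrite /nsq /= !sqrrN. Qed.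

Lemma nsq_real s : nsq (s%:C)%C = s ^+ 2.
Proof. by rewrite /nsq /= expr0n addr0. Qed.

Lemma nsqB z w : nsq (z - w) = nsq (w - z).
Proof. by rewrite -nsqN opprB. Qed.

Lemma nsq_eq0 z : nsq z = 0 -> z = 0.
Proof.
move=> /eqP; rewrite /nsq paddr_eq0 ?sqr_ge0// !sqrf_eq0.
by case: z => a b /= /andP[/eqP -> /eqP ->].
Qed.

(* The free weight [e] lets this replace Minkowski's inequality in limit
   arguments. *)
Lemma nsqD_eps (e : R) z w : 0 < e ->
  nsq (z + w) <= (1 + e) * nsq z + (1 + e^-1) * nsq w.
Proof.
move=> e0; have sq (a b : R) : (a + b) ^+ 2 <= (1 + e) * a ^+ 2 + (1 + e^-1) * b ^+ 2.
  rewrite -subr_ge0.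
  have -> : (1 + e) * a ^+ 2 + (1 + e^-1) * b ^+ 2 - (a + b) ^+ 2 =
     e * (a - e^-1 * b) ^+ 2.
    by field; rewrite gt_eqF.
  by rewrite mulr_ge0 ?sqr_ge0// ltW.
case: z => a b; case: w => c d; rewrite /nsq /=.
by have := lerD (sq a c) (sq b d); lra.
Qed.

Lemma nsqD z w : nsq (z + w) <= 2 * nsq z + 2 * nsq w.
Proof. by have := @nsqD_eps 1 z w ltr01; rewrite invr1. Qed.

Lemma Re_sqr_le z : complex.Re z ^+ 2 <= nsq z.
Proof. by rewrite /nsq lerDl sqr_ge0. Qed.

Lemma Im_sqr_le z : complex.Im z ^+ 2 <= nsq z.
Proof. by rewrite /nsq lerDr sqr_ge0. Qed.

Lemma norm_Re_normc z : `|complex.Re z| <= normc z.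
Proof.
case: z => a b /=.
by rewrite -sqrtr_sqr ler_wsqrtr// lerDl sqr_ge0.
Qed.

Lemma norm_Im_normc z : `|complex.Im z| <= normc z.
Proof.
case: z => a b /=.
by rewrite -sqrtr_sqr ler_wsqrtr// lerDr sqr_ge0.
Qed.

Lemma normc_ge0 z : 0 <= normc z.
Proof. by case: z => a b /=; exact: sqrtr_ge0. Qed.

Lemma normc_sqrt z : normc z = Num.sqrt (nsq z).
Proof. by case: z. Qed.

Lemma normcB z w : normc (z - w) = normc (w - z).
Proof. by rewrite !normc_sqrt nsqB. Qed.

Lemma normc_sum (I : Type) (s : seq I) (F : I -> R[i]) :
  normc (\sum_(i <- s) F i) <= \sum_(i <- s) normc (F i).
Proof.
elim: s => [|i s ih]; first by rewrite !big_nil normc_sqrt nsq0 sqrtr0.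
by rewrite !big_cons (le_trans (le_normcD _ _))// lerD2l.
Qed.

Lemma mul_conjc z : z * conjc z = (nsq z)%:C%C.
Proof. by case: z => a b; rewrite /nsq /=; apply/eqP; rewrite eq_complex /=; apply/andP; split; apply/eqP; ring. Qed.

Lemma expiD s t : expi (s + t) = expi s * expi t.
Proof.
rewrite /expi cosD sinD; apply/eqP; rewrite eq_complex /= eqxx /=.
by rewrite addrC.
Qed.

Lemma expi0 : expi (0 : R) = 1.
Proof. by rewrite /expi cos0 sin0. Qed.

Lemma expiN t : expi (- t) = conjc (expi t).
Proof. by rewrite /expi cosN sinN. Qed.

Lemma nsq_expi t : nsq (expi t) = 1.
Proof. by rewrite /nsq /= cos2Dsin2. Qed.

Lemma normc_expi t : normc (expi t) = 1.
Proof. by rewrite normc_sqrt nsq_expi sqrtr1. Qed.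

Lemma expi_2piMn (n : nat) : expi (2 * pi * n%:R : R) = 1.
Proof.
elim: n => [|n ih]; first by rewrite mulr0 expi0.
rewrite -[n.+1%:R]natr1 mulrDr mulr1 expiD ih mul1r.
have -> : 2 * pi = 0 + pi *+ 2 :> R by rewrite add0r mulr_natl.
by rewrite /expi cosD2pi sinD2pi cos0 sin0.
Qed.

Lemma expi_2pi_int (n : int) : expi (2 * pi * n%:~R : R) = 1.
Proof.
case: n => n; first exact: expi_2piMn.
by rewrite NegzE mulrNz mulrN expiN expi_2piMn /= oppr0.
Qed.

Lemma expi_pi : expi (pi : R) = -1.
Proof. by rewrite /expi cospi sinpi; apply/eqP; rewrite eq_complex /= oppr0 !eqxx. Qed.

(** Two integrations of cos <= 1: [y - sin y] and then [cos y - (1 - y ^+ 2 / 2)] are nondecreasing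
    from 0 on the nonnegative axis, and evenness covers negative arguments. *)
Lemma cos_lb t : 1 - t ^+ 2 / 2 <= cos t :> R.
Proof.
have h (x : R) : 0 <= x -> 1 - x ^+ 2 / 2 <= cos x.
  move=> x0.
  have sinle (y : R) : 0 <= y -> sin y <= y.
    move=> y0; rewrite -subr_ge0.
    have := @ger0_derive1_le_cc R (fun y => y - sin y) 0 y.
    have drv v : is_derive v (1 : R) (fun y : R => y - sin y) (1 - cos v).
      exact: is_deriveB.
    move=> /(_ _ _ _ 0 y); rewrite sin0 subr0; apply.
    - by move=> v _; exact: ex_derive.
    - by move=> v _; rewrite derive1E derive_val subr_ge0 cos_le1.
    - apply: continuous_subspaceT => v; apply: differentiable_continuous.
      by apply/derivable1_diffP.
    - by rewrite in_itv /= lexx.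
    - by rewrite in_itv /= y0 lexx.
    - by [].
  rewrite -subr_ge0.
  have := @ger0_derive1_le_cc R (fun y => cos y - (1 - y ^+ 2 / 2)) 0 x.
  have drv v : is_derive v (1 : R) (fun y : R => cos y - (1 - y ^+ 2 / 2)) (v - sin v).
    apply: is_derive_eq.
    rewrite /GRing.scale /=; lra.
  move=> /(_ _ _ _ 0 x); rewrite cos0 expr0n /= mul0r subr0 subrr; apply.
  - by move=> v _; exact: ex_derive.
  - move=> v; rewrite in_itv /= => /andP[v0 _].
    by rewrite derive1E derive_val subr_ge0 sinle// ltW.
  - apply: continuous_subspaceT => v; apply: differentiable_continuous.
    by apply/derivable1_diffP.
  - by rewrite in_itv /= lexx.
  - by rewrite in_itv /= x0 lexx.
  - by [].
case: (leP 0 t) => [/h//|t0].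
by have := h (- t); rewrite cosN sqrrN; apply; rewrite oppr_ge0 ltW.
Qed.

Lemma nsq_expi1_le t : nsq (expi t - 1) <= t ^+ 2.
Proof.
have -> : nsq (expi t - 1) = 2 - 2 * cos t.
  by rewrite /nsq /= subr0; have := cos2Dsin2 t; lra.
have := cos_lb t; lra.
Qed.

Lemma normc_expi1_le t : normc (expi t - 1) <= `|t|.
Proof. by rewrite normc_sqrt -sqrtr_sqr ler_wsqrtr// nsq_expi1_le. Qed.

End complex_numbers.

(** * Square-integrable complex functions *)

Section complex_measurable.
Context {R : realType}.

Lemma ReD (z w : R[i]) : complex.Re (z + w) = complex.Re z + complex.Re w.
Proof. by case: z; case: w. Qed.
Lemma ImD (z w : R[i]) : complex.Im (z + w) = complex.Im z + complex.Im w.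
Proof. by case: z; case: w. Qed.
Lemma ReM (z w : R[i]) :
  complex.Re (z * w) = complex.Re z * complex.Re w - complex.Im z * complex.Im w.
Proof. by case: z; case: w. Qed.
Lemma ImM (z w : R[i]) :
  complex.Im (z * w) = complex.Re z * complex.Im w + complex.Im z * complex.Re w.
Proof. by case: z => a b; case: w. Qed.
Lemma ReC (z : R[i]) : complex.Re (conjc z) = complex.Re z.
Proof. by case: z. Qed.
Lemma ImC (z : R[i]) : complex.Im (conjc z) = - complex.Im z.
Proof. by case: z. Qed.
Lemma eq_ReIm (z w : R[i]) :
  complex.Re z = complex.Re w -> complex.Im z = complex.Im w -> z = w.
Proof. by case: z => a b; case: w => c d /= -> ->. Qed.

Context d (T : measurableType d).
Implicit Types f g : T -> R[i].

Definition cmeas f : Prop :=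
  measurable_fun [set: T] (fun x => complex.Re (f x)) /\
  measurable_fun [set: T] (fun x => complex.Im (f x)).

Lemma cmeas_cst (c : R[i]) : cmeas (fun=> c).
Proof. by split; exact: measurable_cst. Qed.

Lemma cmeasD f g : cmeas f -> cmeas g -> cmeas (fun x => f x + g x).
Proof.
move=> [f1 f2] [g1 g2]; split.
  by under eq_fun do rewrite ReD; exact: measurable_funD.
by under eq_fun do rewrite ImD; exact: measurable_funD.
Qed.

Lemma cmeasM f g : cmeas f -> cmeas g -> cmeas (fun x => f x * g x).
Proof.
move=> [f1 f2] [g1 g2]; split.
  by under eq_fun do rewrite ReM; apply: measurable_funB; exact: measurable_funM.
by under eq_fun do rewrite ImM; apply: measurable_funD; exact: measurable_funM.
Qed.

Lemma cmeasZ c f : cmeas f -> cmeas (fun x => c * f x).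
Proof. by move=> mf; apply: cmeasM => //; exact: cmeas_cst. Qed.

Lemma cmeasB f g : cmeas f -> cmeas g -> cmeas (fun x => f x - g x).
Proof.
move=> mf mg; have := cmeasD mf (cmeasZ (-1) mg).
by under [in X in X -> _]eq_fun do rewrite mulN1r.
Qed.

Lemma cmeas_conj f : cmeas f -> cmeas (fun x => conjc (f x)).
Proof.
move=> [f1 f2]; split; first by under eq_fun do rewrite ReC.
by under eq_fun do rewrite ImC; exact: measurable_funN.
Qed.

Lemma cmeas_sum (I : Type) (s : seq I) (F : I -> T -> R[i]) :
  (forall i, cmeas (F i)) -> cmeas (fun x => \sum_(i <- s) F i x).
Proof.
move=> mF; elim: s => [|i s ih].
  by under eq_fun do rewrite big_nil; exact: cmeas_cst.
by under eq_fun do rewrite big_cons; exact: cmeasD.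
Qed.

Lemma cmeas_expi (h : T -> R) : measurable_fun [set: T] h ->
  cmeas (fun x => expi (h x)).
Proof.
move=> mh; split => /=; apply: measurableT_comp => //.
  exact: (continuous_measurable_fun (@continuous_cos R)).
exact: (continuous_measurable_fun (@continuous_sin R)).
Qed.

Lemma cmeas_real (h : T -> R) : measurable_fun [set: T] h ->
  cmeas (fun x => ((h x)%:C)%C).
Proof. by move=> mh; split => //=; exact: measurable_cst. Qed.

Lemma measurable_nsq f : cmeas f -> measurable_fun [set: T] (fun x => nsq (f x)).
Proof.
move=> [f1 f2].
apply: measurable_funD; exact: measurable_funX.
Qed.

Lemma measurable_ensq f : cmeas f ->
  measurable_fun [set: T] (fun x => (nsq (f x))%:E).
Proof. by move=> mf; apply/measurable_EFinP; exact: measurable_nsq. Qed.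

End complex_measurable.

Lemma cmeas_comp {R : realType} d (T : measurableType d) d' (T' : measurableType d')
    (h : T' -> T) (f : T -> R[i]) :
  measurable_fun [set: T'] h -> cmeas f -> cmeas (fun x => f (h x)).
Proof.
by move=> mh [f1 f2]; split; [exact: (measurableT_comp f1 mh)|exact: (measurableT_comp f2 mh)].
Qed.


Section L2.
Context {R : realType} d (T : measurableType d) (mu : {measure set T -> \bar R}).
Implicit Types f g h : T -> R[i].

(** The squared L^2 norm, extended-valued and without a root, so that Tonelli and monotone
    convergence apply to it as to any integral. *)
Definition N2 f : \bar R := (\int[mu]_x (nsq (f x))%:E)%E.

Definition L2 f : Prop := cmeas f /\ (N2 f < +oo)%E.

Definition cintegrable f : Prop :=
  mu.-integrable [set: T] (fun x => (complex.Re (f x))%:E) /\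
  mu.-integrable [set: T] (fun x => (complex.Im (f x))%:E).

Definition cint f : R[i] :=
  (\int[mu]_x complex.Re (f x) +i* \int[mu]_x complex.Im (f x))%C.

Definition ip f g : R[i] := cint (fun x => f x * conjc (g x)).

Lemma N2_ge0 f : (0 <= N2 f)%E.
Proof. by apply: integral_ge0 => x _; rewrite lee_fin nsq_ge0. Qed.

Lemma N2_eq0 : N2 (fun=> 0) = 0%E.
Proof. by rewrite /N2 integral0_eq// => x _; rewrite nsq0. Qed.

Lemma eq_N2 f g : f =1 g -> N2 f = N2 g.
Proof. by move=> fg; apply: eq_integral => x _; rewrite fg. Qed.

Lemma N2_le f g : cmeas f -> cmeas g -> (forall x, nsq (f x) <= nsq (g x)) ->
  (N2 f <= N2 g)%E.
Proof.
move=> mf mg fg; apply: ge0_le_integral => //.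
- by move=> x _; rewrite lee_fin nsq_ge0.
- exact: measurable_ensq.
- exact: measurable_ensq.
- by move=> x _; rewrite lee_fin.
Qed.

Lemma N2Z c f : cmeas f -> N2 (fun x => c * f x) = ((nsq c)%:E * N2 f)%E.
Proof.
move=> mf; rewrite /N2; under eq_integral do rewrite nsqM EFinM.
rewrite ge0_integralZl//; first exact: measurable_ensq.
- by move=> x _; rewrite lee_fin nsq_ge0.
- by rewrite lee_fin nsq_ge0.
Qed.

Lemma N2D_eps (e : R) f g : 0 < e -> cmeas f -> cmeas g ->
  (N2 (fun x => f x + g x)%R <= (1 + e)%:E * N2 f + (1 + e^-1)%:E * N2 g)%E.
Proof.
move=> e0 mf mg; rewrite /N2.
have e1 : (0 <= 1 + e)%R by rewrite addr_ge0// ltW.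
have e2 : (0 <= 1 + e^-1)%R by rewrite addr_ge0// invr_ge0 ltW.
have m1 := measurable_ensq mf; have m2 := measurable_ensq mg.
have p1 x : (0 <= (nsq (f x))%:E)%E by rewrite lee_fin nsq_ge0.
have p2 x : (0 <= (nsq (g x))%:E)%E by rewrite lee_fin nsq_ge0.
rewrite -!ge0_integralZl ?lee_fin// -ge0_integralD//; last 4 first.
- by move=> x _; rewrite mule_ge0.
- exact: measurable_funeM.
- by move=> x _; rewrite mule_ge0.
- exact: measurable_funeM.
apply: ge0_le_integral => //.
- by move=> x _; rewrite lee_fin nsq_ge0.
- exact/measurable_ensq/cmeasD.
- by apply: emeasurable_funD; exact: measurable_funeM.
- by move=> x _; rewrite -!EFinM -EFinD lee_fin nsqD_eps.
Qed.

Lemma N2D f g : cmeas f -> cmeas g ->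
  (N2 (fun x => f x + g x)%R <= 2%:E * N2 f + 2%:E * N2 g)%E.
Proof. by move=> mf mg; have := N2D_eps (@ltr01 R) mf mg; rewrite invr1. Qed.

Lemma N2N f : N2 (fun x => - f x) = N2 f.
Proof. by apply: eq_integral => x _; rewrite nsqN. Qed.

Lemma N2B f g : N2 (fun x => f x - g x) = N2 (fun x => g x - f x).
Proof. by apply: eq_integral => x _; rewrite nsqB. Qed.

Lemma L2_0 : L2 (fun=> 0).
Proof. by split; [exact: cmeas_cst|rewrite N2_eq0]. Qed.

Lemma L2D f g : L2 f -> L2 g -> L2 (fun x => f x + g x).
Proof.
move=> [mf fo] [mg go]; split; first exact: cmeasD.
by rewrite (le_lt_trans (N2D mf mg))// lte_add_pinfty// lte_mul_pinfty ?lee_fin.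
Qed.

Lemma L2Z c f : L2 f -> L2 (fun x => c * f x).
Proof.
move=> [mf fo]; split; first exact: cmeasZ.
by rewrite N2Z// lte_mul_pinfty ?lee_fin ?nsq_ge0.
Qed.

Lemma L2B f g : L2 f -> L2 g -> L2 (fun x => f x - g x).
Proof.
move=> hf hg; have := L2D hf (L2Z (-1) hg).
by under [in X in X -> _]eq_fun do rewrite mulN1r.
Qed.

Lemma L2_sum (I : Type) (s : seq I) (F : I -> T -> R[i]) :
  (forall i, L2 (F i)) -> L2 (fun x => \sum_(i <- s) F i x).
Proof.
move=> mF; elim: s => [|i s ih].
  by under eq_fun do rewrite big_nil; exact: L2_0.
by under eq_fun do rewrite big_cons; exact: L2D.
Qed.

Lemma L2_bounded_mul (M : R) f g : cmeas f -> (forall x, nsq (f x) <= M) -> L2 g ->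
  L2 (fun x => f x * g x).
Proof.
move=> mf fM [mg go]; split; first exact: cmeasM.
have M0 : 0 <= Num.max M 0 by rewrite le_max lexx orbT.
have := L2Z ((Num.sqrt (Num.max M 0))%:C)%C (conj mg go).
case=> m2; apply: le_lt_trans.
apply: N2_le => // [|x]; first exact: cmeasM.
rewrite !nsqM nsq_real sqr_sqrtr// ler_wpM2r ?nsq_ge0//.
by rewrite (le_trans (fM x))// le_max lexx.
Qed.

Lemma nsq_integrable f : L2 f -> mu.-integrable setT (fun x => (nsq (f x))%:E).
Proof.
move=> [mf fo]; apply/integrableP; split; first exact: measurable_ensq.
apply: le_lt_trans fo; rewrite le_eqVlt; apply/orP; left; apply/eqP.
by apply: eq_integral => x _; rewrite gee0_abs// lee_fin nsq_ge0.
Qed.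

Lemma N2_fin f : L2 f -> N2 f \is a fin_num.
Proof. by move=> [_ fo]; rewrite ge0_fin_numE// N2_ge0. Qed.

Lemma le_cintegrable f (h : T -> R) : cmeas f -> (forall x, normc (f x) <= h x) ->
  mu.-integrable setT (fun x => (h x)%:E) -> cintegrable f.
Proof.
move=> [m1 m2] fh ih; split; apply: le_integrable ih => //;
  try exact/measurable_EFinP.
- move=> x _ /=; rewrite lee_fin (le_trans (norm_Re_normc _))//.
  by rewrite (le_trans (fh x))// ler_norm.
- move=> x _ /=; rewrite lee_fin (le_trans (norm_Im_normc _))//.
  by rewrite (le_trans (fh x))// ler_norm.
Qed.

Lemma L2_mul_cintegrable f g : L2 f -> L2 g ->
  cintegrable (fun x => f x * conjc (g x)).
Proof.
move=> hf hg; apply: (@le_cintegrable _ (fun x => nsq (f x) + nsq (g x))).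
- by apply: cmeasM; [exact: hf.1 | exact: cmeas_conj hg.1].
- move=> x; rewrite normc_sqrt nsqM nsq_conj.
  have a0 := nsq_ge0 (f x); have b0 := nsq_ge0 (g x).
  have -> : nsq (f x) + nsq (g x) = Num.sqrt ((nsq (f x) + nsq (g x)) ^+ 2).
    by rewrite sqrtr_sqr ger0_norm // addr_ge0.
  by rewrite ler_wsqrtr//; nra.
- have := @integrableD _ _ _ mu setT measurableT _ _
    (nsq_integrable hf) (nsq_integrable hg).
  by apply: eq_integrable => // x _; rewrite EFinD.
Qed.

Lemma cintegrableD f g : cintegrable f -> cintegrable g ->
  cintegrable (fun x => f x + g x).
Proof.
move=> [f1 f2] [g1 g2]; split.
  have := @integrableD _ _ _ mu setT measurableT _ _ f1 g1.
  by apply: eq_integrable => // x _; rewrite ReD EFinD.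
have := @integrableD _ _ _ mu setT measurableT _ _ f2 g2.
by apply: eq_integrable => // x _; rewrite ImD EFinD.
Qed.

Lemma cintD f g : cintegrable f -> cintegrable g ->
  cint (fun x => f x + g x) = cint f + cint g.
Proof.
move=> [f1 f2] [g1 g2]; apply: eq_ReIm; rewrite ?ReD ?ImD /=.
  by rewrite -RintegralD//; apply: eq_Rintegral => x _; rewrite ReD.
by rewrite -RintegralD//; apply: eq_Rintegral => x _; rewrite ImD.
Qed.

Lemma cintegrableZ c f : cintegrable f -> cintegrable (fun x => c * f x).
Proof.
move=> [f1 f2]; split.
  have := @integrableB _ _ _ mu setT measurableT _ _
    (integrableZl measurableT (complex.Re c) f1)
    (integrableZl measurableT (complex.Im c) f2).
  by apply: eq_integrable => // x _; rewrite ReM EFinB !EFinM.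
have := @integrableD _ _ _ mu setT measurableT _ _
    (integrableZl measurableT (complex.Re c) f2)
    (integrableZl measurableT (complex.Im c) f1).
by apply: eq_integrable => // x _; rewrite ImM EFinD !EFinM.
Qed.

Lemma cintZ c f : cintegrable f -> cint (fun x => c * f x) = c * cint f.
Proof.
move=> [f1 f2]; apply: eq_ReIm; rewrite ?ReM ?ImM /=.
  rewrite -!RintegralZl// -RintegralB//.
  - by apply: eq_Rintegral => x _; rewrite ReM.
  - exact: (integrableZl measurableT (complex.Re c) f1).
  - exact: (integrableZl measurableT (complex.Im c) f2).
rewrite -!RintegralZl// -RintegralD//.
- by apply: eq_Rintegral => x _; rewrite ImM.
- exact: (integrableZl measurableT (complex.Re c) f2).
- exact: (integrableZl measurableT (complex.Im c) f1).
Qed.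

Lemma cint0 : cint (fun=> 0) = 0.
Proof. by rewrite /cint /= /Rintegral integral0. Qed.

Lemma cintegrable0 : cintegrable (fun=> 0).
Proof. by split; exact: integrable0. Qed.

Lemma eq_cint f g : f =1 g -> cint f = cint g.
Proof. by move=> fg; congr (_ +i* _)%C; apply: eq_Rintegral => x _; rewrite fg. Qed.

Lemma cintegrable_sum (I : Type) (s : seq I) (F : I -> T -> R[i]) :
  (forall i, cintegrable (F i)) -> cintegrable (fun x => \sum_(i <- s) F i x).
Proof.
move=> mF; elim: s => [|i s ih].
  by under eq_fun do rewrite big_nil; exact: cintegrable0.
by under eq_fun do rewrite big_cons; exact: cintegrableD.
Qed.

Lemma cint_sum (I : Type) (s : seq I) (F : I -> T -> R[i]) :
  (forall i, cintegrable (F i)) ->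
  cint (fun x => \sum_(i <- s) F i x) = \sum_(i <- s) cint (F i).
Proof.
move=> mF; elim: s => [|i s ih].
  by under eq_fun do rewrite big_nil; rewrite big_nil cint0.
under eq_fun do rewrite big_cons; rewrite big_cons cintD ?ih//.
exact: cintegrable_sum.
Qed.

Lemma cint_conj f : cintegrable f -> cint (fun x => conjc (f x)) = conjc (cint f).
Proof.
move=> [f1 f2]; apply: eq_ReIm; rewrite ?ReC ?ImC /=.
  by apply: eq_Rintegral => x _; rewrite ReC.
by rewrite -mulN1r -RintegralZl//; apply: eq_Rintegral => x _; rewrite ImC mulN1r.
Qed.

Lemma ipDl f g h : L2 f -> L2 g -> L2 h ->
  ip (fun x => f x + g x) h = ip f h + ip g h.
Proof.
move=> lf lg lh; rewrite /ip -cintD; [|exact: L2_mul_cintegrable..].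
by apply: eq_cint => x; rewrite mulrDl.
Qed.

Lemma ipZl c f g : L2 f -> L2 g -> ip (fun x => c * f x) g = c * ip f g.
Proof.
move=> lf lg; rewrite /ip -cintZ; last exact: L2_mul_cintegrable.
by apply: eq_cint => x; rewrite mulrA.
Qed.

Lemma ipBl f g h : L2 f -> L2 g -> L2 h ->
  ip (fun x => f x - g x) h = ip f h - ip g h.
Proof.
move=> lf lg lh; rewrite -mulN1r -ipZl// -ipDl//; last exact: L2Z.
by apply: eq_cint => x; rewrite mulN1r.
Qed.

Lemma ip_suml (I : Type) (s : seq I) (F : I -> T -> R[i]) g :
  (forall i, L2 (F i)) -> L2 g ->
  ip (fun x => \sum_(i <- s) F i x) g = \sum_(i <- s) ip (F i) g.
Proof.
move=> mF lg; rewrite /ip -cint_sum; last by move=> i; exact: L2_mul_cintegrable.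
by apply: eq_cint => x; rewrite mulr_suml.
Qed.

Lemma ipC f g : L2 f -> L2 g -> ip g f = conjc (ip f g).
Proof.
move=> lf lg; rewrite /ip -cint_conj; last exact: L2_mul_cintegrable.
by apply: eq_cint => x; rewrite rmorphM /= conjcK mulrC.
Qed.

Lemma ip_self f : ip f f = ((fine (N2 f))%:C)%C.
Proof.
apply: eq_ReIm => /=.
  by rewrite /Rintegral /N2; congr fine; apply: eq_integral => x _; rewrite mul_conjc.
rewrite (_ : (fun _ => _) = fun=> 0); first by rewrite /Rintegral integral0.
by apply: funext => x; rewrite mul_conjc.
Qed.

(** The squared norm of f - (f, g) g is nonnegative and equals N2 f - |(f, g)|^2 when g has norm
    1. *)
Lemma ip_Bessel f g : L2 f -> L2 g -> N2 g = 1%E -> ((nsq (ip f g))%:E <= N2 f)%E.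
Proof.
move=> lf lg g1; pose a := ip f g.
have lh : L2 (fun x => f x - a * g x) by apply: L2B => //; exact: L2Z.
have e : ip (fun x => f x - a * g x) (fun x => f x - a * g x) =
   ip f f - ((nsq a)%:C)%C.
  rewrite ipBl//; last exact: L2Z.
  rewrite ipZl// [ip f _]ipC// [ip g _]ipC// !ipBl//; try exact: L2Z.
  rewrite !ipZl// -/a [ip g f]ipC// -/a (ip_self f) (ip_self g) g1.
  rewrite {lh}; case: a (fine (N2 f)) => p q r.
  by apply: eq_ReIm; rewrite /nsq /=; ring.
move: e; rewrite !ip_self => /(congr1 (@complex.Re R)) /=.
move=> e; rewrite -(fineK (N2_fin lf)) lee_fin -subr_ge0 -e fine_ge0//; exact: N2_ge0.
Qed.

End L2.

Section L2_limits.
Context {R : realType} d (T : measurableType d) (mu : {measure set T -> \bar R}).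
Implicit Types f g h : T -> R[i].

Local Notation N2 := (N2 mu).

(** Norms pass to the limit up to the factor (1 + e)^2, by [N2D_eps] applied once on each side;
    letting e tend to 0 removes it. *)
Lemma N2_cvg_le (v w : nat -> T -> R[i]) (v0 w0 : T -> R[i]) :
  (forall n, cmeas (v n)) -> (forall n, cmeas (w n)) ->
  cmeas v0 -> cmeas w0 ->
  (forall n, (N2 (v n) <= N2 (w n))%E) ->
  (fun n => N2 (fun x => v n x - v0 x)) @ \oo --> 0%E ->
  (fun n => N2 (fun x => w n x - w0 x)) @ \oo --> 0%E ->
  (N2 v0 <= N2 w0)%E.
Proof.
move=> mv mw mv0 mw0 vw cv cw.
have [->|wfin] := eqVneq (N2 w0) +oo%E; first by rewrite leey.
have {wfin} wfin : (N2 w0 \is a fin_num) by rewrite ge0_fin_numE ?N2_ge0 ?lt_neqAle ?leey ?andbT.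
have key (e : R) : 0 < e -> (N2 v0 <= ((1 + e) * (1 + e))%:E * N2 w0)%E.
  move=> e0.
  have cvg0 : (fun n => (1 + e)%:E * ((1 + e)%:E * N2 w0 +
      (1 + e^-1)%:E * N2 (fun x => w n x - w0 x)%R) +
      (1 + e^-1)%:E * N2 (fun x => v n x - v0 x)%R)%E @ \oo -->
      ((1 + e)%:E * ((1 + e)%:E * N2 w0 + (1 + e^-1)%:E * 0) + (1 + e^-1)%:E * 0)%E.
    apply: cvgeD; first by rewrite mule0 ?adde0 fin_num_adde_defl.
      apply: cvgeZl => //; apply: cvgeD.
      - by rewrite mule0 fin_num_adde_defl.
      - exact: cvg_cst.
      - exact: cvgeZl.
    exact: cvgeZl.
  have -> : (((1 + e) * (1 + e))%:E * N2 w0 =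
    ((1 + e)%:E * ((1 + e)%:E * N2 w0 + (1 + e^-1)%:E * 0) + (1 + e^-1)%:E * 0))%E.
    by rewrite !mule0 !adde0 EFinM muleA.
  apply: (cvge_to_ge cvg0); apply: nearW => n.
  have h1 := N2D_eps mu e0 (mv n) (cmeasB mv0 (mv n)).
  rewrite (eq_N2 mu (g := v0)) in h1; last by move=> x; rewrite addrC subrK.
  have h2 := N2D_eps mu e0 mw0 (cmeasB (mw n) mw0).
  rewrite (eq_N2 mu (g := w n)) in h2; last by move=> x; rewrite addrC subrK.
  rewrite (le_trans h1)// [in leLHS]N2B leeD2r// lee_pmul2l ?lte_fin ?ltr_pwDl ?(ltW e0)//.
  by rewrite (le_trans (vw n)).
have c0 : 0 <= fine (N2 w0) by rewrite fine_ge0// N2_ge0.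
move: key c0; rewrite -(fineK wfin) /=; set c := fine _ => key c0.
apply/lee_addgt0Pr => e e0.
(* For e' <= 1 one has (1 + e')^2 <= 1 + 3 e'; the 1 added to c keeps the denominator positive. *)
pose e' := Num.min 1 (e / (3 * (c + 1))).
have d0 : 0 < 3 * (c + 1) by lra.
have e'0 : 0 < e' by rewrite lt_min ltr01 divr_gt0.
apply: (le_trans (key _ e'0)); rewrite -EFinM -EFinD lee_fin.
have h1 : e' <= 1 by rewrite ge_min lexx.
have h2 : e' * (3 * (c + 1)) <= e by rewrite -ler_pdivlMr// ge_min lexx orbT.
nra.
Qed.

End L2_limits.

(** * Translations and folding over the unit cube *)

Section translation.
Context {R : realType}.
Local Open Scope ereal_scope.

Lemma ge0_integral_lebesgue_shift (s : R) (f : R -> \bar R) :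
  measurable_fun [set: R] f -> (forall x, 0 <= f x) ->
  \int[lebesgue_measure]_x f (x + s)%R = \int[lebesgue_measure]_x f x.
Proof.
move=> mf f0.
pose sh := (fun x => (x + s)%R) : measurableTypeR R -> measurableTypeR R.
have msh : measurable_fun [set: measurableTypeR R] sh by exact: measurable_funD.
rewrite -[LHS]/(\int[lebesgue_measure]_(x in sh @^-1` setT) (f \o sh) x).
rewrite -(ge0_integral_pushforward msh lebesgue_measure)//.
(* The image of Lebesgue measure under the translation agrees with it on half-open intervals, which
   determine it. *)
apply: eq_measure_integral => A mA _; apply/esym.
apply: (lebesgue_measure_unique (mu := pushforward lebesgue_measure sh)) => // _ [[a b]] _ <-.
rewrite /= /pushforward (_ : sh @^-1` _ = `]a - s, b - s]%classic%R).
  rewrite !lebesgue_measure_itv /= !lte_fin ltrD2r -!EFinB.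
  by rewrite opprB addrA subrK.
by apply/seteqP; split => x /=; rewrite !in_itv /= ltrBlDr lerBrDr.
Qed.

Definition tadd l (x s : l.-tuple R) : l.-tuple R :=
  [tuple (tnth x i + tnth s i)%R | i < l].
Definition topp l (x : l.-tuple R) : l.-tuple R := [tuple (- tnth x i)%R | i < l].
Definition tsub l (x s : l.-tuple R) : l.-tuple R := tadd x (topp s).

Lemma measurable_tadd l (s : l.-tuple R) : measurable_fun setT (fun x => tadd x s).
Proof.
apply/measurable_fun_tnthP => i.
rewrite (_ : _ \o _ = fun x : l.-tuple R => tnth x i + tnth s i)%R; last first.
  by apply/funext => x /=; rewrite tnth_mktuple.
by apply: measurable_funD => //; exact: measurable_tnth.
Qed.

Lemma measurable_tsub l (s : l.-tuple R) : measurable_fun setT (fun x => tsub x s).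
Proof. exact: measurable_tadd. Qed.

Lemma ge0_integral_lebesgueTS l (f : l.+1.-tuple R -> \bar R) :
  measurable_fun setT f -> (forall x, 0 <= f x) ->
  \int[lebesgueT R l.+1]_x f x =
  \int[lebesgue_measure]_a \int[lebesgueT R l]_t f [tuple of a :: t].
Proof.
move=> mf f0.
pose h := fun u : (measurableTypeR R * l.-tuple R)%type =>
  [tuple of u.1 :: u.2] : l.+1.-tuple R.
have mc : measurable_fun setT h by exact: measurable_consT.
pose P : {measure set (measurableTypeR R * l.-tuple R)%type -> \bar R} :=
  product_measure1 (@lebesgue_measure R) (lebesgueT R l).
have e := @ge0_integral_pushforward _ _ _ _ _ _ mc P setT f measurableT mf (fun x _ => f0 x).
transitivity (\int[P]_x (f \o h) x).
  by move: e; rewrite preimage_setT => <-; apply: eq_measure_integral.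
rewrite fubini_tonelli1//.
- exact: measurableT_comp mc.
- by move=> x; exact: f0.
Qed.

Lemma taddS l (a : R) (t : l.-tuple R) (s : l.+1.-tuple R) :
  tadd [tuple of a :: t] s = [tuple of (a + thead s)%R :: tadd t [tuple of behead s]].
Proof.
apply: eq_from_tnth => i; rewrite tnth_mktuple.
case: (unliftP ord0 i) => [j|] ->; last by rewrite !tnth0.
rewrite !tnthS tnth_mktuple; congr (_ + _)%R.
by rewrite {1}(tuple_eta s) tnthS.
Qed.

Lemma ge0_integral_lebesgueT_shift l (s : l.-tuple R) (f : l.-tuple R -> \bar R) :
  measurable_fun setT f -> (forall x, 0 <= f x) ->
  \int[lebesgueT R l]_x f (tadd x s) = \int[lebesgueT R l]_x f x.
Proof.
elim: l s f => [|l ih] s f mf f0.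
  by apply: eq_integral => x _; rewrite (tuple0 x) (tuple0 (tadd _ _)).
have mfs : measurable_fun setT (fun x => f (tadd x s)).
  exact: (measurableT_comp mf (measurable_tadd s)).
rewrite !ge0_integral_lebesgueTS//.
have mc := @measurable_consT R l.
transitivity (\int[lebesgue_measure]_a
   \int[lebesgueT R l]_t f [tuple of (a + thead s)%R :: t]).
  apply: eq_integral => a _.
  rewrite -(ih [tuple of behead s] (fun t => f [tuple of (a + thead s)%R :: t]))//.
    by apply: eq_integral => t _; rewrite taddS.
  apply: (measurableT_comp mf).
  by apply: measurable_cons => //; exact: measurable_cst.
rewrite (ge0_integral_lebesgue_shift (thead s)
  (f := fun a => \int[lebesgueT R l]_t f [tuple of a :: t]))//.
- apply: (@measurable_fun_fubini_tonelli_F _ _ _ _ _ (lebesgueT R l)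
    (fun u : measurableTypeR R * l.-tuple R => f [tuple of u.1 :: u.2])).
  + exact: measurableT_comp mc.
  + by move=> x; exact: f0.
- by move=> a; apply: integral_ge0.
Qed.

End translation.

(** * Sums over countable index sets *)

Section countable_sums.
Context {R : realType}.
Local Open Scope ereal_scope.

(** The codes of a countable type need not exhaust [nat], so naturals that code nothing contribute
    0. This turns sums over the lattice into series, to which monotone convergence applies. *)
Definition nat_term (I : countType) (a : I -> \bar R) (n : nat) : \bar R :=
  oapp a 0 (@pickle_inv I n).

Lemma esum_nat (I : countType) (a : I -> \bar R) : (forall i, 0 <= a i) ->
  \esum_(i in [set: I]) a i = \sum_(n <oo) nat_term a n.
Proof.
move=> a0; pose b := nat_term a.
have b0 n : 0 <= b n by rewrite /b /nat_term; case: pickle_inv => /=.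
rewrite nneseries_esumT//.
transitivity (\esum_(n in (@pickle I) @` setT) b n).
  rewrite esum_image; first by apply: eq_esum => i _; rewrite /b /nat_term pickleK_inv.
  by move=> x y _ _; exact: pcan_inj (@pickleK_inv I) x y.
rewrite esum_mkcond; apply: eq_esum => n _; case: ifPn => // nr.
rewrite /b /nat_term; case E: (@pickle_inv I n) => [i|//]; exfalso.
move: nr; rewrite notin_setE; apply; exists i => //.
by have := @pickle_invK I n; rewrite /ocancel E.
Qed.

Lemma measurable_esum (I : countType) d (T : measurableType d) (f : I -> T -> \bar R) :
  (forall i x, 0 <= f i x) -> (forall i, measurable_fun setT (f i)) ->
  measurable_fun setT (fun x => \esum_(i in [set: I]) f i x).
Proof.
move=> f0 mf; under eq_fun do rewrite esum_nat//.
apply: (@ge0_emeasurable_sum _ _ _ _ (fun n x => nat_term (f^~ x) n) xpredT).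
  by move=> n x _ _; rewrite /nat_term; case: pickle_inv => /=.
move=> n _; rewrite /nat_term; case: pickle_inv => [i|] /=; first exact: mf.
exact: measurable_cst.
Qed.

Lemma integral_esum (I : countType) d (T : measurableType d)
    (mu : {measure set T -> \bar R}) (f : I -> T -> \bar R) :
  (forall i x, 0 <= f i x) -> (forall i, measurable_fun setT (f i)) ->
  \int[mu]_x (\esum_(i in [set: I]) f i x) = \esum_(i in [set: I]) \int[mu]_x f i x.
Proof.
move=> f0 mf; rewrite esum_nat; last by move=> i; apply: integral_ge0.
under eq_integral do rewrite esum_nat//.
rewrite integral_nneseries//.
- apply: eq_eseriesr => n _; rewrite /nat_term.
  by case: pickle_inv => [i|] //=; rewrite integral0.
- by move=> n; rewrite /nat_term; case: pickle_inv => [i|] /=; [exact: mf|exact: measurable_cst].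
- by move=> n x _; rewrite /nat_term; case: pickle_inv => /=.
Qed.

Lemma esum_ge_seq (I : choiceType) (a : I -> \bar R) (s : seq I) : uniq s ->
  \sum_(i <- s) a i <= \esum_(i in [set: I]) a i.
Proof.
move=> us; apply: esum_ge; exists [set` s]; first by split=> //; exact: finite_seq.
by rewrite fsbig_seq.
Qed.

Lemma esum_le_seq (I : choiceType) (a : I -> \bar R) (C : \bar R) :
  (forall s : seq I, uniq s -> \sum_(i <- s) a i <= C) ->
  \esum_(i in [set: I]) a i <= C.
Proof.
move=> aC; apply: ge_ereal_sup => _ [X [finX _] <-].
by rewrite fsbig_finite//= aC.
Qed.

End countable_sums.

(** * The unit cube as a fundamental domain *)

Section cube.
Context {R : realType} (l : nat).
Local Open Scope ereal_scope.

Definition cube : set (l.-tuple R) := [set x | forall i, (0 <= tnth x i < 1)%R].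

Lemma measurable_cube : measurable cube.
Proof.
rewrite (_ : cube = \bigcap_(i in [set: 'I_l]) ((@tnth l R)^~ i @^-1` `[0%R, 1%R[)).
  apply: fin_bigcap_measurable => // i _; rewrite -[X in measurable X]setTI.
  exact: measurable_tnth.
by apply/seteqP; split => x /=; [move=> xi i _|move=> xi i]; rewrite ?in_itv/=;
  have := xi i; rewrite ?in_itv //=; apply.
Qed.

Definition fl (x : l.-tuple R) : l.-tuple int := [tuple Num.floor (tnth x i) | i < l].

Lemma cube_shift (x : l.-tuple R) (m : l.-tuple int) :
  cube (tsub x (int_tuple R m)) <-> m = fl x.
Proof.
split=> [h|->].
  apply: eq_from_tnth => i; rewrite tnth_mktuple; apply/esym.
  apply: floor_def; have := h i; rewrite !tnth_mktuple => /andP[h1 h2].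
  by rewrite intrD; apply/andP; split; lra.
move=> i; rewrite !tnth_mktuple.
have := floor_itv (tnth x i); rewrite intrD => /andP[h1 h2].
by apply/andP; split; lra.
Qed.

End cube.
Arguments cube {R} l.

Section cube_measure.
Context (R : realType) (l : nat).
Local Open Scope ereal_scope.

(** Normalized Haar measure of the torus, realized as Lebesgue measure restricted to the unit cube
    but living on the whole space: periodic functions and their translates are integrated without
    restricting their domain. *)
Definition kap : set (l.-tuple R) -> \bar R := mrestr (lebesgueT R l) (@measurable_cube R l).

HB.instance Definition _ := Measure.on kap.

End cube_measure.
Arguments kap : clear implicits.

Lemma lebesgueT_cube (R : realType) l : lebesgueT R l (cube l) = 1%E.
Proof.
elim: l => [|l ih].
  by rewrite /= diracE mem_set// => -[].
have -> : lebesgueT R l.+1 (cube l.+1) =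
  (product_measure1 (@lebesgue_measure R) (lebesgueT R l)) (`[0%R, 1%R[ `*` cube l).
  rewrite /= /pushforward; congr (product_measure1 _ _ _); apply/seteqP; split => -[a t] /=.
    move=> h; split; first by have := h ord0; rewrite tnth0 in_itv.
    by move=> i; have := h (lift ord0 i); rewrite tnthS.
  rewrite in_itv /= => -[ha ht] i; case: (unliftP ord0 i) => [j|] ->.
    by rewrite tnthS.
  by rewrite tnth0.
rewrite product_measure1E//; last exact: measurable_cube.
rewrite [X in (_ * X)%E]ih mule1.
by apply: etrans (lebesgue_measure_itv `[0%R, 1%R[) _; rewrite /= lte01 sube0.
Qed.

Lemma kap_setT (R : realType) l : kap R l setT = 1%E.
Proof. by rewrite /kap /mrestr setTI lebesgueT_cube. Qed.

HB.instance Definition _ (R : realType) l :=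
  Measure_isProbability.Build _ _ _ (kap R l) (kap_setT R l).

Section cube_integral.
Context {R : realType} {l : nat}.
Local Open Scope ereal_scope.
Notation X := (l.-tuple R).
Notation zv := (@int_tuple R l).

Lemma kap_ae : {ae kap R l, forall x, cube l x}.
Proof.
exists (~` cube l); split => //.
  by apply: measurableC; exact: measurable_cube.
by rewrite /kap /mrestr setICl measure0.
Qed.

Lemma ge0_integral_kap (f : X -> \bar R) : measurable_fun setT f ->
  (forall x, 0 <= f x) ->
  \int[kap R l]_x f x = \int[lebesgueT R l]_x (f x * (\1_(cube l) x)%:E).
Proof.
move=> mf f0.
have mC : measurable (~` (@cube R l)) by apply: measurableC; exact: measurable_cube.
have mind : measurable_fun setT (fun x : X => (\1_(cube l) x : R)%:E).
  by apply/measurable_EFinP; exact: measurable_indic (@measurable_cube R l).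
have mfi : measurable_fun setT (fun x => f x * (\1_(cube l) x)%:E).
  exact: emeasurable_funM.
have fi0 x : 0 <= f x * (\1_(cube l) x)%:E by rewrite mule_ge0// lee_fin.
(* Lebesgue measure is the sum of its restrictions to the cube and to the complement, and on the
   latter the integrand vanishes. *)
rewrite [RHS](@eq_measure_integral _ _ _ _ (measure_add (kap R l) (mrestr (lebesgueT R l) mC))); last first.
  move=> A mA _; rewrite [RHS]measure_addE /kap /mrestr /=.
  rewrite -[in LHS](setIT A) -(setUCr (cube l)) setIUr.
  apply: (@measureU _ _ _ (lebesgueT R l)).
  - by apply: measurableI => //; exact: measurable_cube.
  - exact: measurableI.
  - by rewrite setIACA setICr setI0.
rewrite ge0_integral_measure_add//.
rewrite [X in _ + X](@ge0_ae_eq_integral _ _ _ _ _ _ (cst 0))//; last first.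
  exists (cube l); split; first exact: measurable_cube.
    by rewrite /= /mrestr setICr measure0.
  move=> x /= /not_implyP[_]; apply: contra_notP => xc.
  by rewrite indicE memNset// mule0.
rewrite integral_cst// mul0e adde0.
apply: ge0_ae_eq_integral => //.
apply: filterS kap_ae => x xc _.
by rewrite indicE mem_set// mule1.
Qed.

Lemma unfold_integral (f : X -> \bar R) : measurable_fun setT f ->
  (forall x, 0 <= f x) ->
  \int[lebesgueT R l]_x f x =
  \int[kap R l]_x \esum_(m in [set: l.-tuple int]) f (tsub x (zv m)).
Proof.
move=> mf f0.
have mfm m : measurable_fun setT (fun x : X => f (tsub x (zv m))).
  exact: (measurableT_comp mf (measurable_tsub (zv m))).
rewrite integral_esum//.
pose opp (m : l.-tuple int) : l.-tuple int := [tuple (- tnth m i)%R | i < l].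
have taddE (x : X) m : tadd x (zv m) = tsub x (zv (opp m)).
  by apply: eq_from_tnth => i; rewrite !tnth_mktuple rmorphN /= opprK.
have oppK : involutive opp.
  by move=> m; apply: eq_from_tnth => i; rewrite !tnth_mktuple opprK.
(* For fixed x exactly one translate x + m lies in the cube, the one with m = - floor x, so
   inserting the sum of the indicators changes nothing. *)
transitivity (\int[lebesgueT R l]_x
   \esum_(m in [set: l.-tuple int]) (f x * (\1_(cube l) (tadd x (zv m)))%:E)).
  apply: eq_integral => x _.
  rewrite (_ : [set: l.-tuple int] = [set opp (fl x)] `|` ~` [set opp (fl x)]); last first.
    by rewrite setUCr.
  rewrite esum_mkcond (_ : (fun m => _) = fun m => if m \in [set opp (fl x)] then f x else 0).
    by rewrite -esum_mkcond esum_set1.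
  apply/funext => m; rewrite setUCr in_setT.
  have [/set_mem /= ->|] := boolP (m \in _).
    rewrite taddE oppK indicE mem_set ?mule1//.
    exact/cube_shift.
  rewrite notin_setE /= => hm; rewrite indicE memNset ?mule0// => hc.
  by apply: hm; rewrite -(oppK m); congr opp; apply/cube_shift; rewrite -taddE.
have mind : measurable_fun setT (fun x : X => (\1_(cube l) x : R)%:E).
  by apply/measurable_EFinP; exact: measurable_indic (@measurable_cube R l).
have mg m : measurable_fun setT (fun x : X => f x * (\1_(cube l) (tadd x (zv m)))%:E).
  by apply: emeasurable_funM => //; exact: (measurableT_comp mind (measurable_tadd _)).
have g0 m (x : X) : 0 <= f x * (\1_(cube l) (tadd x (zv m)))%:E.
  by rewrite mule_ge0// lee_fin.
rewrite integral_esum//; apply: eq_esum => m _.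
rewrite ge0_integral_kap//.
rewrite -(ge0_integral_lebesgueT_shift (topp (zv m)) (mg m) (g0 m)).
apply: eq_integral => x _; rewrite -/(tsub x (zv m)).
congr (_ * (\1_(cube l) _)%:E).
by apply: eq_from_tnth => i; rewrite !tnth_mktuple subrK.
Qed.

Definition zperiodic (Y : Type) (F : X -> Y) := forall x m, F (tadd x (zv m)) = F x.

Lemma zperiodic_sub (Y : Type) (F : X -> Y) x m : zperiodic F -> F (tsub x (zv m)) = F x.
Proof.
move=> pF; rewrite -(pF _ m); congr F.
by apply: eq_from_tnth => i; rewrite !tnth_mktuple subrK.
Qed.

(** The shifted cube is again a fundamental domain: unfolding the integral over it leaves, for each
    x, only the index m = floor (x - s), and there periodicity gives F x. *)
Lemma ge0_integral_kap_shift (F : X -> \bar R) (s : X) : measurable_fun setT F ->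
  (forall x, 0 <= F x) -> zperiodic F ->
  \int[kap R l]_x F (tadd x s) = \int[kap R l]_x F x.
Proof.
move=> mF F0 pF.
have mFs : measurable_fun setT (fun x => F (tadd x s)).
  exact: (measurableT_comp mF (measurable_tadd s)).
have mind : measurable_fun setT (fun x : X => (\1_(cube l) x : R)%:E).
  by apply/measurable_EFinP; exact: measurable_indic (@measurable_cube R l).
rewrite ge0_integral_kap//.
have mg : measurable_fun setT (fun x => F (tadd x s) * (\1_(cube l) x)%:E).
  exact: emeasurable_funM.
have g0 x : 0 <= F (tadd x s) * (\1_(cube l) x)%:E by rewrite mule_ge0// lee_fin.
rewrite -(ge0_integral_lebesgueT_shift (topp s) mg g0) unfold_integral//; last first.
  exact: (measurableT_comp mg (measurable_tadd _)).
apply: eq_integral => x _.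
have subK (y : X) : tadd (tadd y (topp s)) s = y.
  by apply: eq_from_tnth => i; rewrite !tnth_mktuple subrK.
rewrite (_ : (fun m => _) = fun m => if m \in [set fl (tsub x s)] then F x else 0).
  by rewrite -esum_mkcond esum_set1.
apply/funext => m; rewrite subK (zperiodic_sub _ _ pF).
have swp m' : tadd (tsub x (zv m')) (topp s) = tsub (tsub x s) (zv m').
  by apply: eq_from_tnth => i; rewrite !tnth_mktuple addrAC.
have [/set_mem /= ->|] := boolP (m \in _).
  by rewrite swp indicE mem_set ?mule1//; apply/cube_shift.
rewrite notin_setE /= => hm; rewrite swp indicE memNset ?mule0// => hc.
exact/hm/cube_shift.
Qed.

End cube_integral.

(** * Characters of the torus *)

Section characters.
Context {R : realType} {l : nat}.
Notation X := (l.-tuple R).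
Notation Z := (l.-tuple int).
Notation zv := (@int_tuple R l).

Definition zadd (m n : Z) : Z := [tuple tnth m i + tnth n i | i < l].
Definition zopp (m : Z) : Z := [tuple - tnth m i | i < l].
Definition zsub (m n : Z) : Z := zadd m (zopp n).

Lemma zoppK : involutive zopp.
Proof. by move=> m; apply: eq_from_tnth => i; rewrite !tnth_mktuple opprK. Qed.

Lemma zv_add m n : zv (zadd m n) = tadd (zv m) (zv n).
Proof. by apply: eq_from_tnth => i; rewrite !tnth_mktuple intrD. Qed.

Lemma zv_opp m : zv (zopp m) = topp (zv m).
Proof. by apply: eq_from_tnth => i; rewrite !tnth_mktuple intrN. Qed.

Lemma taddC (x y : X) : tadd x y = tadd y x.
Proof. by apply: eq_from_tnth => i; rewrite !tnth_mktuple addrC. Qed.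

Lemma taddA (x y z : X) : tadd x (tadd y z) = tadd (tadd x y) z.
Proof. by apply: eq_from_tnth => i; rewrite !tnth_mktuple addrA. Qed.

Lemma tsubK (x y : X) : tadd (tsub x y) y = x.
Proof. by apply: eq_from_tnth => i; rewrite !tnth_mktuple subrK. Qed.

Lemma taddK (x y : X) : tsub (tadd x y) y = x.
Proof. by apply: eq_from_tnth => i; rewrite !tnth_mktuple addrK. Qed.

Lemma dotC (x y : X) : dot x y = dot y x.
Proof. by apply: eq_bigr => i _; rewrite mulrC. Qed.

Lemma dotDr (x y z : X) : dot x (tadd y z) = dot x y + dot x z.
Proof. by rewrite -big_split; apply: eq_bigr => i _; rewrite tnth_mktuple mulrDr. Qed.

Lemma dotDl (x y z : X) : dot (tadd y z) x = dot y x + dot z x.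
Proof. by rewrite dotC dotDr !(dotC x). Qed.

Lemma dotNr (x y : X) : dot x (topp y) = - dot x y.
Proof. by rewrite -sumrN; apply: eq_bigr => i _; rewrite tnth_mktuple mulrN. Qed.

Lemma dotNl (x y : X) : dot (topp x) y = - dot x y.
Proof. by rewrite dotC dotNr dotC. Qed.

Lemma dot_zv (m n : Z) : exists k : int, dot (zv m) (zv n) = k%:~R.
Proof.
exists (\sum_(i < l) tnth m i * tnth n i); rewrite rmorph_sum.
by apply: eq_bigr => i _; rewrite !tnth_mktuple -intrM.
Qed.

Definition eu (x y : X) : R[i] := expi (2 * pi * dot x y).

Lemma euC x y : eu x y = eu y x.
Proof. by rewrite /eu dotC. Qed.

Lemma euDl x y z : eu (tadd x y) z = eu x z * eu y z.
Proof. by rewrite /eu dotDl mulrDr expiD. Qed.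

Lemma euDr x y z : eu z (tadd x y) = eu z x * eu z y.
Proof. by rewrite /eu dotDr mulrDr expiD. Qed.

Lemma euNl x y : eu (topp x) y = conjc (eu x y).
Proof. by rewrite /eu dotNl mulrN expiN. Qed.

Lemma euNr x y : eu x (topp y) = conjc (eu x y).
Proof. by rewrite /eu dotNr mulrN expiN. Qed.

Lemma eu_zv m n : eu (zv m) (zv n) = 1.
Proof. by rewrite /eu; have [k ->] := dot_zv m n; rewrite expi_2pi_int. Qed.

Lemma nsq_eu x y : nsq (eu x y) = 1.
Proof. exact: nsq_expi. Qed.

Lemma euV x y : eu x y * conjc (eu x y) = 1.
Proof. by rewrite mul_conjc nsq_eu. Qed.

Lemma measurable_dot d (T : measurableType d) (f g : T -> X) :
  measurable_fun setT f -> measurable_fun setT g ->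
  measurable_fun setT (fun t => dot (f t) (g t)).
Proof.
move=> mf mg; apply: measurable_sum => i; apply: measurable_funM.
  exact: (measurableT_comp (measurable_tnth i) mf).
exact: (measurableT_comp (measurable_tnth i) mg).
Qed.

Lemma cmeas_eu d (T : measurableType d) (f g : T -> X) :
  measurable_fun setT f -> measurable_fun setT g ->
  cmeas (fun t => eu (f t) (g t)).
Proof.
move=> mf mg; apply: cmeas_expi; apply: measurable_funM => //.
exact: measurable_dot.
Qed.

Definition ch (m : Z) (y : X) : R[i] := eu (zv m) y.

Lemma chD m n y : ch (zadd m n) y = ch m y * ch n y.
Proof. by rewrite /ch zv_add euDl. Qed.

Lemma chN m y : ch (zopp m) y = conjc (ch m y).
Proof. by rewrite /ch zv_opp euNl. Qed.

Lemma chB m n y : ch (zsub m n) y = ch m y * conjc (ch n y).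
Proof. by rewrite chD chN. Qed.

Lemma ch_zv m n : ch m (zv n) = 1.
Proof. exact: eu_zv. Qed.

Lemma ch_period m y n : ch m (tadd y (zv n)) = ch m y.
Proof. by rewrite /ch euDr eu_zv mulr1. Qed.

Lemma nsq_ch m y : nsq (ch m y) = 1.
Proof. exact: nsq_eu. Qed.

Lemma ch0 y : ch [tuple 0 | i < l] y = 1.
Proof.
rewrite /ch /eu /dot big1 ?mulr0 ?expi0// => i _.
by rewrite !tnth_mktuple mul0r.
Qed.

Lemma cmeas_ch m : cmeas (ch m).
Proof. by apply: cmeas_eu => //; exact: measurable_cst. Qed.

Lemma N2_kap_unit (f : X -> R[i]) : (forall x, nsq (f x) = 1) -> N2 (kap R l) f = 1%E.
Proof.
move=> f1; rewrite /N2; under eq_integral do rewrite f1.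
by rewrite integral_cst//= mul1e probability_setT.
Qed.

Lemma L2_kap_unit (f : X -> R[i]) : cmeas f -> (forall x, nsq (f x) = 1) ->
  L2 (kap R l) f.
Proof. by move=> mf f1; split => //; rewrite N2_kap_unit// ltry. Qed.

Lemma L2_ch m : L2 (kap R l) (ch m).
Proof. by apply: L2_kap_unit; [exact: cmeas_ch|exact: nsq_ch]. Qed.

Lemma integral_kap_shift (F : X -> \bar R) (s : X) : measurable_fun setT F ->
  zperiodic F ->
  (\int[kap R l]_x F (tadd x s) = \int[kap R l]_x F x)%E.
Proof.
move=> mF pF; rewrite [LHS]integralE [RHS]integralE.
congr (_ - _)%E.
  transitivity (\int[kap R l]_x (F^\+)%E (tadd x s))%E.
    by apply: eq_integral => x _; rewrite !funeposE.
  apply: (ge0_integral_kap_shift s (F := F^\+%E)); first exact: measurable_funepos.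
    by move=> x; exact: funepos_ge0.
  by move=> x m; rewrite !funeposE pF.
transitivity (\int[kap R l]_x (F^\-)%E (tadd x s))%E.
  by apply: eq_integral => x _; rewrite !funenegE.
apply: (ge0_integral_kap_shift s (F := F^\-%E)); first exact: measurable_funeneg.
  by move=> x; exact: funeneg_ge0.
by move=> x m; rewrite !funenegE pF.
Qed.

Lemma cint_kap_shift (f : X -> R[i]) (s : X) : cmeas f -> zperiodic f ->
  cint (kap R l) (fun x => f (tadd x s)) = cint (kap R l) f.
Proof.
move=> [m1 m2] pf; apply: eq_ReIm; rewrite /= /Rintegral; congr fine.
  apply: (integral_kap_shift s (F := fun x => (complex.Re (f x))%:E)).
    exact/measurable_EFinP.
  by move=> x m; rewrite pf.
apply: (integral_kap_shift s (F := fun x => (complex.Im (f x))%:E)).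
  exact/measurable_EFinP.
by move=> x m; rewrite pf.
Qed.

Lemma ch_eqN1 k : k != [tuple 0 | i < l] -> exists s, ch k s = -1.
Proof.
move=> k0; have [i ki] : exists i, tnth k i != 0.
  apply/existsP; rewrite -negb_forall; apply/negP => /forallP h.
  move/eqP: k0; apply; apply: eq_from_tnth => i.
  by have /eqP := h i; rewrite !tnth_mktuple.
(* The nonzero coordinate k_i is paired with 1 / (2 k_i), so that k.s = 1/2. *)
pose s : X := [tuple if j == i then (2 * (tnth k i)%:~R)^-1 else 0 | j < l].
exists s; rewrite /ch /eu (_ : dot _ _ = 2^-1).
  by rewrite mulrAC mulfV ?pnatr_eq0// mul1r expi_pi.
rewrite /dot (bigD1 i)//= big1 ?addr0; last first.
  by move=> j ji; rewrite !tnth_mktuple (negbTE ji) mulr0.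
have -> : tnth (zv k) i = (tnth k i)%:~R by rewrite tnth_mktuple.
have -> : tnth s i = (2 * (tnth k i)%:~R)^-1 by rewrite tnth_mktuple eqxx.
by rewrite invfM mulrCA mulfV ?mulr1// intr_eq0.
Qed.

Lemma zsub_neq0 m n : m != n -> zsub m n != [tuple 0 | i < l].
Proof.
apply: contraNneq => h; apply/eqP; apply: eq_from_tnth => i.
by have /(congr1 (fun k => tnth k i)) := h; rewrite !tnth_mktuple => /eqP; rewrite subr_eq0 => /eqP.
Qed.

Lemma eq_opp0 (z : R[i]) : z = - z -> z = 0.
Proof. by move/eqP; rewrite -addr_eq0 -mulr2n mulrn_eq0 /= => /eqP. Qed.

(* Translating by a point where the nontrivial character is -1 changes the sign
   of its integral. *)
Lemma ch_orthogonal m n : ip (kap R l) (ch m) (ch n) = (m == n)%:R.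
Proof.
have [->|mn] := eqVneq m n.
  by rewrite ip_self N2_kap_unit; [|exact: nsq_ch].
pose k := zsub m n.
have -> : ip (kap R l) (ch m) (ch n) = cint (kap R l) (ch k).
  by apply: eq_cint => x; rewrite chB.
have [s es] := ch_eqN1 (zsub_neq0 mn).
apply: eq_opp0; rewrite -[LHS](cint_kap_shift s (cmeas_ch k) (ch_period k)).
rewrite -mulN1r -cintZ.
  by apply: eq_cint => x; rewrite -es /ch euDr mulrC.
apply: (@le_cintegrable _ _ _ _ _ (fun=> 1)); first exact: cmeas_ch.
  by move=> x; rewrite normc_sqrt nsq_ch sqrtr1.
exact: finite_measure_integrable_cst.
Qed.

End characters.

(** * Weighted density of trigonometric polynomials *)

Section step_function.
Context {R : realType}.
Implicit Types s t u : R.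

Lemma bernoulli_lower u (k : nat) : 0 <= u <= 1 -> 1 - k%:R * u <= (1 - u) ^+ k.
Proof.
move=> /andP[u0 u1]; elim: k => [|k ih]; first by rewrite mul0r subr0 expr0.
rewrite exprSr (le_trans _ (ler_wpM2r _ ih)) ?subr_ge0//.
rewrite -natr1; have k0 : 0 <= k%:R * (u * u) by rewrite mulr_ge0 ?mulr_ge0.
by nra.
Qed.

(** (1 + u)^k >= 1 + k u, and (1 - u) (1 + u) <= 1. *)
Lemma bernoulli_upper u (k : nat) : 0 <= u <= 1 -> (1 - u) ^+ k * (1 + k%:R * u) <= 1.
Proof.
move=> /andP[u0 u1].
have h : 1 + k%:R * u <= (1 + u) ^+ k.
  elim: k => [|k ih]; first by rewrite mul0r addr0 expr0.
  rewrite exprSr (le_trans _ (ler_wpM2r _ ih)) ?addr_ge0//.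
  rewrite -natr1; have k0 : 0 <= k%:R * (u * u) by rewrite mulr_ge0 ?mulr_ge0.
  by nra.
rewrite (le_trans (ler_wpM2l _ h)) ?exprn_ge0 ?subr_ge0//.
rewrite -exprMn exprn_ile1//; nra.
Qed.

(** 1 - t^n is 1 - t times a sum of n powers of t, each at least t^n. For t < 1 this bounds n t^n
    uniformly in n. *)
Lemma mulrn_exp_le t (n : nat) : 0 <= t <= 1 -> n%:R * t ^+ n * (1 - t) <= 1 - t ^+ n.
Proof.
move=> /andP[t0 t1]; elim: n => [|n ih]; first by rewrite !mul0r expr0 subrr.
have p0 : 0 <= t ^+ n by rewrite exprn_ge0.
have p1 : t ^+ n <= 1 by rewrite exprn_ile1.
rewrite exprSr -natr1.
have h2 : t ^+ n * t * (1 - t) <= 1 * (1 - t).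
  by rewrite ler_wpM2r ?subr_ge0// mulr_ile1.
nra.
Qed.

(* The exponents make n 2^n s^n tend to 0 or to +oo according to whether
   s < 1/2 or not; s = 1/2 falls in the second case. *)
Lemma step_cvg s : 0 <= s <= 1 ->
  (fun n => (1 - s ^+ n) ^+ (n * 2 ^ n)%N) @ \oo --> ((s < 2^-1)%R%:R : R).
Proof.
move=> /andP[s0 s1].
have u01 n : 0 <= s ^+ n <= 1 by rewrite exprn_ge0//= exprn_ile1.
have kE n : (n * 2 ^ n)%:R * s ^+ n = n%:R * (2 * s) ^+ n :> R.
  by rewrite natrM natrX exprMn mulrA.
have [s2|s2] /= := ltP s 2^-1.
(* The root splits n (2 s)^n into t^n times n t^n, and the latter stays below 1 / (1 - t). *)
- pose t := Num.sqrt (2 * s).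
  have t2 : t ^+ 2 = 2 * s by rewrite sqr_sqrtr// mulr_ge0.
  have t0 : 0 <= t by rewrite sqrtr_ge0.
  have t1 : t < 1 by rewrite -(@ltr_pXn2r _ 2%N)// ?nnegrE// t2 expr1n; lra.
  apply: (@squeeze_cvgr _ _ _ _ (fun n => 1 - t ^+ n * (1 - t)^-1) (cst 1)).
  + apply: nearW => n; apply/andP; split; last first.
      by rewrite exprn_ile1 ?subr_ge0 ?lerBlDr ?lerDl; case/andP: (u01 n).
    rewrite (le_trans _ (bernoulli_lower (n * 2 ^ n) (u01 n)))// lerD2l lerN2 kE -t2 exprAC.
    rewrite expr2 mulrA mulrC ler_wpM2l ?exprn_ge0//.
    rewrite -[leRHS]mul1r ler_pdivlMr ?subr_gt0//.
    rewrite (le_trans (mulrn_exp_le n _)) ?t0 ?(ltW t1)//.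
    by rewrite lerBlDr lerDl exprn_ge0.
  + rewrite -[X in _ --> X]subr0; apply: cvgB; first exact: cvg_cst.
    rewrite -[X in _ --> X](mul0r (1 - t)^-1); apply: cvgMl.
    by apply: cvg_expr; rewrite ger0_norm.
  + exact: cvg_cst.
- apply: (@squeeze_cvgr _ _ _ _ (cst 0) (@harmonic R)).
  + apply: nearW => n; apply/andP; split.
      by rewrite exprn_ge0// subr_ge0; case/andP: (u01 n).
    rewrite /harmonic /= -[leRHS]mul1r ler_pdivlMr//.
    rewrite (le_trans _ (bernoulli_upper (n * 2 ^ n) (u01 n)))//.
    rewrite ler_wpM2l ?exprn_ge0 ?subr_ge0//; first by case/andP: (u01 n).
    rewrite kE -natr1 addrC lerD2l ler_peMr// exprn_ege1//; lra.
  + exact: cvg_cst.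
  + exact: cvg_harmonic.
Qed.

(** The arc from 0 to t is centred at t / 2 and has angular half-width a = pi t. The angle y runs
    over [-a, 2 pi - a) and is brought to [0, pi], where cosine decreases, by y -> - y or y -> 2 pi
    - y. *)
Lemma cos_arc (x t : R) : 0 <= x < 1 -> 0 < t < 1 ->
  (cos (pi * t) < cos (2 * pi * (x - t / 2))) = (0 < x < t).
Proof.
move=> /andP[x0 x1] /andP[t0 t1].
have pi0 := @pi_gt0 R.
set a := pi * t; set y := 2 * pi * (x - t / 2).
have ay : y = 2 * pi * x - a by rewrite /y /a; field.
have a0 : 0 < a by rewrite mulr_gt0.
have api : a < pi by rewrite -[ltRHS]mulr1 ltr_pM2l.
have px0 : 0 <= pi * x by rewrite mulr_ge0// ltW.
have px1 : pi * x < pi by rewrite -[ltRHS]mulr1 ltr_pM2l.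
have cosl (u v : R) : 0 <= u <= pi -> 0 <= v <= pi -> (cos u < cos v) = (v < u).
  by move=> hu hv; rewrite ltr_cos// in_itv.
have xt : (x < t) = (pi * x < a) by rewrite ltr_pM2l.
have xp : (0 < x) = (0 < pi * x) by rewrite pmulr_rgt0.
rewrite xt xp.
have [y0|y0] := ltP y 0.
  rewrite -(cosN y) cosl; [|lra|lra].
  by apply/idP/idP => [h|/andP[h1 h2]]; [apply/andP; split|]; lra.
have [yp|yp] := leP y pi.
  rewrite cosl; [|lra|lra].
  by apply/idP/idP => [h|/andP[h1 h2]]; [apply/andP; split|]; lra.
have -> : cos y = cos (2 * pi - y).
  rewrite -[in RHS]cosN opprB -(cosD2pi (y - 2 * pi)); congr cos.
  by rewrite mulrC -mulr_natr; lra.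
rewrite cosl; [|lra|lra].
by apply/idP/idP => [h|/andP[h1 h2]]; [apply/andP; split|]; lra.
Qed.

Lemma cos_lt1 (x : R) : 0 <= x < 1 -> (cos (2 * pi * x) < 1) = (x != 0).
Proof.
move=> /andP[x0 x1]; have pi0 := @pi_gt0 R.
have [->|xn0] := eqVneq x 0; first by rewrite mulr0 cos0 ltxx.
have xp : 0 < x by rewrite lt_neqAle eq_sym xn0.
have px0 : 0 < pi * x by rewrite mulr_gt0.
have px1 : pi * x < pi by rewrite -[ltRHS]mulr1 ltr_pM2l.
rewrite /=; set y := 2 * pi * x.
have ey : y = 2 * (pi * x) by rewrite /y mulrA.
have cosl (v : R) : 0 < v <= pi -> cos v < 1.
  move=> hv; rewrite -[ltRHS]cos0 ltr_cos ?in_itv/=; lra.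
have [yp|yp] := leP y pi; first by rewrite cosl//; lra.
have -> : cos y = cos (2 * pi - y).
  rewrite -[in RHS]cosN opprB -(cosD2pi (y - 2 * pi)); congr cos.
  by rewrite mulrC -mulr_natr; lra.
by rewrite cosl//; lra.
Qed.

End step_function.

Lemma measurable_lt_set {R : realType} d (T : measurableType d) (f g : T -> R) :
  measurable_fun setT f -> measurable_fun setT g -> measurable [set x | f x < g x].
Proof.
move=> mf mg; have mt : measurable [set true] by [].
have := measurable_fun_ltr mf mg measurableT mt.
by rewrite setTI; congr (measurable _); apply/seteqP; split => x //=; case: (_ < _).
Qed.

Section dominated.
Context {R : realType} d (T : measurableType d) (mu : {measure set T -> \bar R}).

Lemma ge0_dominated_cvg0 (u : nat -> T -> R) (h : T -> R) :
  (forall n, measurable_fun setT (u n)) ->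
  mu.-integrable setT (fun x => (h x)%:E) ->
  (forall n x, 0 <= u n x <= h x) ->
  {ae mu, forall x, u n x @[n --> \oo] --> (0 : R)} ->
  (fun n => \int[mu]_x (u n x)%:E)%E @ \oo --> 0%E.
Proof.
move=> mu_ ih uh u0.
have cv : {ae mu, forall x, setT x -> (u n x)%:E @[n --> \oo] --> 0%E}.
  by apply: filterS u0 => x ux _; apply: cvg_EFin => //; exact: nearW.
have bd : {ae mu, forall x n, setT x -> (`|(u n x)%:E| <= (h x)%:E)%E}.
  by apply: aeW => x n _; rewrite gee0_abs ?lee_fin//; case/andP: (uh n x).
have me n : measurable_fun setT (fun x => (u n x)%:E) by exact/measurable_EFinP.
have [_ _] := dominated_convergence measurableT me (measurable_cst 0%E) cv ih bd.
by rewrite integral0.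
Qed.

Lemma N2_dominated_cvg0 (u : nat -> T -> R[i]) (h : T -> R) :
  (forall n, cmeas (u n)) ->
  mu.-integrable setT (fun x => (h x)%:E) ->
  (forall n x, nsq (u n x) <= h x) ->
  {ae mu, forall x, nsq (u n x) @[n --> \oo] --> (0 : R)} ->
  (fun n => N2 mu (u n)) @ \oo --> 0%E.
Proof.
move=> mu_ ih uh u0; apply: (ge0_dominated_cvg0 (u := fun n x => nsq (u n x)) _ ih) => //.
- by move=> n; exact: measurable_nsq.
- by move=> n x; rewrite nsq_ge0 uh.
Qed.

End dominated.

Import HBNNSimple.

(** * Density in a weighted L^2 space of an algebra of bounded functions *)

Section density.
Context {R : realType} d (T : measurableType d) (mu : {measure set T -> \bar R}).
Variables (W : T -> R[i]) (A : (T -> R[i]) -> Prop).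
Hypothesis lW : L2 mu W.
Hypothesis A_meas : forall P, A P -> cmeas P.
Hypothesis A_bdd : forall P, A P -> exists M, forall x, nsq (P x) <= M.
Hypothesis A_cst : forall c, A (fun=> c).
Hypothesis A_D : forall P Q, A P -> A Q -> A (fun x => P x + Q x).
Hypothesis A_M : forall P Q, A P -> A Q -> A (fun x => P x * Q x).
Implicit Types f g : T -> R[i].

(** Two weights are used: W = 1 for the completeness of the characters, and |W|^2 = 1 + |G|^2 to
    control a polynomial and its product with the Zak transform at once. *)
Definition apx f : Prop := cmeas f /\
  forall e : R, 0 < e -> exists2 P, A P &
    (N2 mu (fun x => (W x * (f x - P x))%R) < e%:E)%E.

Lemma A_apx P : A P -> apx P.
Proof.
move=> AP; split; first exact: A_meas.
move=> e e0; exists P => //; rewrite (_ : (fun _ => _) = fun=> 0).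
  by rewrite N2_eq0 lte_fin.
by apply/funext => x; rewrite subrr mulr0.
Qed.

Lemma apxD f g : apx f -> apx g -> apx (fun x => f x + g x).
Proof.
move=> [mf af] [mg ag]; split; first exact: cmeasD.
move=> e e0; have e4 : 0 < e / 4 by rewrite divr_gt0.
have [P AP hP] := af _ e4; have [Q AQ hQ] := ag _ e4.
exists (fun x => P x + Q x); first exact: A_D.
rewrite (@eq_N2 _ _ _ _ _ (fun x => W x * (f x - P x) + W x * (g x - Q x))); last first.
  by move=> x; ring.
have [mP mQ] := (A_meas AP, A_meas AQ).
rewrite (le_lt_trans (N2D _ _ _))//.
- by apply: cmeasM; [exact: lW.1|exact: cmeasB].
- by apply: cmeasM; [exact: lW.1|exact: cmeasB].
have -> : e%:E = (2%:E * (e / 4)%:E + 2%:E * (e / 4)%:E)%E.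
  by rewrite -!EFinM -EFinD; congr EFin; field.
by rewrite lteD// lte_pmul2l.
Qed.

Lemma N2_scale_le M f g : 0 <= M -> cmeas f -> cmeas g ->
  (forall x, nsq (f x) <= M) ->
  (N2 mu (fun x => (f x * g x)%R) <= M%:E * N2 mu g)%E.
Proof.
move=> M0 mf mg fM.
have -> : (M%:E = (nsq (Num.sqrt M)%:C%C)%:E)%E by rewrite nsq_real sqr_sqrtr.
rewrite -N2Z//; apply: N2_le; [exact: cmeasM|exact: cmeasZ|].
by move=> x; rewrite !nsqM nsq_real sqr_sqrtr// ler_wpM2r// nsq_ge0.
Qed.

Lemma apxM M f g : (forall x, nsq (f x) <= M) -> apx f -> apx g ->
  apx (fun x => f x * g x).
Proof.
move=> fM [mf af] [mg ag]; split; first exact: cmeasM.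
move=> e e0; pose M1 := Num.max M 1.
have M10 : 0 < M1 by rewrite lt_max ltr01 orbT.
have e4 : 0 < e / 4 / M1 by rewrite !divr_gt0.
(* Q is taken first, since the precision demanded of P depends on the bound of Q in f g - P Q = f (g
   - Q) + Q (f - P). *)
have [Q AQ hQ] := ag _ e4.
have [M2' QM2'] := A_bdd AQ; pose M2 := Num.max M2' 1.
have M20 : 0 < M2 by rewrite lt_max ltr01 orbT.
have e5 : 0 < e / 4 / M2 by rewrite !divr_gt0.
have [P AP hP] := af _ e5.
have [mP mQ] := (A_meas AP, A_meas AQ).
exists (fun x => P x * Q x); first exact: A_M.
rewrite (@eq_N2 _ _ _ _ _ (fun x => f x * (W x * (g x - Q x)) + Q x * (W x * (f x - P x)))); last first.
  by move=> x; ring.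
have m1 : cmeas (fun x => W x * (g x - Q x)) by apply: cmeasM; [exact: lW.1|exact: cmeasB].
have m2 : cmeas (fun x => W x * (f x - P x)) by apply: cmeasM; [exact: lW.1|exact: cmeasB].
rewrite (le_lt_trans (N2D _ _ _))//; try exact: cmeasM.
have -> : e%:E = (2%:E * (M1%:E * (e / 4 / M1)%:E) + 2%:E * (M2%:E * (e / 4 / M2)%:E))%E.
  by rewrite -!EFinM -EFinD; congr EFin; field; rewrite !gt_eqF.
rewrite lteD// lte_pmul2l//.
  rewrite (le_lt_trans (N2_scale_le (ltW M10) _ _ _))//.
    by move=> x; rewrite (le_trans (fM x))// le_max lexx.
  by rewrite lte_pmul2l.
rewrite (le_lt_trans (N2_scale_le (ltW M20) _ _ _))//.
  by move=> x; rewrite (le_trans (QM2' x))// le_max lexx.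
by rewrite lte_pmul2l.
Qed.

Lemma apx_cvg (fn : nat -> T -> R[i]) f : cmeas f -> (forall n, apx (fn n)) ->
  (fun n => N2 mu (fun x => W x * (fn n x - f x))) @ \oo --> 0%E -> apx f.
Proof.
move=> mf afn cvg; split => // e e0.
have mfn n : cmeas (fn n) by case: (afn n).
have e4 : 0 < e / 4 by rewrite divr_gt0.
have [n hn] : exists n, (N2 mu (fun x => (W x * (fn n x - f x))%R) < (e / 4)%:E)%E.
  move/fine_cvgP : cvg => [fin /cvgrPdist_lt /(_ _ e4) h].
  near \oo => n; exists n.
  have finn : N2 mu (fun x => W x * (fn n x - f x)) \is a fin_num by near: n.
  rewrite -(fineK finn) lte_fin.
  have : `|0 - fine (N2 mu (fun x => W x * (fn n x - f x)))| < e / 4 by near: n.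
  by rewrite sub0r normrN ger0_norm// fine_ge0// N2_ge0.
have [P AP hP] := (afn n).2 _ e4; exists P => //.
rewrite (@eq_N2 _ _ _ _ _ (fun x => W x * (fn n x - P x) + - (W x * (fn n x - f x)))); last first.
  by move=> x; ring.
have m1 : cmeas (fun x => W x * (fn n x - f x)) by apply: cmeasM; [exact: lW.1|exact: cmeasB].
have m1' : cmeas (fun x => - (W x * (fn n x - f x))).
  by under eq_fun do rewrite -mulN1r; exact: cmeasZ.
have m2 : cmeas (fun x => W x * (fn n x - P x)).
  by apply: cmeasM; [exact: lW.1|apply: cmeasB => //; exact: A_meas].
rewrite (le_lt_trans (N2D _ m2 m1'))// N2N.
have -> : e%:E = (2%:E * (e / 4)%:E + 2%:E * (e / 4)%:E)%E.
  by rewrite -!EFinM -EFinD; congr EFin; field.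
by rewrite lteD// lte_pmul2l.
Unshelve. all: by end_near. Qed.

Lemma apx_lim M (fn : nat -> T -> R[i]) f : cmeas f ->
  (forall n x, nsq (fn n x - f x) <= M) -> (forall n, apx (fn n)) ->
  {ae mu, forall x, nsq (fn n x - f x) @[n --> \oo] --> (0 : R)} -> apx f.
Proof.
move=> mf fM afn cv; apply: (apx_cvg mf afn).
have mfn n : cmeas (fn n) by case: (afn n).
apply: (@N2_dominated_cvg0 _ _ _ _ _ (fun x => M * nsq (W x))).
- by move=> n; apply: cmeasM; [exact: lW.1|exact: cmeasB].
- have := integrableZl measurableT M (nsq_integrable lW).
  by apply: eq_integrable => // x _; rewrite EFinM.
- by move=> n x; rewrite nsqM mulrC ler_wpM2r// nsq_ge0.
- apply: filterS cv => x cx.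
  have -> : (fun n => nsq (W x * (fn n x - f x))) =
    (fun n => nsq (W x) * nsq (fn n x - f x)) by apply/funext => n; rewrite nsqM.
  have -> : (0 : R) = nsq (W x) * 0 by rewrite mulr0.
  by apply: cvgM => //; exact: cvg_cst.
Qed.

Definition cind (E : set T) : T -> R[i] := fun x => ((\1_E x)%:C)%C.

Lemma nsq_cind E x : nsq (cind E x) = \1_E x.
Proof. by rewrite nsq_real indicE; case: (_ \in _); rewrite ?expr1n ?expr0n. Qed.

Lemma cmeas_cind E : measurable E -> cmeas (cind E).
Proof. by move=> mE; apply: cmeas_real; exact: measurable_indic. Qed.

Lemma nsq_cind_le1 E x : nsq (cind E x) <= 1.
Proof. by rewrite nsq_cind indicE; case: (_ \in _). Qed.

Lemma nsq_cindB_le1 E F x : nsq (cind E x - cind F x) <= 1.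
Proof.
rewrite /cind !indicE; case: (x \in E); case: (x \in F);
  by rewrite ?subrr ?subr0 ?sub0r ?nsqN ?nsq0 ?nsq1.
Qed.

Definition apx_set : set (set T) := [set E | measurable E /\ apx (cind E)].

Lemma apx_setI E F : apx_set E -> apx_set F -> apx_set (E `&` F).
Proof.
move=> [mE aE] [mF aF]; split; first exact: measurableI.
rewrite (_ : cind _ = fun x => cind E x * cind F x).
  exact: (apxM (nsq_cind_le1 E)).
by apply/funext => x; rewrite /cind indicI -rmorphM.
Qed.

Lemma apx_setC E : apx_set E -> apx_set (~` E).
Proof.
move=> [mE aE]; split; first exact: measurableC.
rewrite (_ : cind _ = fun x => 1 + (-1) * cind E x).
  apply: apxD; first exact: A_apx.
  by apply: (@apxM 1) => //; [move=> x; rewrite nsqN nsq1|exact: A_apx].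
apply/funext => x; rewrite /cind indicC indicE; case: (x \in E) => /=.
  by rewrite mulr1 subrr.
by rewrite mulr0 addr0.
Qed.

Lemma apx_setU E F : apx_set E -> apx_set F -> apx_set (E `|` F).
Proof.
move=> aE aF; rewrite -(setCK (E `|` F)) setCU.
by apply: apx_setC; apply: apx_setI; exact: apx_setC.
Qed.

Lemma apx_set_ae E F : apx_set E -> measurable F ->
  {ae mu, forall x, E x <-> F x} -> apx_set F.
Proof.
move=> [mE aE] mF EF; split => //.
apply: (@apx_lim 1 (fun=> cind E)) => //; first exact: cmeas_cind.
- by move=> _ x; exact: nsq_cindB_le1.
- apply: filterS EF => x EFx; rewrite (_ : cind E x = cind F x).
    by rewrite subrr nsq0; exact: cvg_cst.
  rewrite /cind !indicE; congr ((_%:R)%:C)%C; congr nat_of_bool.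
  by apply/idP/idP; rewrite !inE => /EFx.
Qed.

Lemma apx_set0 : apx_set set0.
Proof.
split => //; rewrite (_ : cind _ = fun=> 0); first exact: A_apx.
by apply/funext => x; rewrite /cind indic0.
Qed.

Lemma apx_bigcup (F : nat -> set T) : (forall n, apx_set (F n)) ->
  apx_set (\bigcup_n F n).
Proof.
move=> aF; have mF : measurable (\bigcup_n F n).
  by apply: bigcup_measurable => n _; case: (aF n).
have aU n : apx_set (\big[setU/set0]_(i < n) F i).
  elim: n => [|n ih]; first by rewrite big_ord0; exact: apx_set0.
  by rewrite big_ord_recr; apply: apx_setU.
split => //; apply: (@apx_lim 1 (fun n => cind (\big[setU/set0]_(i < n) F i))).
- exact: cmeas_cind.
- by move=> n x; exact: nsq_cindB_le1.
- by move=> n; case: (aU n).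
- apply: aeW => x.
  have [[k _ Fkx]|nF] := pselect ((\bigcup_n F n) x).
    apply: cvg_near_cst.
    near=> n; have h1 : (\bigcup_n F n) x by exists k.
    have h2 : (\big[setU/set0]_(i < n) F i) x.
      by rewrite -bigcup_mkord; exists k => //=; near: n; exact: nbhs_infty_gt.
    by rewrite /cind !indicE (mem_set h1) (mem_set h2) subrr nsq0.
  apply: cvg_near_cst; apply: nearW => n.
  have h2 : ~ (\big[setU/set0]_(i < n) F i) x.
    by rewrite -bigcup_mkord => -[k _ Fkx]; apply: nF; exists k.
  by rewrite /cind !indicE (memNset nF) (memNset h2) subrr nsq0.
Unshelve. all: by end_near. Qed.

(** Products of indicators give intersections, 1 minus an indicator gives complements, and dominated
    convergence passes from finite to countable unions. *)
Lemma sigma_algebra_apx_set : sigma_algebra setT apx_set.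
Proof.
split; [exact: apx_set0| |exact: apx_bigcup].
by move=> E aE; rewrite setTD; exact: apx_setC.
Qed.

Lemma A_X P n : A P -> A (fun x => P x ^+ n).
Proof.
move=> AP; elim: n => [|n ih]; first by under eq_fun do rewrite expr0; exact: A_cst.
by under eq_fun do rewrite exprS; exact: A_M.
Qed.

Lemma apx_level (s : T -> R) (c : R) : (forall x, -1 <= s x <= 1) -> -1 <= c <= 1 ->
  A (fun x => (s x)%:C%C) -> measurable_fun setT s -> apx_set [set x | c < s x].
Proof.
move=> s1 c1 As ms.
have mE : measurable [set x | c < s x].
  exact: measurable_lt_set.
split => //.
(* (s - c) / 4 lies in [-1/2, 1/2], so t takes values in [0, 1] and c < s becomes t < 1/2, the
   threshold of [step_cvg]. *)
pose t x := 2^-1 - (s x - c) / 4.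
have t01 x : 0 <= t x <= 1 by rewrite /t; have := s1 x; lra.
have At : A (fun x => (t x)%:C%C).
  rewrite (_ : (fun x => (t x)%:C%C) =
    fun x => ((2^-1 + c / 4)%:C%C : R[i]) + ((- 4^-1)%:C%C : R[i]) * (s x)%:C%C).
    by apply: A_D => //; apply: A_M.
  by apply/funext => x; rewrite -rmorphM -rmorphD; congr (_%:C%C); rewrite /t; field.
pose fn n x : R[i] := ((1 - t x ^+ n) ^+ (n * 2 ^ n)%N)%:C%C.
have Afn n : A (fn n).
  rewrite (_ : fn n = fun x => (1 + (-1) * (t x)%:C%C ^+ n) ^+ (n * 2 ^ n)%N).
    by apply: A_X; apply: A_D => //; apply: A_M => //; exact: A_X.
  by apply/funext => x; rewrite /fn rmorphXn rmorphB rmorphXn rmorph1 mulN1r.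
have cindE x : cind [set x | c < s x] x = ((t x < 2^-1)%R%:R)%:C%C.
  rewrite /cind indicE; congr ((_%:R)%:C)%C; congr nat_of_bool.
  by apply/idP/idP; rewrite !inE /= /t => ?; lra.
apply: (@apx_lim 1 fn) => //; first exact: cmeas_cind.
- move=> n x; rewrite cindE -rmorphB nsq_real.
  have : 0 <= (1 - t x ^+ n) ^+ (n * 2 ^ n)%N <= 1.
    have h : 0 <= 1 - t x ^+ n <= 1.
      by have /andP[a b] := t01 x; rewrite subr_ge0 exprn_ile1//= lerBlDr lerDl exprn_ge0.
    by case/andP: h => h1 h2; rewrite exprn_ge0//= exprn_ile1.
  by case: (_ < _) => /=; nra.
- by move=> n; exact: A_apx.
- apply: aeW => x; have := step_cvg (t01 x) => h.
  rewrite (_ : (fun n => _) = fun n =>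
     ((1 - t x ^+ n) ^+ (n * 2 ^ n)%N - (t x < 2^-1)%R%:R) *
     ((1 - t x ^+ n) ^+ (n * 2 ^ n)%N - (t x < 2^-1)%R%:R)); last first.
    by apply/funext => n; rewrite cindE -rmorphB nsq_real expr2.
  rewrite -[X in _ --> X](mulr0 0); apply: cvgM;
    by apply/subr_cvg0.
Qed.

Variables (J : Type) (p : J -> T -> R).
Hypothesis mp : forall j, measurable_fun setT (p j).
Hypothesis p01 : forall j, {ae mu, forall x, 0 <= p j x < 1}.
Hypothesis Acos : forall j c, A (fun x => (cos (2 * pi * (p j x - c)))%:C%C).
Hypothesis gen : forall M : set (set T), sigma_algebra setT M ->
  (forall j B, measurable B -> M (p j @^-1` B)) -> measurable `<=` M.

(* On [0, 1) the set p < t is an open arc, hence a superlevel set of a cosine,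
   together with the point 0. *)
Lemma apx_coord_lt j (t : R) : apx_set [set x | p j x < t].
Proof.
have mE : measurable [set x | p j x < t].
  exact: (measurable_lt_set (g := cst t)).
have mcos c : measurable_fun setT (fun x => cos (2 * pi * (p j x - c))).
  by have [] := A_meas (Acos j c).
have cos1 (x : R) : -1 <= cos x <= 1 by rewrite cos_geN1 cos_le1.
have [t0|t0] := leP t 0.
  apply: (apx_set_ae apx_set0) => //.
  apply: filterS (p01 j) => x xj; split => //= xt.
  by case/andP: xj => x0 _; have := lt_le_trans xt t0; rewrite ltNge x0.
have [t1|t1] := leP 1 t.
  apply: (@apx_set_ae setT) => //.
    by rewrite -setC0; exact/apx_setC/apx_set0.
  by apply: filterS (p01 j) => x /andP[_ xj]; split => //= _; exact: lt_le_trans t1.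
have aE : apx_set ([set x | cos (pi * t) < cos (2 * pi * (p j x - t / 2))] `|`
    ~` [set x | - 1 < - cos (2 * pi * (p j x - 0))]).
  apply: apx_setU.
    apply: (apx_level (s := fun x => cos (2 * pi * (p j x - t / 2)))).
    - by move=> x; exact: cos1.
    - exact: cos1.
    - exact: Acos.
    - exact: mcos.
  apply: apx_setC; apply: (apx_level (s := fun x => - cos (2 * pi * (p j x - 0)))).
  - by move=> x; have := cos1 (2 * pi * (p j x - 0)); lra.
  - lra.
  - under eq_fun do rewrite -mulN1r rmorphM.
    by apply: A_M; [exact: A_cst|exact: Acos].
  - exact: measurable_funN.
apply: (apx_set_ae aE) => //.
apply: filterS (p01 j) => x xj /=; rewrite cos_arc ?t0//.
rewrite subr0 ltrN2 cos_lt1//; case/andP: xj => x0 x1.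
split=> [[/andP[]//|/negP]|xt]; first by rewrite negbK => /eqP ->.
have [->|xn] := eqVneq (p j x) 0; first by right; apply/negP; rewrite negbK.
by left; rewrite xt lt_neqAle eq_sym xn x0.
Qed.

(** By [gen] it is enough to treat one coordinate at a time, where half-lines generate the Borel
    sets. *)
Lemma dense_indic E : measurable E -> apx (cind E).
Proof.
move=> mE; suff [] : apx_set E by [].
apply: (gen sigma_algebra_apx_set _ mE) => j B mB.
have : (@RGenInftyO.G R).-sigma.-measurable B by rewrite -RGenInftyO.measurableE.
suff h : <<s (@RGenInftyO.G R) >> `<=` [set B | apx_set (p j @^-1` B)] by exact: h.
apply: smallest_sub.
- split => /=.
  + by rewrite preimage_set0; exact: apx_set0.
  + by move=> F aF; rewrite setTD preimage_setC; exact: apx_setC.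
  + by move=> F aF; rewrite preimage_bigcup; exact: apx_bigcup.
- move=> _ [x ->] /=; rewrite (_ : _ @^-1` _ = [set y | p j y < x]).
    exact: apx_coord_lt.
  by apply/seteqP; split => y /=; rewrite in_itv.
Qed.

Lemma apxZ c f : apx f -> apx (fun x => c * f x).
Proof. by move=> af; apply: (@apxM (nsq c) (fun=> c)) => //; exact: A_apx. Qed.

Lemma apx_sum (I : Type) (s : seq I) (F : I -> T -> R[i]) :
  (forall i, apx (F i)) -> apx (fun x => \sum_(i <- s) F i x).
Proof.
move=> aF; elim: s => [|i s ih].
  by under eq_fun do rewrite big_nil; exact: A_apx.
by under eq_fun do rewrite big_cons; exact: apxD.
Qed.

Lemma dense_nonneg (f : T -> R) : measurable_fun setT f -> (forall x, 0 <= f x) ->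
  L2 mu (fun x => W x * (f x)%:C%C) -> apx (fun x => (f x)%:C%C).
Proof.
move=> mf f0 lf.
have mef : measurable_fun setT (EFin \o f) by exact/measurable_EFinP.
pose g := nnsfun_approx measurableT mef.
have g_le n x : g n x <= f x.
  rewrite /g nnsfun_approxE -lee_fin.
  by apply: (le_approx (f := EFin \o f)) => // y _; rewrite /= lee_fin.
have g_ge n x : 0 <= g n x by [].
apply: (@apx_cvg (fun n x => (g n x)%:C%C)).
- exact: cmeas_real.
- move=> n.
  rewrite (_ : (fun x => _) = fun x => \sum_(y <- finmap.enum_fset (fset_set (range (g n))))
      (y%:C%C * cind (g n @^-1` [set y]) x)).
    by apply: apx_sum => y; apply: apxZ; exact: dense_indic.
  apply/funext => x; rewrite [in LHS]fimfunE fsbig_finite//= rmorph_sum.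
  by apply: eq_bigr => y _; rewrite rmorphM.
- apply: (@N2_dominated_cvg0 _ _ _ _ _ (fun x => nsq (W x * (f x)%:C%C))).
  + move=> n; apply: cmeasM; first exact: lW.1.
    by apply: cmeasB; exact: cmeas_real.
  + exact: nsq_integrable.
  + move=> n x; rewrite !nsqM ler_wpM2l ?nsq_ge0// -rmorphB !nsq_real.
    by have := g_le n x; have := g_ge n x; nra.
  + apply: aeW => x.
    have := @cvg_nnsfun_approx _ _ _ _ measurableT _ mef (fun x _ => f0 x) x I.
    move=> /fine_cvgP[_ /= gf].
    have -> : (fun n => nsq (W x * ((g n x)%:C%C - (f x)%:C%C))) =
      (fun n => nsq (W x) * ((g n x - f x) * (g n x - f x))).
      by apply/funext => n; rewrite nsqM -rmorphB nsq_real expr2.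
    have -> : (0 : R) = nsq (W x) * (0 * 0) by rewrite !mulr0.
    by apply: cvgM; [exact: cvg_cst|apply: cvgM; apply/subr_cvg0].
Qed.

Lemma dense_L2 f : cmeas f -> L2 mu (fun x => W x * f x) -> apx f.
Proof.
move=> mf lf.
have part (h : T -> R) : measurable_fun setT h -> (forall x, h x ^+ 2 <= nsq (f x)) ->
    apx (fun x => (h x)%:C%C).
  move=> mh hf.
  have key (h' : T -> R) : measurable_fun setT h' -> (forall x, 0 <= h' x) ->
      (forall x, h' x <= `|h x|) -> apx (fun x => (h' x)%:C%C).
    move=> mh' h'0 h'h; apply: dense_nonneg => //; split.
      by apply: cmeasM; [exact: lW.1|exact: cmeas_real].
    apply: le_lt_trans lf.2; apply: N2_le.
    - by apply: cmeasM; [exact: lW.1|exact: cmeas_real].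
    - exact: lf.1.
    - move=> x; rewrite !nsqM ler_wpM2l ?nsq_ge0// nsq_real.
      by rewrite (le_trans _ (hf x))// -[leRHS]real_normK ?num_real// ler_pXn2r ?nnegrE.
  rewrite (_ : (fun x => _) = fun x => ((h^\+)%R x)%:C%C + (-1) * ((h^\-)%R x)%:C%C).
    apply: apxD; last apply: apxZ; apply: key.
    - exact: measurable_funrpos.
    - by move=> x; exact: funrpos_ge0.
    - move=> x; rewrite /funrpos ge_max normr_ge0 ler_norm//.
    - exact: measurable_funrneg.
    - by move=> x; exact: funrneg_ge0.
    - by move=> x; rewrite /funrneg ge_max normr_ge0 -normrN ler_norm.
  by apply/funext => x; rewrite mulN1r -rmorphB; congr (_%:C%C); rewrite -{1}(funrposBneg h).
rewrite (_ : f = fun x => (complex.Re (f x))%:C%C + 'i%C * (complex.Im (f x))%:C%C).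
  apply: apxD; last apply: apxZ; apply: part.
  - exact: mf.1.
  - by move=> x; exact: Re_sqr_le.
  - exact: mf.2.
  - by move=> x; exact: Im_sqr_le.
by apply/funext => x; rewrite -complexE.
Qed.

End density.

(** * Parseval's identity on the unit cube *)

Section trigonometric_polynomials.
Context {R : realType} d (T : measurableType d) (I : eqType).
Variables (e : I -> T -> R[i]) (op : I -> I -> I) (i0 : I).
Hypothesis e_op : forall i j x, e (op i j) x = e i x * e j x.
Hypothesis e_i0 : forall x, e i0 x = 1.
Hypothesis e_cmeas : forall i, cmeas (e i).
Hypothesis e_unit : forall i x, nsq (e i x) = 1.

(** Repeated indices are allowed in the list, so that sums and products are lists again; [trig_uniq]
    merges equal indices afterwards. *)
Definition trig (P : T -> R[i]) : Prop :=
  exists s : seq (R[i] * I), forall x, P x = \sum_(q <- s) q.1 * e q.2 x.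

Lemma trig_cmeas P : trig P -> cmeas P.
Proof.
move=> [s Ps]; rewrite (_ : P = fun x => \sum_(q <- s) q.1 * e q.2 x); last exact/funext.
by apply: cmeas_sum => q; exact: cmeasZ.
Qed.

Lemma trig_bdd P : trig P -> exists M, forall x, nsq (P x) <= M.
Proof.
move=> [s Ps]; exists ((\sum_(q <- s) normc q.1) ^+ 2) => x.
rewrite -nsqE ler_pXn2r ?nnegrE ?normc_ge0 ?sumr_ge0//; last first.
  by move=> q _; exact: normc_ge0.
rewrite Ps (le_trans (normc_sum _ _))// ler_sum// => q _.
by rewrite ComplexField.Normc.normcM [normc (e _ _)]normc_sqrt e_unit sqrtr1 mulr1.
Qed.

Lemma trig_char i c : trig (fun x => c * e i x).
Proof. by exists [:: (c, i)] => x; rewrite big_seq1. Qed.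

Lemma trig_cst c : trig (fun=> c).
Proof. by exists [:: (c, i0)] => x; rewrite big_seq1 e_i0 mulr1. Qed.

Lemma trigD P Q : trig P -> trig Q -> trig (fun x => P x + Q x).
Proof. by move=> [s Ps] [t Qt]; exists (s ++ t) => x; rewrite big_cat Ps Qt. Qed.

Lemma trigM P Q : trig P -> trig Q -> trig (fun x => P x * Q x).
Proof.
move=> [s Ps] [t Qt].
exists (flatten [seq [seq (q.1 * r.1, op q.2 r.2) | r <- t] | q <- s]) => x.
rewrite big_flatten big_map Ps mulr_suml; apply: eq_bigr => q _.
rewrite big_map Qt mulr_sumr; apply: eq_bigr => r _ /=.
by rewrite e_op; ring.
Qed.

Lemma trig_uniq P : trig P -> exists (s : seq I) (c : I -> R[i]), uniq s /\
  forall x, P x = \sum_(i <- s) c i * e i x.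
Proof.
move=> [s Ps]; pose t := undup (map snd s).
exists t, (fun i => \sum_(q <- s | q.2 == i) q.1); split; first exact: undup_uniq.
move=> x; rewrite Ps.
under [RHS]eq_bigr do rewrite big_mkcond mulr_suml.
rewrite exchange_big /= [LHS]big_seq [RHS]big_seq; apply: eq_bigr => q qs.
rewrite (bigD1_seq q.2) ?undup_uniq//=; last by rewrite mem_undup map_f.
rewrite eqxx big1 ?addr0// => i iq.
by rewrite eq_sym (negbTE iq) mul0r.
Qed.

End trigonometric_polynomials.

Section cosines.
Context {R : realType} {l : nat}.
Notation X := (l.-tuple R).
Notation Z := (l.-tuple int).

Definition zdelta (j : 'I_l) : Z := [tuple if i == j then 1 else 0 | i < l].

Lemma ch_zdelta j (x : X) : ch (zdelta j) x = expi (2 * pi * tnth x j).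
Proof.
rewrite /ch /eu /dot (bigD1 j)//= big1 ?addr0; last first.
  by move=> i ij; rewrite !tnth_mktuple (negbTE ij) mul0r.
by rewrite !tnth_mktuple eqxx mul1r.
Qed.

Lemma cos_ch j (c : R) (x : X) : (cos (2 * pi * (tnth x j - c)))%:C%C =
  (expi (- (2 * pi * c)) / 2) * ch (zdelta j) x +
  (expi (2 * pi * c) / 2) * ch (zopp (zdelta j)) x.
Proof.
rewrite chN ch_zdelta.
have -> : expi (- (2 * pi * c)) / 2 * expi (2 * pi * tnth x j) =
  2^-1 * expi (2 * pi * (tnth x j - c)).
  by rewrite mulrAC [RHS]mulrC -expiD; congr (expi _ / _); ring.
have -> : expi (2 * pi * c) / 2 * conjc (expi (2 * pi * tnth x j)) =
  2^-1 * conjc (expi (2 * pi * (tnth x j - c))).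
  by rewrite -!expiN mulrAC [RHS]mulrC -expiD; congr (expi _ / _); ring.
by rewrite -mulrDr addcJ mulrA mulVf ?mul1r// pnatr_eq0.
Qed.

Lemma tuple_measurable_gen (M : set (set X)) : sigma_algebra setT M ->
  (forall j (B : set R), measurable B -> M ((fun x : X => tnth x j) @^-1` B)) ->
  measurable `<=` M.
Proof.
move=> sM hM; apply: smallest_sub => //.
rewrite -bigcup_seq => A [j _ [B mB <-]]; rewrite setTI; exact: hM.
Qed.

Lemma prod_measurable_gen (M : set (set (X * X))) : sigma_algebra setT M ->
  (forall j (B : set R), measurable B -> M ((fun x : X * X => tnth x.1 j) @^-1` B)) ->
  (forall j (B : set R), measurable B -> M ((fun x : X * X => tnth x.2 j) @^-1` B)) ->
  measurable `<=` M.
Proof.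
move=> sM h1 h2.
have key (f : X * X -> X) :
    (forall j (B : set R), measurable B -> M ((fun x => tnth (f x) j) @^-1` B)) ->
    forall A, measurable A -> M (f @^-1` A).
  move=> hf A mA; apply: (@tuple_measurable_gen [set A | M (f @^-1` A)]) => //.
  case: sM => s0 sC sU; split => /=.
  - by rewrite preimage_set0.
  - by move=> B hB; rewrite setTD preimage_setC -setTD; exact: sC.
  - by move=> F hF; rewrite preimage_bigcup; exact: sU.
apply: smallest_sub => // A [] [B mB <-]; rewrite setTI; exact: key.
Qed.

End cosines.

Section Parseval.
Context {R : realType} d (T : measurableType d) (mu : {measure set T -> \bar R}).
Implicit Types f g h : T -> R[i].

Lemma N2_sub_unit f g (c : R[i]) : L2 mu f -> L2 mu g -> N2 mu g = 1%E ->
  fine (N2 mu (fun x => f x - c * g x)) =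
  fine (N2 mu f) - nsq (ip mu f g) + nsq (ip mu f g - c).
Proof.
move=> lf lg g1.
have lh : L2 mu (fun x => f x - c * g x) by apply: L2B => //; exact: L2Z.
have : ip mu (fun x => f x - c * g x) (fun x => f x - c * g x) =
   ((fine (N2 mu f) - nsq (ip mu f g) + nsq (ip mu f g - c))%:C)%C.
  rewrite ipBl//; last exact: L2Z.
  rewrite ipZl// [ip mu f _]ipC// [ip mu g _]ipC// !ipBl//; try exact: L2Z.
  rewrite !ipZl// [ip mu g f]ipC// (ip_self _ f) (ip_self _ g) g1.
  rewrite {lh}; case: c (ip mu f g) (fine (N2 mu f)) => p q [u v] r.
  by apply: eq_ReIm; rewrite /nsq /=; ring.
by rewrite ip_self => /(congr1 (@complex.Re R)).
Qed.

Variables (I : eqType) (e : I -> T -> R[i]).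
Hypothesis le : forall i, L2 mu (e i).
Hypothesis oe : forall i j, ip mu (e i) (e j) = (i == j)%:R.

Lemma N2_orthonormal i : N2 mu (e i) = 1%E.
Proof.
have := oe i i; rewrite eqxx ip_self => /(congr1 (@complex.Re R)) /= h.
by rewrite -(fineK (N2_fin (le i))) h.
Qed.

(** The square is completed one orthonormal vector at a time. Taking c_i to be the coefficients of f
    yields Bessel's inequality; a general c gives the distance from f to a given polynomial. *)
Lemma N2_sub_orthonormal f (s : seq I) (c : I -> R[i]) : L2 mu f -> uniq s ->
  fine (N2 mu (fun x => f x - \sum_(i <- s) c i * e i x)) =
  fine (N2 mu f) - \sum_(i <- s) nsq (ip mu f (e i)) +
  \sum_(i <- s) nsq (ip mu f (e i) - c i).
Proof.
elim: s f => [|i s ih] f lf /=.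
  by rewrite !big_nil subr0 addr0; under eq_fun do rewrite big_nil subr0.
move=> /andP[nis us].
have lg : L2 mu (fun x => f x - c i * e i x) by apply: L2B => //; exact: L2Z.
have := ih _ lg us.
rewrite (_ : (fun x => f x - c i * e i x - _) =
   fun x => f x - \sum_(j <- i :: s) c j * e j x); last first.
  by apply/funext => x; rewrite big_cons opprD addrA.
move=> ->; rewrite N2_sub_unit//; last exact: N2_orthonormal.
have E j : j \in s -> ip mu (fun x => f x - c i * e i x) (e j) = ip mu f (e j).
  move=> js; rewrite ipBl//; last exact: L2Z.
  rewrite ipZl// oe (_ : i == j = false) ?mulr0 ?subr0//.
  by apply/negP => /eqP ij; rewrite ij js in nis.
rewrite !big_cons [in LHS]big_seq [X in _ + X = _]big_seq.
under eq_bigr do rewrite E//.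
under [X in _ + X = _]eq_bigr do rewrite E//.
by rewrite -!big_seq; ring.
Qed.

Lemma Bessel f (s : seq I) : L2 mu f -> uniq s ->
  \sum_(i <- s) nsq (ip mu f (e i)) <= fine (N2 mu f).
Proof.
move=> lf us; have E := N2_sub_orthonormal (fun i => ip mu f (e i)) lf us.
have Z0 : \sum_(i <- s) nsq (ip mu f (e i) - ip mu f (e i)) = 0.
  by apply: big1 => i _; rewrite subrr nsq0.
by rewrite -subr_ge0 -[X in 0 <= X]addr0 -[X in _ + X]Z0 -E fine_ge0// N2_ge0.
Qed.

End Parseval.

Section Parseval_cube.
Context {R : realType} {l : nat}.
Notation X := (l.-tuple R).
Notation Z := (l.-tuple int).
Notation kap := (kap R l).

(** Relates f to its Fourier coefficients on the unit cube. A relation is convenient because the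
    coefficients are prescribed in advance and are attained only on almost every fibre of the Zak
    transform. *)
Definition CR (f : X -> R[i]) (a : Z -> R[i]) : Prop :=
  L2 kap f /\ forall m, ip kap f (ch m) = a m.

Lemma kap_coord (j : 'I_l) : {ae kap, forall x, 0 <= tnth x j < 1}.
Proof. by apply: filterS (@kap_ae R l) => x; exact. Qed.

Lemma trig_dense_kap (f : X -> R[i]) (eps : R) : L2 kap f -> 0 < eps ->
  exists2 P, trig (@ch R l) P & (N2 kap (fun x => f x - P x)%R < eps%:E)%E.
Proof.
move=> lf eps0.
have l1 : L2 kap (fun=> 1) by apply: L2_kap_unit => [|x]; [exact: cmeas_cst|exact: nsq1].
have af : apx kap (fun=> 1) (trig (@ch R l)) f.
  apply: (@dense_L2 _ _ _ _ _ _ l1 _ _ _ _ _ 'I_l (fun j x => tnth x j)).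
  - by move=> P; apply: trig_cmeas; exact: cmeas_ch.
  - by move=> P; apply: trig_bdd; exact: nsq_ch.
  - apply: trig_cst; exact: ch0.
  - by move=> P Q; exact: trigD.
  - by move=> P Q; apply: trigM; exact: chD.
  - by move=> j; exact: measurable_tnth.
  - exact: kap_coord.
  - move=> j c; under eq_fun do rewrite cos_ch.
    by apply: trigD; exact: trig_char.
  - exact: tuple_measurable_gen.
  - exact: lf.1.
  - by under eq_fun do rewrite mul1r.
have [P tP hP] := af.2 _ eps0; exists P => //.
by under eq_N2 do rewrite -[_ - _]mul1r.
Qed.

(** Bessel's inequality bounds the sum from above. Conversely, if a polynomial with frequencies in s
    is close to f, the defect of the sum over s is at most its squared distance to f. *)
Lemma Parseval f a : CR f a -> N2 kap f = \esum_(m in [set: Z]) (nsq (a m))%:E.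
Proof.
move=> [lf fa]; apply/eqP; rewrite eq_le; apply/andP; split; last first.
  apply: esum_le_seq => s us; rewrite sumEFin -(fineK (N2_fin lf)) lee_fin.
  under eq_bigr do rewrite -fa.
  exact: (Bessel (@L2_ch R l) (@ch_orthogonal R l)).
apply/lee_addgt0Pr => eps eps0.
have [P tP hP] := trig_dense_kap lf eps0.
have [s [c [us Ps]]] := trig_uniq tP.
have E := N2_sub_orthonormal (@L2_ch R l) (@ch_orthogonal R l) c lf us.
have LP : L2 kap (fun x => f x - P x).
  apply: L2B => //; rewrite (_ : P = fun x => \sum_(i <- s) c i * ch i x); last exact/funext.
  by apply: L2_sum => i; apply: L2Z; exact: L2_ch.
rewrite (_ : (fun x => f x - \sum_(i <- s) c i * ch i x) = fun x => f x - P x) in E; last first.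
  by apply/funext => x; rewrite Ps.
apply: (@le_trans _ _ (\sum_(m <- s) (nsq (a m))%:E + eps%:E)%E); last first.
  by rewrite leeD2r//; exact: esum_ge_seq.
rewrite sumEFin -(fineK (N2_fin lf)) -EFinD lee_fin.
have : fine (N2 kap (fun x => f x - P x)) < eps.
  by rewrite -lte_fin (fineK (N2_fin LP)).
rewrite E; under eq_bigr do rewrite fa.
have : 0 <= \sum_(i <- s) nsq (ip kap f (ch i) - c i).
  by apply: sumr_ge0 => i _; exact: nsq_ge0.
lra.
Qed.

Lemma CR_D f g a b : CR f a -> CR g b -> CR (fun x => f x + g x) (fun m => a m + b m).
Proof.
move=> [lf fa] [lg gb]; split; first exact: L2D.
by move=> m; rewrite ipDl ?fa ?gb//; exact: L2_ch.
Qed.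

Lemma CR_Z c f a : CR f a -> CR (fun x => c * f x) (fun m => c * a m).
Proof.
move=> [lf fa]; split; first exact: L2Z.
by move=> m; rewrite ipZl ?fa//; exact: L2_ch.
Qed.

Lemma CR_0 : CR (fun=> 0) (fun=> 0).
Proof.
split; first exact: L2_0.
by move=> m; rewrite /ip; under eq_fun do rewrite mul0r; exact: cint0.
Qed.

Lemma CR_sum (I : Type) (s : seq I) (F : I -> X -> R[i]) (a : I -> Z -> R[i]) :
  (forall i, CR (F i) (a i)) ->
  CR (fun x => \sum_(i <- s) F i x) (fun m => \sum_(i <- s) a i m).
Proof.
move=> FA; elim: s => [|i s ih].
  by under eq_fun do rewrite big_nil; under [in X in CR _ X]eq_fun do rewrite big_nil; exact: CR_0.
by under eq_fun do rewrite big_cons; under [in X in CR _ X]eq_fun do rewrite big_cons; exact: CR_D.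
Qed.

Lemma CR_ch n f a : CR f a -> CR (fun x => conjc (ch n x) * f x) (fun m => a (zadd m n)).
Proof.
move=> [lf fa]; split.
  apply: (@L2_bounded_mul _ _ _ _ 1) => //; first by apply: cmeas_conj; exact: cmeas_ch.
  by move=> x; rewrite nsq_conj nsq_ch.
move=> m; rewrite -fa; apply: eq_cint => x.
by rewrite chD rmorphM /=; ring.
Qed.

Lemma CR_shift s f a : CR f a -> zperiodic f ->
  CR (fun x => f (tadd x s)) (fun m => a m * ch m s).
Proof.
move=> [lf fa] pf; split.
  split; first exact: cmeas_comp (measurable_tadd s) lf.1.
  rewrite /N2 (ge0_integral_kap_shift s (F := fun x => (nsq (f x))%:E)); first exact: lf.2.
  - exact: measurable_ensq lf.1.
  - by move=> x; rewrite lee_fin nsq_ge0.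
  - by move=> x m; rewrite pf.
move=> m; have hc : cintegrable kap (fun x => f x * conjc (ch m x)).
  by apply: L2_mul_cintegrable => //; exact: L2_ch.
have mc : cmeas (fun x => f x * conjc (ch m x)).
  by apply: cmeasM; [exact: lf.1|apply: cmeas_conj; exact: cmeas_ch].
rewrite -fa mulrC -cintZ// -(cint_kap_shift s); last 2 first.
- exact: cmeasZ.
- by move=> x n; rewrite pf ch_period.
apply: eq_cint => x; rewrite /ch euDr rmorphM.
have := euV (int_tuple R m) s; set u := eu _ s => uV.
by rewrite [RHS](_ : _ = f (tadd x s) * conjc (eu (int_tuple R m) x) * (u * conjc u));
  [rewrite uV mulr1|ring].
Qed.

End Parseval_cube.

(** * The Zak transform *)

Section Riesz_Fischer.
Context {R : realType} d (T : measurableType d) (mu : {measure set T -> \bar R}).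
Hypothesis mu1 : mu setT = 1%E.

(** The geometric rate makes the series of |f_(n+1) - f_n| integrable, hence finite almost
    everywhere. There f_n converges pointwise, and Fatou's lemma turns this into convergence in
    norm. *)
Lemma L2_complete (f : nat -> T -> R[i]) : (forall n, cmeas (f n)) ->
  (forall n m, (n <= m)%N -> (N2 mu (fun x => f m x - f n x)%R <= (4^-1 ^+ n)%:E)%E) ->
  exists2 g, cmeas g & (fun n => N2 mu (fun x => f n x - g x)) @ \oo --> 0%E.
Proof.
move=> mf hf.
pose D n x := normc (f n.+1 x - f n x).
have mdiff n m : cmeas (fun x => f n x - f m x) by exact: cmeasB.
have DE n x : D n x = Num.sqrt (nsq (f n.+1 x - f n x)) by rewrite /D normc_sqrt.
have mD n : measurable_fun setT (D n).
  rewrite (_ : D n = fun x => Num.sqrt (nsq (f n.+1 x - f n x))); last exact/funext.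
  apply: (measurableT_comp (continuous_measurable_fun (@sqrt_continuous R))).
  exact: measurable_nsq.
have D0 n x : 0 <= D n x by exact: normc_ge0.
have intD n : (\int[mu]_x (D n x)%:E <= (2^-1 ^+ n)%:E)%E.
  (* This is 2 c <= 2^n c^2 + 2^-n. With the rate 4^-n the first term has integral at most 2^-n, and
     so has the second as [mu] has mass 1. *)
  have pw x : D n x <= 2^-1 * (2 ^+ n * nsq (f n.+1 x - f n x) + 2^-1 ^+ n).
    rewrite -nsqE -/(D n x).
    have q0 : 0 < 2 ^+ n :> R by rewrite exprn_gt0.
    have q1 : 2 ^+ n * 2^-1 ^+ n = 1 :> R by rewrite -exprMn mulfV ?expr1n// pnatr_eq0.
    set a := 2 ^+ n in q0 q1 *; set b := 2^-1 ^+ n in q1 *; set c := D n x.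
    have := sqr_ge0 (a * c - 1); nra.
  apply: (@le_trans _ _ (\int[mu]_x
     ((2^-1)%:E * ((2 ^+ n)%:E * (nsq (f n.+1 x - f n x))%:E + (2^-1 ^+ n)%:E)))%E).
    apply: ge0_le_integral => //.
    - by move=> x _; rewrite lee_fin.
    - exact/measurable_EFinP.
    - apply: measurable_funeM; apply: emeasurable_funD; last exact: measurable_cst.
      by apply: measurable_funeM; exact: measurable_ensq.
    - by move=> x _; rewrite -!EFinM lee_fin.
  have m0 : measurable_fun setT (fun x => (nsq (f n.+1 x - f n x))%:E) by exact: measurable_ensq.
  have p0 x : (0 <= (nsq (f n.+1 x - f n x))%:E)%E by rewrite lee_fin nsq_ge0.
  have q0 : (0 <= (2 ^+ n : R)%:E)%E by rewrite lee_fin exprn_ge0.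
  have q1 : (0 <= (2^-1 ^+ n : R)%:E)%E by rewrite lee_fin exprn_ge0.
  have m1 : measurable_fun setT (fun x => (2 ^+ n)%:E * (nsq (f n.+1 x - f n x))%:E)%E.
    exact: measurable_funeM.
  have p1 x : (0 <= (2 ^+ n)%:E * (nsq (f n.+1 x - f n x))%:E)%E by rewrite mule_ge0.
  have m2 : measurable_fun setT
      (fun x => (2 ^+ n)%:E * (nsq (f n.+1 x - f n x))%:E + (2^-1 ^+ n)%:E)%E.
    by apply: emeasurable_funD => //; exact: measurable_cst.
  have p2 x : (0 <= (2 ^+ n)%:E * (nsq (f n.+1 x - f n x))%:E + (2^-1 ^+ n)%:E)%E.
    by rewrite adde_ge0.
  rewrite ge0_integralZl// ge0_integralD// ge0_integralZl//.
  rewrite integral_cst// mu1 mule1 -/(N2 mu (fun x => f n.+1 x - f n x)).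
  apply: (@le_trans _ _ ((2^-1)%:E * ((2 ^+ n)%:E * (4^-1 ^+ n)%:E + (2^-1 ^+ n)%:E))%E).
    by rewrite lee_pmul2l// leeD2r// lee_pmul2l ?lte_fin ?exprn_gt0// hf.
  rewrite -!EFinM lee_fin -exprMn (_ : 2 * 4^-1 = 2^-1 :> R); last by field.
  by set b := 2^-1 ^+ n; lra.
have intS : (\int[mu]_x (\sum_(n <oo) (D n x)%:E) < +oo)%E.
  rewrite integral_nneseries//; last 2 first.
  - by move=> n; exact/measurable_EFinP.
  - by move=> n x _; rewrite lee_fin.
  apply: (@le_lt_trans _ _ (\sum_(n <oo) (2 / (2 ^ (n + 1))%:R)%:E)%E).
    apply: lee_nneseries => [n *|n *].
      by apply: integral_ge0 => x _; rewrite lee_fin.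
    rewrite (le_trans (intD n))// lee_fin addn1 natrX exprS invfM mulrA mulfV ?mul1r ?exprVn//.
  have /cvg_lim h := @cvg_geometric_eseries_half R 2 0.
  by rewrite [ltLHS]h// ltry.
have aeS : {ae mu, forall x, (\sum_(n <oo) (D n x)%:E)%E \is a fin_num}.
  have ms : measurable_fun setT (fun x => \sum_(n <oo) (D n x)%:E)%E.
    by apply: ge0_emeasurable_sum => [k x _ _|k _]; [rewrite lee_fin|exact/measurable_EFinP].
  have s0 x : (0 <= \sum_(n <oo) (D n x)%:E)%E.
    by apply: nneseries_ge0 => n _ _; rewrite lee_fin.
  have : mu.-integrable setT (fun x => \sum_(n <oo) (D n x)%:E)%E.
    apply/integrableP; split => //.
    by under eq_integral do rewrite gee0_abs//.
  move=> /(integrable_ae measurableT).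
  by apply: filterS => x; apply.
(* [h] stands for the real or the imaginary part; its increments are dominated by [D], so the
   telescoping series converges absolutely. *)
have cvgs x (h : R[i] -> R) : (forall z w, h (z - w) = h z - h w) ->
    (forall z, `|h z| <= normc z) ->
    (\sum_(n <oo) (D n x)%:E)%E \is a fin_num ->
    cvgn (fun n => h (f n x)).
  move=> hB hn fin.
  have : cvgn (series (telescope (fun n => h (f n x)))).
    apply: (@normed_cvg R R^o); apply: nondecreasing_is_cvgn.
      exact: (@nondecreasing_series _ (fun k => `|telescope (fun n => h (f n x)) k|) xpredT 0).
    exists (fine (\sum_(n <oo) (D n x)%:E)%E) => _ [n _ <-].
    rewrite -lee_fin (fineK fin).
    apply: le_trans (nneseries_lim_ge n _); last by move=> k _ _; rewrite lee_fin.
    rewrite sumEFin lee_fin; apply: ler_sum => k _.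
    by rewrite /telescope /= -hB.
  move=> /cvg_ex[lim hl]; apply/cvg_ex; exists (h (f 0 x) + lim).
  rewrite (_ : (fun n => _) = fun n => h (f 0%N x) + series (telescope (fun n => h (f n x))) n).
    by apply: cvgD => //; exact: cvg_cst.
  by apply/funext => n; rewrite -eq_sum_telescope.
(* An upper limit is measurable without any convergence, and agrees with the limit wherever that
   exists. *)
pose lm (h : R[i] -> R) x := fine (limn_esup (fun n => (h (f n x))%:E)).
have mlm (h : R[i] -> R) : (forall n, measurable_fun setT (fun x => h (f n x))) ->
    measurable_fun setT (lm h).
  move=> mh; apply: (measurableT_comp (fine_measurable measurableT)).
  apply: (measurable_fun_limn_esup (f := fun n x => (h (f n x))%:E)) => n.
  exact/measurable_EFinP.
have lmE (h : R[i] -> R) x : cvgn (fun n => h (f n x)) -> h (f n x) @[n --> \oo] --> lm h x.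
  move=> /cvg_ex[l hl].
  have hle : (h (f n x))%:E @[n --> \oo] --> l%:E by apply: cvg_EFin => //; exact: nearW.
  suff -> : lm h x = l by [].
  rewrite /lm limn_esup_lim.
  by have /cvg_lim -> := cvg_esups hle.
pose g x := (lm (@complex.Re R) x +i* lm (@complex.Im R) x)%C.
have mg : cmeas g by split; apply: mlm => n; case: (mf n).
exists g => //.
have aeg : {ae mu, forall x n, (nsq (f n x - f m x))%:E @[m --> \oo] --> (nsq (f n x - g x))%:E}.
  apply: filterS aeS => x fin n.
  have cr := lmE _ _ (cvgs x (@complex.Re R) _ (@norm_Re_normc R) fin).
  have ci := lmE _ _ (cvgs x (@complex.Im R) _ (@norm_Im_normc R) fin).
  have ReB z w : complex.Re (z - w) = complex.Re z - complex.Re w :> R.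
    by case: z; case: w.
  have ImB z w : complex.Im (z - w) = complex.Im z - complex.Im w :> R.
    by case: z; case: w.
  apply: cvg_EFin; first exact: nearW.
  rewrite /nsq; under eq_fun do rewrite ReB ImB !expr2.
  rewrite ReB ImB !expr2.
  by apply: cvgD; apply: cvgM; (apply: cvgB; [exact: cvg_cst|]); [exact: (cr ReB)..|exact: (ci ImB)|exact: (ci ImB)].
have key n : (N2 mu (fun x => f n x - g x)%R <= (4^-1 ^+ n)%:E)%E.
  apply: (@le_trans _ _ (\int[mu]_x limn_einf (fun m => (nsq (f n x - f m x))%:E))%E).
    rewrite /N2 le_eqVlt; apply/orP; left; apply/eqP.
    apply: ae_eq_integral => //.
    - exact/measurable_ensq/cmeasB.
    - rewrite /limn_einf; apply: measurableT_comp => //.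
      apply: (measurable_fun_limn_esup (f := fun m x => - (nsq (f n x - f m x))%:E)%E) => m.
      by apply: measurableT_comp => //; exact: measurable_ensq.
    - apply: filterS aeg => x hx _.
      by rewrite is_cvg_limn_einfE//; [apply/esym/cvg_lim => //; exact: hx|apply/cvg_ex; eexists; exact: hx].
  apply: le_trans (fatou _ _ _ _) _ => //.
  - by move=> m; exact: measurable_ensq.
  - by move=> m x _; rewrite lee_fin nsq_ge0.
  rewrite limn_einf_lim; apply: lime_le; first exact: is_cvg_einfs.
  apply: nearW => k.
  apply: (@le_trans _ _ (N2 mu (fun x => f n x - f (maxn k n) x)%R)).
    by apply: ereal_inf_lbound; exists (maxn k n) => //=; exact: leq_maxl.
  by rewrite N2B hf// leq_maxr.
apply: (@squeeze_cvge _ _ _ _ (cst 0%E) _ (fun n => (4^-1 ^+ n)%:E)).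
- by apply: nearW => n; rewrite N2_ge0 key.
- exact: cvg_cst.
- apply: cvg_EFin; first exact: nearW.
  by apply: cvg_expr; rewrite ger0_norm ?invr_ge0// invf_lt1// ltr1n.
Qed.

End Riesz_Fischer.

(** * The product of two unit cubes *)

Section product_cube.
Context (R : realType) (l : nat).

Definition kap2 : set (l.-tuple R * l.-tuple R) -> \bar R :=
  product_measure1 (kap R l) (kap R l).

HB.instance Definition _ := Measure.on kap2.

End product_cube.
Arguments kap2 : clear implicits.

Section product_cube_theory.
Context {R : realType} {l : nat}.
Notation X := (l.-tuple R).
Notation Z := (l.-tuple int).
Notation zv := (@int_tuple R l).
Notation kap := (kap R l).
Notation kap2 := (kap2 R l).
Local Open Scope ereal_scope.

Lemma kap2_setT : kap2 setT = 1.
Proof.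
rewrite /kap2 -setXTT product_measure1E//.
by rewrite [X in X * _](kap_setT R l) [X in _ * X](kap_setT R l) mule1.
Qed.

Lemma ge0_integral_kap2 (F : X * X -> \bar R) : measurable_fun setT F ->
  (forall z, 0 <= F z) -> \int[kap2]_z F z = \int[kap]_x \int[kap]_y F (x, y).
Proof. by move=> mF F0; exact: fubini_tonelli1. Qed.

Lemma ge0_integral_kap2_swap (F : X * X -> \bar R) : measurable_fun setT F ->
  (forall z, 0 <= F z) -> \int[kap2]_z F z = \int[kap]_y \int[kap]_x F (x, y).
Proof. by move=> mF F0; exact: fubini_tonelli2. Qed.

Lemma measurable_kap_inner (F : X * X -> \bar R) : measurable_fun setT F ->
  (forall z, 0 <= F z) -> measurable_fun setT (fun x => \int[kap]_y F (x, y)).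
Proof. by move=> mF F0; exact: measurable_fun_fubini_tonelli_F. Qed.

Lemma measurable_kap_inner_swap (F : X * X -> \bar R) : measurable_fun setT F ->
  (forall z, 0 <= F z) -> measurable_fun setT (fun y => \int[kap]_x F (x, y)).
Proof. by move=> mF F0; exact: measurable_fun_fubini_tonelli_G. Qed.

Lemma measurable_shift2 (s t : X) :
  measurable_fun setT (fun z : X * X => (tadd z.1 s, tadd z.2 t)).
Proof.
apply/measurable_fun_pairP; split => /=.
  exact: (measurableT_comp (measurable_tadd s) measurable_fst).
exact: (measurableT_comp (measurable_tadd t) measurable_snd).
Qed.

Lemma ge0_integral_kap2_shift (F : X * X -> \bar R) (s t : X) : measurable_fun setT F ->
  (forall z, 0 <= F z) -> (forall x y m, F (tadd x (zv m), y) = F (x, y)) ->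
  (forall x y m, F (x, tadd y (zv m)) = F (x, y)) ->
  \int[kap2]_z F (tadd z.1 s, tadd z.2 t) = \int[kap2]_z F z.
Proof.
move=> mF F0 p1 p2.
have mFs : measurable_fun setT (fun z : X * X => F (tadd z.1 s, tadd z.2 t)).
  exact: (measurableT_comp mF (measurable_shift2 s t)).
rewrite !ge0_integral_kap2//=.
rewrite -(ge0_integral_kap_shift s (F := fun x => \int[kap]_y F (x, y))).
- apply: eq_integral => x _.
  rewrite (ge0_integral_kap_shift t (F := fun y => F (tadd x s, y)))//.
  + exact: (measurableT_comp mF (pair1_measurable _)).
- exact: measurable_kap_inner.
- by move=> x; apply: integral_ge0.
- by move=> x m /=; apply: eq_integral => y _; rewrite p1.
Qed.

End product_cube_theory.

Section Zak_sums.
Context {R : realType} {l : nat}.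
Notation X := (l.-tuple R).
Notation Z := (l.-tuple int).
Notation zv := (@int_tuple R l).
Notation kap := (kap R l).
Notation kap2 := (kap2 R l).
Notation lam := (lebesgueT R l).
Variable g : X -> R[i].
Hypothesis lg : L2 lam g.

(** Finite partial sum of the Zak transform: in y, a trigonometric polynomial with coefficients g(x
    - m). *)
Definition zsum (s : seq Z) (z : X * X) : R[i] :=
  \sum_(m <- s) g (tsub z.1 (zv m)) * ch m z.2.

Lemma cmeas_zsum s : cmeas (zsum s).
Proof.
apply: cmeas_sum => m; apply: cmeasM.
  apply: cmeas_comp lg.1.
  exact: (measurableT_comp (measurable_tsub (zv m)) measurable_fst).
by apply: cmeas_eu; [exact: measurable_cst|exact: measurable_snd].
Qed.

Lemma cmeas_tsub m : cmeas (fun x => g (tsub x (zv m))).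
Proof. exact: cmeas_comp (measurable_tsub (zv m)) lg.1. Qed.

Lemma N2_trig (s : seq Z) (c : Z -> R[i]) : uniq s ->
  N2 kap (fun y => \sum_(m <- s) c m * ch m y) = (\sum_(m <- s) nsq (c m))%:E.
Proof.
move=> us.
have l0 : L2 kap (fun y => \sum_(m <- s) c m * ch m y).
  by apply: L2_sum => m; apply: L2Z; exact: L2_ch.
have := N2_sub_orthonormal (@L2_ch R l) (@ch_orthogonal R l) c (@L2_0 _ _ _ kap) us.
under eq_N2 do rewrite sub0r.
rewrite N2N N2_eq0 /= => h; rewrite -(fineK (N2_fin l0)) h; congr EFin.
have e m : ip kap (fun=> 0) (ch m) = 0.
  by rewrite /ip; under eq_fun do rewrite mul0r; exact: cint0.
under eq_bigr do rewrite e nsq0.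
under [X in _ - _ + X]eq_bigr do rewrite e sub0r nsqN.
by rewrite big1// subr0 add0r.
Qed.

Definition cellN2 (m : Z) : \bar R := N2 kap (fun x => g (tsub x (zv m))).

Lemma cellN2_ge0 m : (0 <= cellN2 m)%E.
Proof. exact: N2_ge0. Qed.

Lemma esum_cellN2 : (\esum_(m in [set: Z]) cellN2 m = N2 lam g)%E.
Proof.
rewrite [RHS]unfold_integral; last 2 first.
- exact: measurable_ensq lg.1.
- by move=> x; rewrite lee_fin nsq_ge0.
rewrite integral_esum//.
- by move=> m x; rewrite lee_fin nsq_ge0.
- by move=> m; exact: measurable_ensq (cmeas_tsub m).
Qed.

Lemma N2_zsum s : uniq s -> (N2 kap2 (zsum s) = \sum_(m <- s) cellN2 m)%E.
Proof.
move=> us; rewrite /N2 ge0_integral_kap2; last 2 first.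
- exact: measurable_ensq (cmeas_zsum s).
- by move=> z; rewrite lee_fin nsq_ge0.
rewrite -ge0_integral_sum//; last 2 first.
- by move=> m; exact: measurable_ensq (cmeas_tsub m).
- by move=> m x _; rewrite lee_fin nsq_ge0.
apply: eq_integral => x _.
by rewrite sumEFin; exact: (N2_trig (fun m => g (tsub x (zv m))) us).
Qed.

Definition zprefix (n : nat) : seq Z := pmap (@pickle_inv Z) (iota 0 n).

Lemma uniq_zprefix n : uniq (zprefix n).
Proof. by apply: (pmap_uniq (@pickle_invK Z)); exact: iota_uniq. Qed.

Lemma mem_zprefix (m : Z) n : (pickle m < n)%N -> m \in zprefix n.
Proof.
move=> mn; rewrite /zprefix mem_pmap; apply/mapP; exists (pickle m).
  by rewrite mem_iota.
by rewrite pickleK_inv.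
Qed.

Lemma zprefix_cat n k : zprefix (n + k) = zprefix n ++ pmap (@pickle_inv Z) (iota n k).
Proof. by rewrite /zprefix iotaD pmap_cat. Qed.

Lemma zprefix_sum (a : Z -> \bar R) n :
  (\sum_(m <- zprefix n) a m = \sum_(0 <= i < n) nat_term a i)%E.
Proof.
elim: n => [|n ih]; first by rewrite /zprefix /= big_nil big_geq.
rewrite -addn1 zprefix_cat big_cat ih /= addn1 big_nat_recr//=; congr (_ + _)%E.
by rewrite /nat_term; case: pickle_inv => [m|] /=; rewrite ?big_seq1 ?big_nil.
Qed.

(** By orthonormality in y, the squared norm of a block of the series is the mass of |g|^2 in the
    corresponding cells, and the total mass is finite. *)
Lemma zprefix_tail (e : R) : 0 < e -> exists N, forall n m, (N <= n)%N -> (n <= m)%N ->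
  (N2 kap2 (fun z => zsum (zprefix m) z - zsum (zprefix n) z)%R <= e%:E)%E.
Proof.
move=> e0.
have fin : N2 lam g \is a fin_num by exact: N2_fin.
have cvg : (\sum_(0 <= i < n) nat_term cellN2 i)%E @[n --> \oo] --> N2 lam g.
  rewrite -esum_cellN2 esum_nat; last exact: cellN2_ge0.
  apply: is_cvg_nneseries => n _ _; rewrite /nat_term.
  by case: pickle_inv => //= m; exact: cellN2_ge0.
move: cvg; rewrite -(fineK fin) => /fine_cvgP[[N1 _ hN1] /cvgrPdist_lt /(_ _ e0) [N2' _ hN2]].
exists (maxn N1 N2') => n m; rewrite geq_max => /andP[nN1 nN2] nm.
have -> : zprefix m = zprefix n ++ pmap (@pickle_inv Z) (iota n (m - n)).
  by rewrite -zprefix_cat subnKC.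
rewrite (@eq_N2 _ _ _ _ _ (zsum (pmap (@pickle_inv Z) (iota n (m - n))))); last first.
  by move=> z; rewrite /zsum big_cat /= addrAC subrr add0r.
rewrite N2_zsum; last by apply: (pmap_uniq (@pickle_invK Z)); exact: iota_uniq.
have tot : (\sum_(k <- zprefix n) cellN2 k +
    \sum_(k <- pmap (@pickle_inv Z) (iota n (m - n))) cellN2 k <= N2 lam g)%E.
  by rewrite -big_cat -zprefix_cat -esum_cellN2; apply: esum_ge_seq; exact: uniq_zprefix.
have sn : (\sum_(k <- zprefix n) cellN2 k)%E \is a fin_num by rewrite zprefix_sum; exact: hN1.
have := hN2 n nN2; rewrite /= -zprefix_sum.
move: tot; rewrite -(fineK sn) -(fineK fin) /=.
set a := fine _; set b := fine _; set S := (\sum_(k <- pmap _ _) _)%E => tot.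
rewrite ltr_norml => /andP[_ h].
have Sfin : S \is a fin_num.
  rewrite ge0_fin_numE; last by apply: sume_ge0 => k _; exact: cellN2_ge0.
  move: tot; case: S => [r _|//|//]; first exact: ltry.
move: tot; rewrite -(fineK Sfin) -EFinD !lee_fin; lra.
Qed.

(** Convergence along a subsequence of partial sums, as [L2_complete] asks for a geometric rate. The
    condition j <= k j puts every lattice index into the partial sums from some point on. *)
Definition zlim (G : X * X -> R[i]) : Prop := exists k : nat -> nat,
  (forall j, (j <= k j)%N) /\
  (fun j => N2 kap2 (fun z => zsum (zprefix (k j)) z - G z)) @ \oo --> 0%E.

Lemma zlim_exists : exists2 G, cmeas G & zlim G.
Proof.
have h j : exists N, forall n m, (N <= n)%N -> (n <= m)%N ->
  (N2 kap2 (fun z => zsum (zprefix m) z - zsum (zprefix n) z)%R <= (4^-1 ^+ j)%:E)%E.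
  by apply: zprefix_tail; rewrite exprn_gt0 ?invr_gt0.
have [N hN] := choice h.
(* Summing the thresholds up to j makes k monotone and places k j beyond N j. *)
pose k j := (j + \sum_(i < j.+1) N i)%N.
have kmono i j : (i <= j)%N -> (k i <= k j)%N.
  move=> ij; rewrite leq_add// -(subnKC ij) -addSn big_split_ord /=.
  exact: leq_addr.
have kN j : (N j <= k j)%N by rewrite /k big_ord_recr /= addnA leq_addl.
have [G mG cG] := @L2_complete R _ _ kap2 kap2_setT (fun j => zsum (zprefix (k j)))
  (fun j => cmeas_zsum _) (fun n m nm => hN n _ _ (kN n) (kmono _ _ nm)).
exists G => //; exists k; split => // j.
exact: leq_addr.
Qed.

End Zak_sums.

Section liminf.
Context {R : realType}.
Local Open Scope ereal_scope.

Lemma limn_einf_ge (u : nat -> \bar R) (c : \bar R) :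
  (exists J, forall j, (J <= j)%N -> c <= u j) -> c <= limn_einf u.
Proof.
move=> [J hJ]; rewrite limn_einf_lim; apply: lime_ge; first exact: is_cvg_einfs.
exists J => // k /= Jk; apply: le_ereal_inf_tmp => _ [j /= kj <-].
by apply: hJ; exact: leq_trans kj.
Qed.

Context d (T : measurableType d) (mu : {measure set T -> \bar R}).

(** Fatou's lemma. A vanishing lower limit is enough to squeeze a fixed quantity to 0 on almost
    every fibre, which spares the extraction of an almost everywhere convergent subsequence. *)
Lemma ae_limn_einf0 (F : nat -> T -> \bar R) : (forall j, measurable_fun setT (F j)) ->
  (forall j x, 0 <= F j x) -> (fun j => \int[mu]_x F j x) @ \oo --> 0 ->
  {ae mu, forall x, limn_einf (F^~ x) = 0}.
Proof.
move=> mF F0 cF.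
have mi : measurable_fun setT (fun x => limn_einf (F^~ x)).
  rewrite /limn_einf; apply: measurableT_comp => //.
  apply: (measurable_fun_limn_esup (f := fun m x => - F m x)) => m.
  exact: measurableT_comp.
have i0 x : 0 <= limn_einf (F^~ x) by apply: limn_einf_ge; exists 0%N.
have := @fatou _ _ _ mu setT measurableT F mF (fun n x _ => F0 n x).
have -> : limn_einf (fun n => \int[mu]_x F n x) = 0.
  by have [-> _] := cvg_limn_einf_sup cF.
move=> h0.
have e0 : \int[mu]_x limn_einf (F^~ x) = 0.
  by apply/eqP; rewrite eq_le h0 integral_ge0.
have := (ae_eq_integral_abs mu measurableT mi).1.
rewrite (eq_integral (fun x => limn_einf (F^~ x))); last first.
  by move=> x _; rewrite gee0_abs.
by move=> /(_ e0); apply: filterS => x; apply.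
Qed.

End liminf.

HB.instance Definition _ (R : realType) l :=
  Measure_isProbability.Build _ _ _ (kap2 R l) (@kap2_setT R l).

(** * Reduction modulo the lattice and translation of null sets *)

Section fractional_part.
Context {R : realType} {l : nat}.
Notation X := (l.-tuple R).
Notation Z := (l.-tuple int).
Notation zv := (@int_tuple R l).
Notation kap := (kap R l).
Notation kap2 := (kap2 R l).

Definition fr (x : X) : X := tsub x (zv (fl x)).

Lemma fl_shift (x : X) m : fl (tadd x (zv m)) = zadd (fl x) m.
Proof.
apply: eq_from_tnth => i; rewrite !tnth_mktuple floorDrz ?intr_int//.
by rewrite intrKfloor.
Qed.

Lemma fr_shift (x : X) m : fr (tadd x (zv m)) = fr x.
Proof.
rewrite /fr fl_shift; apply: eq_from_tnth => i; rewrite !tnth_mktuple intrD.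
by rewrite opprD addrACA subrr addr0.
Qed.

Lemma fl_cube (x : X) : cube l x -> fl x = [tuple 0 | i < l].
Proof.
move=> cx; apply/esym/cube_shift.
rewrite (_ : tsub _ _ = x)//; apply: eq_from_tnth => i.
by rewrite !tnth_mktuple oppr0 addr0.
Qed.

Lemma fr_cube (x : X) : cube l x -> fr x = x.
Proof.
move=> cx; rewrite /fr fl_cube//; apply: eq_from_tnth => i.
by rewrite !tnth_mktuple oppr0 addr0.
Qed.

Lemma measurable_floor : measurable_fun setT (fun x : R => (Num.floor x)%:~R : R).
Proof.
apply: (measurability _ (RGenCInfty.measurableE R)) => //.
move=> /= _ [_ [a ->] <-]; rewrite setTI.
rewrite (_ : _ @^-1` _ = `[(Num.ceil a)%:~R, +oo[%classic)//.
apply/seteqP; split => x /=; rewrite !in_itv /= !andbT.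
  by rewrite -ceil_le_int -floor_ge_int.
by rewrite -floor_ge_int -ceil_le_int.
Qed.

Lemma measurable_fl : measurable_fun setT (fun x : X => zv (fl x)).
Proof.
apply/measurable_fun_tnthP => i.
rewrite (_ : _ \o _ = (fun r : R => (Num.floor r)%:~R) \o (fun x : X => tnth x i)).
  by apply: measurableT_comp; [exact: measurable_floor|exact: measurable_tnth].
by apply/funext => x /=; rewrite !tnth_mktuple.
Qed.

Lemma measurable_fr : measurable_fun setT fr.
Proof.
apply/measurable_fun_tnthP => i.
rewrite (_ : _ \o _ = fun x : X => tnth x i - tnth (zv (fl x)) i).
  apply: measurable_funB; first exact: measurable_tnth.
  exact: (measurableT_comp (measurable_tnth i) measurable_fl).
by apply/funext => x /=; rewrite !tnth_mktuple.
Qed.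

Lemma fr_shiftP (P : X -> Prop) (x : X) : (forall x m, P (tadd x (zv m)) <-> P x) ->
  P (fr x) <-> P x.
Proof. by move=> pP; rewrite -(pP (fr x) (fl x)) /fr tsubK. Qed.

Lemma kap_cubeC : kap (~` cube l) = 0%E.
Proof. by rewrite /kap /mrestr setICl measure0. Qed.

(** The null set N is replaced by its periodization, the preimage of N under [fr]. Inside the cube
    the two agree, so it is still null, and translation preserves the integral of its periodic
    indicator. *)
Lemma ae_kap_shift (P : X -> Prop) (s : X) :
  (forall x m, P (tadd x (zv m)) <-> P x) ->
  {ae kap, forall x, P x} -> {ae kap, forall x, P (tadd x s)}.
Proof.
move=> pP [N [mN N0 PN]].
pose N' := fr @^-1` N.
have mN' : measurable N' by rewrite -[N']setTI; exact: measurable_fr.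
have N'0 : kap N' = 0%E.
  apply/eqP; rewrite eq_le measure_ge0 andbT.
  apply: (@le_trans _ _ (kap (N `|` ~` cube l))).
    apply: le_measure; rewrite ?inE//.
      by apply: measurableU => //; apply: measurableC; exact: measurable_cube.
    move=> x; rewrite /N' /=; have [cx|] := pselect (cube l x); last by right.
    by rewrite fr_cube//; left.
  apply: (le_trans (measureU2 _ _ _)) => //.
    by apply: measurableC; exact: measurable_cube.
  rewrite [X in (X + _)%E]N0 add0e.
  by rewrite [X in (X <= _)%E]kap_cubeC.
exists ((fun x => tadd x s) @^-1` N'); split.
- by rewrite -[X in measurable X]setTI; exact: measurable_tadd.
- have mi : measurable_fun setT (fun x : X => (\1_N' x : R)%:E).
    by apply/measurable_EFinP; exact: measurable_indic.
  have mS : measurable ((fun x => tadd x s) @^-1` N').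
    by rewrite -[X in measurable X]setTI; exact: measurable_tadd.
  have E1 : (\int[kap]_x (\1_N' (tadd x s))%:E = kap ((fun x => tadd x s) @^-1` N'))%E.
    transitivity (\int[kap]_x (\1_((fun x => tadd x s) @^-1` N') x)%:E)%E; first by [].
    by rewrite integral_indic// setIT.
  have E2 : (\int[kap]_x (\1_N' x)%:E = kap N')%E by rewrite integral_indic// setIT.
  apply: etrans (esym E1) _; rewrite -[RHS]N'0 -[RHS]E2.
  apply: (ge0_integral_kap_shift s (F := fun x => (\1_N' x)%:E)) => //.
  move=> x m; rewrite !indicE; congr ((_%:R)%:E); congr nat_of_bool.
  by apply/idP/idP; rewrite !inE /N' /= fr_shift.
- move=> x /= nP; rewrite /N' /=; apply: PN => /= h; apply: nP.
  exact/(fr_shiftP _ pP).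
Qed.

Lemma ae_kap2_cube : {ae kap2, forall z, cube l z.1 /\ cube l z.2}.
Proof.
have mC : measurable (cube l `*` cube l : set (X * X)).
  by apply: measurableX; exact: measurable_cube.
exists (~` (cube l `*` cube l)); split; first exact: measurableC.
  have e : kap2 (cube l `*` cube l) = 1%E.
    have kc : kap (cube l) = 1%E by rewrite /kap /mrestr setIid lebesgueT_cube.
    rewrite /kap2 product_measure1E; [|exact: measurable_cube..].
    by rewrite [X in (X * _)%E]kc [X in (_ * X)%E]kc mule1.
  have := probability_setC kap2 mC; rewrite [X in (_ - X)%E]e subee// => <-.
by move=> z /=.
Qed.

Lemma ae_kap2_shift (P : X * X -> Prop) (s t : X) :
  (forall x y m, P (tadd x (zv m), y) <-> P (x, y)) ->
  (forall x y m, P (x, tadd y (zv m)) <-> P (x, y)) ->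
  {ae kap2, forall z, P z} -> {ae kap2, forall z, P (tadd z.1 s, tadd z.2 t)}.
Proof.
move=> p1 p2 [N [mN N0 PN]].
pose h (z : X * X) := (fr z.1, fr z.2).
have mh : measurable_fun setT h.
  apply/measurable_fun_pairP; split => /=.
    exact: (measurableT_comp measurable_fr measurable_fst).
  exact: (measurableT_comp measurable_fr measurable_snd).
pose N' := h @^-1` N.
have mN' : measurable N' by rewrite -[N']setTI; exact: mh.
have N'0 : kap2 N' = 0%E.
  have [M [mM M0 hM]] := ae_kap2_cube.
  apply/eqP; rewrite eq_le measure_ge0 andbT.
  apply: (@le_trans _ _ (kap2 (N `|` M))).
    apply: le_measure; rewrite ?inE//; first exact: measurableU.
    move=> [x y]; rewrite /N' /h /=.
    have [[/= cx cy]|nc] := pselect (cube l x /\ cube l y).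
      by rewrite !fr_cube//; left.
    by right; apply: hM.
  apply: (le_trans (measureU2 _ _ _)) => //.
  by rewrite [X in (X + _)%E]N0 add0e [X in (X <= _)%E]M0.
pose sh (z : X * X) := (tadd z.1 s, tadd z.2 t).
exists (sh @^-1` N'); split.
- by rewrite -[X in measurable X]setTI; exact: measurable_shift2.
- have mi : measurable_fun setT (fun x : X * X => (\1_N' x : R)%:E).
    by apply/measurable_EFinP; exact: measurable_indic.
  have mS : measurable (sh @^-1` N').
    by rewrite -[X in measurable X]setTI; exact: measurable_shift2.
  have E1 : (\int[kap2]_z (\1_N' (sh z))%:E = kap2 (sh @^-1` N'))%E.
    transitivity (\int[kap2]_x (\1_(sh @^-1` N') x)%:E)%E; first by [].
    by rewrite integral_indic// setIT.
  have E2 : (\int[kap2]_x (\1_N' x)%:E = kap2 N')%E by rewrite integral_indic// setIT.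
  apply: etrans (esym E1) _; rewrite -[RHS]N'0 -[RHS]E2.
  apply: (ge0_integral_kap2_shift s t (F := fun x => (\1_N' x)%:E)) => //.
    move=> x y m; rewrite !indicE; congr ((_%:R)%:E); congr nat_of_bool.
    by apply/idP/idP; rewrite !inE /N' /h /= fr_shift.
  move=> x y m; rewrite !indicE; congr ((_%:R)%:E); congr nat_of_bool.
  by apply/idP/idP; rewrite !inE /N' /h /= fr_shift.
- move=> z /= nP; rewrite /N' /=; apply: PN => /= hP; apply: nP.
  move: hP; rewrite /h /=.
  move/(fr_shiftP (P := fun x => P (x, fr (tadd z.2 t))) _ (fun x m => p1 x _ m)).
  by move/(fr_shiftP (P := fun y => P (tadd z.1 s, y)) _ (fun y m => p2 _ y m)).
Qed.

End fractional_part.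

Section Parseval_fibres.
Context {R : realType} {l : nat}.
Notation X := (l.-tuple R).
Notation Z := (l.-tuple int).

Lemma N2_kap2_CR (F : X * X -> R[i]) (a : X -> Z -> R[i]) :
  cmeas F -> (forall m, cmeas (a^~ m)) ->
  {ae kap R l, forall x, CR (fun y => F (x, y)) (a x)} ->
  N2 (kap2 R l) F = (\int[kap R l]_x \esum_(m in [set: Z]) (nsq (a x m))%:E)%E.
Proof.
move=> mF ma hF; have m1 := measurable_ensq mF.
have p1 z : (0 <= (nsq (F z))%:E)%E by rewrite lee_fin nsq_ge0.
rewrite /N2 (ge0_integral_kap2 m1)//.
apply: ge0_ae_eq_integral => //.
- exact: (measurable_kap_inner m1).
- apply: measurable_esum => [m x|m]; first by rewrite lee_fin nsq_ge0.
  exact: measurable_ensq.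
- by move=> x _; exact: integral_ge0.
- by move=> x _; apply: esum_ge0 => m _; rewrite lee_fin nsq_ge0.
by apply: filterS hF => x /Parseval <- _.
Qed.

End Parseval_fibres.

Section Zak.
Context {R : realType} {l : nat}.
Notation X := (l.-tuple R).
Notation Z := (l.-tuple int).
Notation zv := (@int_tuple R l).
Notation kap := (kap R l).
Notation kap2 := (kap2 R l).
Notation lam := (lebesgueT R l).
Variable g : X -> R[i].
Hypothesis lg : L2 lam g.

(* [G] is the Zak transform of [g], the sum over m of g(x - m) e^(2 pi i m.y). *)
Definition zak (G : X * X -> R[i]) : Prop :=
  [/\ cmeas G,
     forall x m y, G (tadd x (zv m), y) = ch m y * G (x, y),
     forall x y m, G (x, tadd y (zv m)) = G (x, y) &
     zlim g G].

Lemma zak_exists : exists G, zak G.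
Proof.
have [G0 mG0 [k [jk cG0]]] := zlim_exists lg.
(* Extension from the cube by quasi-periodicity makes the two functional equations hold at every
   point and not just almost everywhere. *)
pose G (z : X * X) := ch (fl z.1) z.2 * G0 (fr z.1, fr z.2).
have mG : cmeas G.
  apply: cmeasM.
    apply: cmeas_eu; last exact: measurable_snd.
    exact: (measurableT_comp measurable_fl measurable_fst).
  apply: cmeas_comp mG0; apply/measurable_fun_pairP; split => /=.
    exact: (measurableT_comp measurable_fr measurable_fst).
  exact: (measurableT_comp measurable_fr measurable_snd).
exists G; split => //.
- by move=> x m y; rewrite /G /= fl_shift fr_shift chD; ring.
- by move=> x y m; rewrite /G /= fr_shift ch_period.
exists k; split => //.
rewrite (_ : (fun j => _) = fun j => N2 kap2 (fun z => zsum g (zprefix (k j)) z - G0 z))//.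
apply/funext => j.
apply: ge0_ae_eq_integral => //.
- by apply: measurable_ensq; apply: cmeasB => //; exact: cmeas_zsum.
- by apply: measurable_ensq; apply: cmeasB => //; exact: cmeas_zsum.
- by move=> z _; rewrite lee_fin nsq_ge0.
- by move=> z _; rewrite lee_fin nsq_ge0.
- apply: filterS (@ae_kap2_cube R l) => -[x y] /= [cx cy] _.
  by rewrite /G /= !fr_cube// fl_cube// ch0 mul1r.
Qed.

Variable G : X * X -> R[i].
Hypothesis zG : zak G.

Lemma zak_cmeas : cmeas G. Proof. by case: zG. Qed.

Lemma zak_L2 : L2 kap2 G.
Proof.
case: zG => mG _ _ [k [_ cG]]; split => //.
move/fine_cvgP : cG => [[J _ hJ] _].
have finJ := hJ J (leqnn J); rewrite /= in finJ.
have mz := cmeas_zsum lg (zprefix (k J)).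
rewrite (@eq_N2 _ _ _ _ _ (fun z => zsum g (zprefix (k J)) z +
   - (zsum g (zprefix (k J)) z - G z))); last first.
  by move=> z; rewrite opprB addrC subrK.
have md : cmeas (fun z => - (zsum g (zprefix (k J)) z - G z)).
  by under eq_fun do rewrite -mulN1r; apply: cmeasZ; exact: cmeasB.
rewrite (le_lt_trans (N2D _ mz md))// N2N.
have zf : (N2 kap2 (zsum g (zprefix (k J))) < +oo)%E.
  rewrite N2_zsum//; last exact: uniq_zprefix.
  apply: le_lt_trans lg.2; rewrite -esum_cellN2//.
  by apply: esum_ge_seq; exact: uniq_zprefix.
rewrite lte_add_pinfty// lte_mul_pinfty ?lee_fin//.
by rewrite ltey_eq finJ.
Qed.

Lemma cmeas_section1 (F : X * X -> R[i]) x : cmeas F -> cmeas (fun y => F (x, y)).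
Proof. by move=> mF; apply: cmeas_comp mF; exact: pair1_measurable. Qed.

Lemma cmeas_section2 (F : X * X -> R[i]) y : cmeas F -> cmeas (fun x => F (x, y)).
Proof. by move=> mF; apply: (cmeas_comp (h := fun x => (x, y))) mF; exact: pair2_measurable. Qed.

Lemma ae_section1_L2 : {ae kap, forall x, L2 kap (fun y => G (x, y))}.
Proof.
have m1 := measurable_ensq zak_cmeas.
have p1 z : (0 <= (nsq (G z))%:E)%E by rewrite lee_fin nsq_ge0.
have int1 : kap.-integrable setT (fun x => \int[kap]_y (nsq (G (x, y)))%:E)%E.
  apply/integrableP; split; first exact: (measurable_kap_inner m1).
  under eq_integral do rewrite gee0_abs ?integral_ge0//.
  by rewrite -(ge0_integral_kap2 m1)//; exact: zak_L2.2.
have := integrable_ae measurableT int1; apply: filterS => x /(_ I) hx.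
split; first exact/cmeas_section1/zak_cmeas.
by rewrite ltey_eq hx.
Qed.

Lemma ae_section2_L2 : {ae kap, forall y, L2 kap (fun x => G (x, y))}.
Proof.
have m1 := measurable_ensq zak_cmeas.
have p1 z : (0 <= (nsq (G z))%:E)%E by rewrite lee_fin nsq_ge0.
have int1 : kap.-integrable setT (fun y => \int[kap]_x (nsq (G (x, y)))%:E)%E.
  apply/integrableP; split; first exact: (measurable_kap_inner_swap m1).
  under eq_integral do rewrite gee0_abs ?integral_ge0//.
  by rewrite -(ge0_integral_kap2_swap m1)//; exact: zak_L2.2.
have := integrable_ae measurableT int1; apply: filterS => x /(_ I) hx.
split; first exact/cmeas_section2/zak_cmeas.
by rewrite ltey_eq hx.
Qed.

Lemma ip_zsum x n (m : Z) : (pickle m < n)%N ->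
  ip kap (fun y => zsum g (zprefix n) (x, y)) (ch m) = g (tsub x (zv m)).
Proof.
move=> mn; rewrite -[X in ip kap X _]/(fun y => \sum_(i <- zprefix n) g (tsub x (zv i)) * ch i y).
rewrite ip_suml; [|by move=> i; exact: (L2Z _ (L2_ch i))|exact: L2_ch].
rewrite (bigD1_seq m) ?uniq_zprefix ?mem_zprefix//= big1 ?addr0.
  by rewrite ipZl ?ch_orthogonal ?eqxx ?mulr1//; exact: L2_ch.
by move=> i im; rewrite ipZl ?ch_orthogonal ?(negbTE im) ?mulr0//; exact: L2_ch.
Qed.

(** By Bessel's inequality, the m-th coefficient of G(x, .) differs from that of a long partial sum,
    g(x - m), by at most the norm of the difference on the fibre, whose lower limit is 0 for almost
    every x. *)
Lemma zak_CR :
  {ae kap, forall x, CR (fun y => G (x, y)) (fun m => g (tsub x (zv m)))}.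
Proof.
case: (zG) => mG _ _ [k [jk cG]].
pose F j x := N2 kap (fun y => zsum g (zprefix (k j)) (x, y) - G (x, y)).
have md j : cmeas (fun z => zsum g (zprefix (k j)) z - G z).
  by apply: cmeasB => //; exact: cmeas_zsum.
have p1 j z : (0 <= (nsq (zsum g (zprefix (k j)) z - G z))%:E)%E.
  by rewrite lee_fin nsq_ge0.
have mF j : measurable_fun setT (F j).
  by exact: (measurable_kap_inner (measurable_ensq (md j))).
have F0 j x : (0 <= F j x)%E by exact: N2_ge0.
have cF : (fun j => \int[kap]_x F j x)%E @ \oo --> 0%E.
  rewrite (_ : (fun j => _) = fun j => N2 kap2 (fun z => zsum g (zprefix (k j)) z - G z))//.
  apply/funext => j; apply/esym.
  exact: (ge0_integral_kap2 (measurable_ensq (md j))).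
have liminf0 := ae_limn_einf0 mF F0 cF.
apply: filterS2 ae_section1_L2 liminf0 => x lx Fx; split => // m.
have zL2 j : L2 kap (fun y => zsum g (zprefix (k j)) (x, y)).
  by apply: L2_sum => i; exact: (L2Z (g (tsub x (zv i))) (L2_ch i)).
have : ((nsq (ip kap (fun y => G (x, y)) (ch m) - g (tsub x (zv m))))%:E <= 0)%E.
  rewrite -Fx; apply: limn_einf_ge; exists (pickle m).+1 => j mj.
  rewrite -(ip_zsum x (n := k j)); last exact: leq_trans (jk j).
  rewrite nsqB -ipBl//; last exact: L2_ch.
  apply: ip_Bessel; [exact: L2B|exact: L2_ch|].
  by apply: N2_kap_unit; exact: nsq_ch.
rewrite lee_fin => h; apply/eqP; rewrite -subr_eq0; apply/eqP/nsq_eq0.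
by apply/eqP; rewrite eq_le h nsq_ge0.
Qed.

(** Replacing x by x + n multiplies the fibre by a character and so shifts its coefficients. The
    property of x is thus invariant under the lattice, and [ae_kap_shift] applies. *)
Lemma zak_CR_shift s : {ae kap, forall x,
  CR (fun y => G (tadd x s, y)) (fun m => g (tsub (tadd x s) (zv m)))}.
Proof.
apply: (ae_kap_shift (P := fun x => CR (fun y => G (x, y)) (fun m => g (tsub x (zv m))))) zak_CR.
case: (zG) => _ qG _ _.
have step x n : CR (fun y => G (x, y)) (fun m => g (tsub x (zv m))) ->
    CR (fun y => G (tadd x (zv n), y)) (fun m => g (tsub (tadd x (zv n)) (zv m))).
  move=> h; have := CR_ch (zopp n) h.
  rewrite (_ : (fun y => _) = fun y => G (tadd x (zv n), y)); last first.
    by apply/funext => y; rewrite qG chN conjcK.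
  rewrite (_ : (fun m => _) = fun m => g (tsub (tadd x (zv n)) (zv m)))//.
  apply/funext => m; congr g; apply: eq_from_tnth => i.
  by rewrite !tnth_mktuple intrD intrN; lra.
move=> x n; split; last exact: step.
move=> /(step _ (zopp n)).
rewrite (_ : tadd (tadd x (zv n)) (zv (zopp n)) = x)//.
by rewrite zv_opp -/(tsub _ _) taddK.
Qed.

Lemma zak_isometry : N2 kap2 G = N2 lam g.
Proof.
rewrite (N2_kap2_CR zak_cmeas (cmeas_tsub lg) zak_CR) [RHS]/N2 unfold_integral//.
- exact: measurable_ensq lg.1.
- by move=> x; rewrite lee_fin nsq_ge0.
Qed.

End Zak.

(** * Plancherel's identity *)

Section folding.
Context {R : realType} {l : nat}.
Notation X := (l.-tuple R).
Notation Z := (l.-tuple int).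
Notation zv := (@int_tuple R l).
Notation kap := (kap R l).
Notation kap2 := (kap2 R l).
Notation lam := (lebesgueT R l).

Lemma ge0_fold_cvg (F : X -> \bar R) : measurable_fun setT F -> (forall x, 0 <= F x)%E ->
  (fun n => \sum_(m <- zprefix n) \int[kap]_x F (tsub x (zv m)))%E @ \oo -->
  (\int[lam]_x F x)%E.
Proof.
move=> mF F0; rewrite unfold_integral// integral_esum//; last first.
  by move=> m; exact: (measurableT_comp mF (measurable_tsub (zv m))).
have a0 m : (0 <= \int[kap]_x F (tsub x (zv m)))%E by apply: integral_ge0.
rewrite esum_nat//; under eq_fun do rewrite zprefix_sum.
by apply: is_cvg_nneseries => n _ _; rewrite /nat_term; case: pickle_inv => /=.
Qed.

Lemma ge0_cell_le (F : X -> \bar R) m : measurable_fun setT F -> (forall x, 0 <= F x)%E ->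
  (\int[kap]_x F (tsub x (zv m)) <= \int[lam]_x F x)%E.
Proof.
move=> mF F0; rewrite unfold_integral// integral_esum//; last first.
  by move=> n; exact: (measurableT_comp mF (measurable_tsub (zv n))).
have := @esum_ge_seq R _ (fun m => \int[kap]_x F (tsub x (zv m)))%E [:: m] isT.
by rewrite big_seq1.
Qed.

Lemma integrable_cell (F : X -> \bar R) m : lam.-integrable setT F ->
  kap.-integrable setT (fun x => F (tsub x (zv m))).
Proof.
move=> /integrableP[mF Fo]; apply/integrableP; split.
  exact: (measurableT_comp mF (measurable_tsub (zv m))).
apply: le_lt_trans Fo; apply: (ge0_cell_le (F := fun x => `|F x|%E)) => //.
exact: measurableT_comp.
Qed.

Lemma fold_cvg (F : X -> R) : lam.-integrable setT (fun x => (F x)%:E) ->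
  (fun n => \sum_(m <- zprefix n) \int[kap]_x F (tsub x (zv m))) @ \oo -->
  \int[lam]_x F x.
Proof.
move=> iF.
pose f x := (F x)%:E.
have part (h : X -> \bar R) : lam.-integrable setT h -> (forall x, 0 <= h x)%E ->
   (fun n => \sum_(m <- zprefix n) fine (\int[kap]_x h (tsub x (zv m)))%E) @ \oo -->
   fine (\int[lam]_x h x)%E.
  move=> ih h0; have mh := measurable_int _ ih.
  have fin m : (\int[kap]_x h (tsub x (zv m)))%E \is a fin_num.
    exact: integrable_fin_num (integrable_cell m ih).
  have := ge0_fold_cvg mh h0.
  rewrite -[X in _ --> X](fineK (integrable_fin_num measurableT ih)) => /fine_cvgP[_].
  rewrite (_ : _ \o _ = fun n => \sum_(m <- zprefix n) fine (\int[kap]_x h (tsub x (zv m)))%E)//.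
  by apply/funext => n /=; rewrite sum_fine.
have ip := integrable_funepos measurableT iF.
have iN := integrable_funeneg measurableT iF.
have E1 : \int[lam]_x F x = fine (\int[lam]_x (f^\+)%E x)%E - fine (\int[lam]_x (f^\-)%E x)%E.
  rewrite -fineB; [by rewrite -integralE|exact: integrable_fin_num ip|exact: integrable_fin_num iN].
have E2 m : \int[kap]_x F (tsub x (zv m)) =
    fine (\int[kap]_x (f^\+)%E (tsub x (zv m)))%E - fine (\int[kap]_x (f^\-)%E (tsub x (zv m)))%E.
  rewrite -fineB.
  - by congr fine; rewrite [LHS]integralE; congr (_ - _)%E; apply: eq_integral => x _; rewrite ?funeposE ?funenegE.
  - exact: (integrable_fin_num measurableT (integrable_cell m ip)).
  - exact: (integrable_fin_num measurableT (integrable_cell m iN)).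
rewrite E1 (_ : (fun n => _) = (fun n =>
    \sum_(m <- zprefix n) fine (\int[kap]_x (f^\+)%E (tsub x (zv m)))%E -
    \sum_(m <- zprefix n) fine (\int[kap]_x (f^\-)%E (tsub x (zv m)))%E)); last first.
  by apply/funext => n; rewrite -sumrB; apply: eq_bigr => m _; rewrite E2.
by apply: cvgB; apply: part.
Qed.

Lemma cfold_cvg (F : X -> R[i]) (e : R) : cintegrable lam F -> 0 < e ->
  exists J, forall n, (J <= n)%N ->
  nsq (\sum_(m <- zprefix n) cint kap (fun x => F (tsub x (zv m))) - cint lam F) <= e.
Proof.
move=> [iR iI] e0.
have e1 : 0 < Num.sqrt (e / 2) by rewrite sqrtr_gt0 divr_gt0.
have /cvgrPdist_lt /(_ _ e1) [J1 _ h1] := fold_cvg iR.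
have /cvgrPdist_lt /(_ _ e1) [J2 _ h2] := fold_cvg iI.
exists (maxn J1 J2) => n; rewrite geq_max => /andP[n1 n2].
have Resum (s : seq Z) (a : Z -> R[i]) :
    complex.Re (\sum_(m <- s) a m) = \sum_(m <- s) complex.Re (a m).
  by elim: s => [|i s ih]; rewrite ?big_nil// !big_cons ReD ih.
have Imsum (s : seq Z) (a : Z -> R[i]) :
    complex.Im (\sum_(m <- s) a m) = \sum_(m <- s) complex.Im (a m).
  by elim: s => [|i s ih]; rewrite ?big_nil// !big_cons ImD ih.
have ReN (z : R[i]) : complex.Re (- z) = - complex.Re z by case: z.
have ImN (z : R[i]) : complex.Im (- z) = - complex.Im z by case: z.
have sqle (a : R) : `|a| < Num.sqrt (e / 2) -> a ^+ 2 <= e / 2.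
  have q : Num.sqrt (e / 2) ^+ 2 = e / 2 by rewrite sqr_sqrtr// divr_ge0// ltW.
  by move=> ha; rewrite -[leRHS]q -real_normK ?num_real// ler_pXn2r ?nnegrE// ltW.
rewrite nsqB /nsq ReD ReN Resum ImD ImN Imsum.
have := sqle _ (h1 _ n1); have := sqle _ (h2 _ n2); rewrite /=; lra.
Qed.

End folding.

Section Zak_Fourier.
Context {R : realType} {l : nat}.
Notation X := (l.-tuple R).
Notation Z := (l.-tuple int).
Notation zv := (@int_tuple R l).
Notation kap := (kap R l).
Notation kap2 := (kap2 R l).
Notation lam := (lebesgueT R l).
Variables (g : X -> R[i]) (G : X * X -> R[i]).
Hypothesis lg : L2 lam g.
Hypothesis g1 : lam.-integrable setT (fun x => (normc (g x))%:E).
Hypothesis zG : zak g G.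

Lemma fourierL1E xi : fourierL1 g xi = cint lam (fun x => g x * conjc (eu x xi)).
Proof. by apply: eq_cint => x; rewrite /eu -expiN. Qed.

Lemma normc_mul_eu (z : R[i]) (x y : X) : normc (z * conjc (eu x y)) = normc z.
Proof. by rewrite !normc_sqrt nsqM nsq_conj nsq_eu mulr1. Qed.

Lemma cmeas_mul_eu (f : X -> R[i]) xi : cmeas f -> cmeas (fun x => f x * conjc (eu x xi)).
Proof.
move=> mf; apply: cmeasM => //; apply: cmeas_conj.
by apply: cmeas_eu => //; exact: measurable_cst.
Qed.

Lemma fourier_cintegrable xi : cintegrable lam (fun x => g x * conjc (eu x xi)).
Proof.
apply: (le_cintegrable _ _ g1); first exact: cmeas_mul_eu lg.1.
by move=> x; rewrite normc_mul_eu.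
Qed.

Lemma conjcM (z w : R[i]) : conjc (z * w) = conjc z * conjc w.
Proof. by case: z => a b; case: w => c d; apply: eq_ReIm => /=; ring. Qed.

(** Poisson summation on partial sums: since m.k is an integer, integrating g(x - m) e^(2 pi i m.y)
    against e^(-2 pi i x.(y + k)) over the cube gives the part of the Fourier integral at y + k that
    comes from the m-th cell. The twist by e^(-2 pi i x.y) makes G(., y) periodic. *)
Lemma zak_fourier : {ae kap, forall y,
  CR (fun x => G (x, y) * conjc (eu x y)) (fun k => fourierL1 g (tadd y (zv k)))}.
Proof.
case: (zG) => mG _ _ [k [jk cG]].
pose F j y := N2 kap (fun x => zsum g (zprefix (k j)) (x, y) - G (x, y)).
have md j : cmeas (fun z => zsum g (zprefix (k j)) z - G z).
  by apply: cmeasB => //; exact: cmeas_zsum.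
have p1 j z : (0 <= (nsq (zsum g (zprefix (k j)) z - G z))%:E)%E.
  by rewrite lee_fin nsq_ge0.
have mF j : measurable_fun setT (F j).
  by exact: (measurable_kap_inner_swap (measurable_ensq (md j))).
have F0 j x : (0 <= F j x)%E by exact: N2_ge0.
have cF : (fun j => \int[kap]_x F j x)%E @ \oo --> 0%E.
  rewrite (_ : (fun j => _) = fun j => N2 kap2 (fun z => zsum g (zprefix (k j)) z - G z))//.
  apply/funext => j; apply/esym.
  exact: (ge0_integral_kap2_swap (measurable_ensq (md j))).
have liminf0 := ae_limn_einf0 mF F0 cF.
apply: filterS2 (ae_section2_L2 lg zG) liminf0 => y ly Fy.
have lye (f : X -> R[i]) : L2 kap f -> L2 kap (fun x => f x * conjc (eu x y)).
  move=> lf; under eq_fun do rewrite mulrC.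
  apply: (@L2_bounded_mul _ _ _ _ 1) => //; last by move=> x; rewrite nsq_conj nsq_eu.
  by apply: cmeas_conj; apply: cmeas_eu => //; exact: measurable_cst.
split; first exact: lye.
have lcell m : L2 kap (fun x => g (tsub x (zv m))).
  split; first exact: cmeas_tsub.
  apply: le_lt_trans lg.2; apply: (ge0_cell_le (F := fun x => (nsq (g x))%:E)).
    exact: measurable_ensq lg.1.
  by move=> x; rewrite lee_fin nsq_ge0.
have zL2 j : L2 kap (fun x => zsum g (zprefix (k j)) (x, y)).
  apply: L2_sum => m; under eq_fun do rewrite mulrC.
  exact: (L2Z (ch m y) (lcell m)).
move=> q; set c := ip _ _ _; pose xi := tadd y (zv q).
have zsumE n : ip kap (fun x => zsum g (zprefix n) (x, y) * conjc (eu x y)) (ch q) =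
   \sum_(m <- zprefix n) cint kap (fun x => g (tsub x (zv m)) * conjc (eu (tsub x (zv m)) xi)).
  rewrite -cint_sum; last first.
    move=> m; apply: (@le_cintegrable _ _ _ _ _ (fun x => normc (g (tsub x (zv m))))).
    - exact: (cmeas_comp (measurable_tsub (zv m)) (cmeas_mul_eu xi lg.1)).
    - by move=> x; rewrite normc_mul_eu.
    - exact: integrable_cell g1.
  apply: eq_cint => x; rewrite /zsum !mulr_suml; apply: eq_bigr => m _.
  rewrite /xi {2}/tsub euDr !euDl !euNl eu_zv /ch [eu (zv q) x]euC.
  move: (eu x y) (eu (zv m) y) (eu x (zv q)) => a b c'.
  rewrite !conjcM !conjcK /=.
  by ring.
(* The coefficient c is compared with the Fourier integral through [cj], that of a partial sum: the
   second distance is small because g is integrable, the first has lower limit 0 by Bessel's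
   inequality. *)
have key (e : R) : 0 < e -> nsq (c - fourierL1 g xi) <= 2 * e.
  move=> e0; have [J hJ] := cfold_cvg (fourier_cintegrable xi) e0.
  have : (((nsq (c - fourierL1 g xi)) / 2 - e)%:E <= 0)%E.
    rewrite -Fy; apply: limn_einf_ge; exists J => j Jj.
    have Jk : (J <= k j)%N by exact: leq_trans (jk j).
    have := hJ _ Jk; rewrite -fourierL1E -zsumE; set cj := ip _ _ _ => h.
    have B : ((nsq (cj - c))%:E <= F j y)%E.
      rewrite /cj /c -ipBl; [|exact: lye..|exact: L2_ch].
      apply: le_trans (ip_Bessel _ (L2_ch q) _) _.
      + by apply: L2B; exact: lye.
      + by apply: N2_kap_unit; exact: nsq_ch.
      + rewrite le_eqVlt; apply/orP; left; apply/eqP; apply: eq_integral => x _.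
        by rewrite -mulrBl nsqM nsq_conj nsq_eu mulr1.
    apply: le_trans B; rewrite lee_fin.
    have := nsqD (c - cj) (cj - fourierL1 g xi).
    rewrite addrA subrK (nsqB c cj); lra.
  rewrite lee_fin; lra.
apply/eqP; rewrite -subr_eq0; apply/eqP/nsq_eq0.
apply/eqP; rewrite eq_le nsq_ge0 andbT.
apply/ler_addgt0Pr => e e0; rewrite add0r.
by rewrite (le_trans (key (e / 2) _)) ?divr_gt0// mulrCA mulfV ?mulr1.
Qed.

(* Measurability of the parametric integral comes from Tonelli applied to the
   positive and negative parts. *)
Lemma cmeas_fourierL1 : cmeas (fourierL1 g).
Proof.
have part (h : X -> X -> R) : measurable_fun setT (fun z : X * X => h z.1 z.2) ->
    measurable_fun setT (fun xi => \int[lam]_x h x xi).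
  move=> mh; apply: (measurableT_comp (fine_measurable measurableT)).
  under eq_fun do rewrite integralE.
  pose F (z : X * X) := (h z.1 z.2)%:E.
  have mF : measurable_fun setT F by exact/measurable_EFinP.
  apply: emeasurable_funB.
    rewrite (_ : (fun xi => _) = fun xi => \int[lam]_x (F^\+)%E (x, xi))%E; last first.
      by apply/funext => xi; apply: eq_integral => x _; rewrite !funeposE.
    exact: (measurable_fun_fubini_tonelli_G _ (measurable_funepos mF) (funepos_ge0 F)).
  rewrite (_ : (fun xi => _) = fun xi => \int[lam]_x (F^\-)%E (x, xi))%E; last first.
    by apply/funext => xi; apply: eq_integral => x _; rewrite !funenegE.
  exact: (measurable_fun_fubini_tonelli_G _ (measurable_funeneg mF) (funeneg_ge0 F)).
have mz : cmeas (fun z : X * X => g z.1 * conjc (eu z.1 z.2)).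
  apply: cmeasM; first exact: cmeas_comp measurable_fst lg.1.
  by apply: cmeas_conj; apply: cmeas_eu; [exact: measurable_fst|exact: measurable_snd].
rewrite (_ : fourierL1 g = fun xi => cint lam (fun x => g x * conjc (eu x xi))); last first.
  by apply/funext => xi; rewrite fourierL1E.
by split; apply: part; case: mz.
Qed.

(** Both sides are the norm of G: summing |ghat(y + k)|^2 over k is Parseval in x at fixed y, while
    [zak_isometry] is Parseval in y at fixed x. *)
Lemma Plancherel_L1 : N2 lam (fourierL1 g) = N2 lam g.
Proof.
rewrite -(zak_isometry lg zG).
have mG := zak_cmeas zG; have m1 := measurable_ensq mG.
have p1 z : (0 <= (nsq (G z))%:E)%E by rewrite lee_fin nsq_ge0.
have mf := measurable_ensq cmeas_fourierL1.
rewrite [in RHS]/N2 (ge0_integral_kap2_swap m1)// /N2.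
rewrite unfold_integral//; last by move=> x; rewrite lee_fin nsq_ge0.
apply: ge0_ae_eq_integral => //.
- apply: measurable_esum => [m x|m]; first by rewrite lee_fin nsq_ge0.
  exact: (measurableT_comp mf (measurable_tsub (zv m))).
- exact: (measurable_kap_inner_swap m1).
- by move=> x _; apply: esum_ge0 => m _; rewrite lee_fin nsq_ge0.
- by move=> x _; exact: integral_ge0.
- apply: filterS zak_fourier => y /Parseval h _.
  transitivity (\esum_(m in [set: Z]) (nsq (fourierL1 g (tadd y (zv m))))%:E)%E.
    (* Unfolding produces the points y - m, whereas the coefficients belong to y + m. *)
    rewrite (@reindex_esum _ _ _ setT setT zopp).
      apply: eq_esum => m _; congr (nsq (fourierL1 g _))%:E.
      by apply: eq_from_tnth => i; rewrite !tnth_mktuple ?intrN ?opprK.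
    split=> [m _ //|m n _ _ h'|m _]; first by rewrite -(zoppK m) h' zoppK.
    by exists (zopp m) => //; rewrite zoppK.
  rewrite -h; apply: eq_integral => x _.
  by rewrite nsqM nsq_conj nsq_eu mulr1.
Qed.

End Zak_Fourier.

(** * Combinations of time-frequency shifts under the Fourier transform *)

Section time_frequency.
Context {R : realType} {l : nat}.
Notation X := (l.-tuple R).
Notation lam := (lebesgueT R l).
Implicit Types (f g h u : X -> R[i]) (s : seq (R[i] * (X * X))).

(** In an entry (c, (a, b)) the frequency a precedes the translation b. Gabor sums, translates and
    modulations all have this form, and the Fourier transform preserves it. *)
Definition combo s f (x : X) : R[i] :=
  \sum_(q <- s) q.1 * (eu q.2.1 x * f (tsub x q.2.2)).

(* The Fourier transform of e^(2 pi i a.x) f(x - b) is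
   e^(2 pi i a.b) e^(- 2 pi i b.xi) fhat(xi - a). *)
Definition hatq (q : R[i] * (X * X)) := (q.1 * eu q.2.2 q.2.1, (topp q.2.2, q.2.1)).
Definition unhatq (q : R[i] * (X * X)) := (q.1 * eu q.2.1 q.2.2, (q.2.2, topp q.2.1)).

Lemma toppK : involutive (@topp R l).
Proof. by move=> x; apply: eq_from_tnth => i; rewrite !tnth_mktuple opprK. Qed.

Lemma unhatqK : cancel unhatq hatq.
Proof.
move=> [c [a b]]; rewrite /hatq /unhatq /= toppK; congr (_, _).
by rewrite euNl -mulrA euV mulr1.
Qed.

Lemma cmeas_tf (a b : X) f : cmeas f -> cmeas (fun x => eu a x * f (tsub x b)).
Proof.
move=> mf; apply: cmeasM; last exact: cmeas_comp (measurable_tsub b) mf.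
by apply: cmeas_eu => //; exact: measurable_cst.
Qed.

Lemma cmeas_combo s f : cmeas f -> cmeas (combo s f).
Proof. by move=> mf; apply: cmeas_sum => q; apply: cmeasZ; exact: cmeas_tf. Qed.

Lemma ge0_lam_tsub (F : X -> \bar R) b : measurable_fun setT F -> (forall x, 0 <= F x)%E ->
  (\int[lam]_x F (tsub x b) = \int[lam]_x F x)%E.
Proof. by move=> mF F0; exact: ge0_integral_lebesgueT_shift. Qed.

Lemma N2_tf (a b : X) f : cmeas f -> N2 lam (fun x => eu a x * f (tsub x b)) = N2 lam f.
Proof.
move=> mf; rewrite -[RHS](ge0_lam_tsub b (measurable_ensq mf)); last first.
  by move=> x; rewrite lee_fin nsq_ge0.
by apply: eq_integral => x _; rewrite nsqM nsq_eu mul1r.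
Qed.

Lemma N2_combo_le s : exists2 C : R, 0 <= C &
  forall f, cmeas f -> (N2 lam (combo s f) <= C%:E * N2 lam f)%E.
Proof.
elim: s => [|q s [C C0 ih]].
  exists 0 => // f mf; rewrite mul0e (eq_N2 lam (g := fun=> 0)) ?N2_eq0//.
  by move=> x; rewrite /combo big_nil.
exists (2 * nsq q.1 + 2 * C) => [|f mf]; first by rewrite addr_ge0 ?mulr_ge0 ?nsq_ge0.
rewrite (eq_N2 lam (g := fun x => q.1 * (eu q.2.1 x * f (tsub x q.2.2)) + combo s f x)); last first.
  by move=> x; rewrite /combo big_cons.
apply: le_trans (N2D lam _ _) _; [exact/cmeasZ/cmeas_tf|exact: cmeas_combo|].
rewrite N2Z; last exact: cmeas_tf.
rewrite N2_tf// [(2 * nsq q.1 + 2 * C)%:E]EFinD [leRHS]ge0_muleDl ?lee_fin ?mulr_ge0 ?nsq_ge0//.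
rewrite [(2 * nsq q.1)%:E]EFinM [(2 * C)%:E]EFinM -!muleA leeD2l// lee_pmul2l//; exact: ih.
Qed.

Lemma L2_combo s f : L2 lam f -> L2 lam (combo s f).
Proof.
move=> [mf fo]; split; first exact: cmeas_combo.
have [C C0 h] := N2_combo_le s; apply: le_lt_trans (h _ mf) _.
by rewrite lte_mul_pinfty.
Qed.

Lemma comboB s f g x : combo s (fun x => f x - g x) x = combo s f x - combo s g x.
Proof. by rewrite /combo -sumrB; apply: eq_bigr => q _; ring. Qed.

Lemma combo_cvg s (u : nat -> X -> R[i]) g : (forall n, cmeas (u n)) -> cmeas g ->
  (fun n => N2 lam (fun x => u n x - g x)) @ \oo --> 0%E ->
  (fun n => N2 lam (fun x => combo s (u n) x - combo s g x)) @ \oo --> 0%E.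
Proof.
move=> mu mg cu; have [C C0 h] := N2_combo_le s.
apply: (@squeeze_cvge _ _ _ _ (cst 0%E) _ (fun n => (C%:E * N2 lam (fun x => u n x - g x)%R)%E)).
- apply: nearW => n; rewrite N2_ge0 /=.
  rewrite -(eq_N2 lam (f := combo s (fun x => u n x - g x))).
    by apply: h; exact: cmeasB.
  by move=> x; rewrite comboB.
- exact: cvg_cst.
- by rewrite -(mule0 C%:E); apply: cvgeZl.
Qed.

Definition L1 f := cmeas f /\ lam.-integrable setT (fun x => (normc (f x))%:E).

Lemma measurable_normc f : cmeas f -> measurable_fun setT (fun x => normc (f x)).
Proof.
move=> mf; under eq_fun do rewrite normc_sqrt.
apply: (measurableT_comp (continuous_measurable_fun (@sqrt_continuous R))).
exact: measurable_nsq.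
Qed.

Lemma L1_tf (a b : X) f : L1 f -> L1 (fun x => eu a x * f (tsub x b)).
Proof.
move=> [mf /integrableP[_ fo]]; split; first exact: cmeas_tf.
apply/integrableP; split.
  by apply/measurable_EFinP; apply: measurable_normc; exact: cmeas_tf.
apply: le_lt_trans fo.
have mE : measurable_fun setT (fun x => `|(normc (f x))%:E|%E).
  by apply: measurableT_comp => //; apply/measurable_EFinP; exact: measurable_normc.
rewrite -[leRHS](ge0_lam_tsub b mE)//.
rewrite le_eqVlt; apply/orP; left; apply/eqP; apply: eq_integral => x _.
by rewrite !normc_sqrt nsqM nsq_eu mul1r.
Qed.

Lemma L1_combo s f : L1 f -> L1 (combo s f).
Proof.
move=> lf; elim: s => [|q s [mi ih]].
  rewrite (_ : combo [::] f = fun=> 0); last by apply/funext => x; rewrite /combo big_nil.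
  split; first exact: cmeas_cst.
  by under eq_fun do rewrite normc_sqrt nsq0 sqrtr0; exact: integrable0.
rewrite (_ : combo (q :: s) f = fun x => q.1 * (eu q.2.1 x * f (tsub x q.2.2)) + combo s f x); last first.
  by apply/funext => x; rewrite /combo big_cons.
have [mt it] := L1_tf q.2.1 q.2.2 lf.
have mm : cmeas (fun x => q.1 * (eu q.2.1 x * f (tsub x q.2.2)) + combo s f x).
  by apply: cmeasD => //; exact: cmeasZ.
split => //.
have := @integrableD _ _ _ lam setT measurableT _ _ (integrableZl measurableT (normc q.1) it) ih.
apply: le_integrable => //; first by apply/measurable_EFinP; exact: measurable_normc.
move=> x _ /=; rewrite lee_fin !ger0_norm ?addr_ge0 ?mulr_ge0 ?normc_ge0//.
by rewrite (le_trans (le_normcD _ _))// ComplexField.Normc.normcM.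
Qed.

Lemma fourierL1_tf (a b : X) f xi : L1 f ->
  fourierL1 (fun x => eu a x * f (tsub x b)) xi =
  conjc (eu b (tsub xi a)) * fourierL1 f (tsub xi a).
Proof.
move=> [mf f1]; rewrite !fourierL1E.
pose F x := f x * conjc (eu x (tsub xi a)).
have mF : cmeas F by exact: cmeas_mul_eu.
have shiftR (H : X -> R) : measurable_fun setT H ->
    \int[lam]_x H (tsub x b) = \int[lam]_x H x.
  move=> mH; rewrite /Rintegral; congr fine.
  rewrite [LHS]integralE [RHS]integralE; congr (_ - _)%E.
    transitivity (\int[lam]_x ((fun x => (H x)%:E)^\+)%E (tsub x b))%E.
      by apply: eq_integral => x _; rewrite !funeposE.
    apply: ge0_lam_tsub; last by move=> x; exact: funepos_ge0.
    by apply: measurable_funepos; exact/measurable_EFinP.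
  transitivity (\int[lam]_x ((fun x => (H x)%:E)^\-)%E (tsub x b))%E.
    by apply: eq_integral => x _; rewrite !funenegE.
  apply: ge0_lam_tsub; last by move=> x; exact: funeneg_ge0.
  by apply: measurable_funeneg; exact/measurable_EFinP.
have shift : cint lam (fun x => F (tsub x b)) = cint lam F.
  by apply: eq_ReIm; [apply: (shiftR (fun x => complex.Re (F x))); exact: mF.1|
    apply: (shiftR (fun x => complex.Im (F x))); exact: mF.2].
have iFs : cintegrable lam (fun x => F (tsub x b)).
  apply: (@le_cintegrable _ _ _ _ _ (fun x => normc (f (tsub x b)))).
  - exact: cmeas_comp (measurable_tsub b) mF.
  - by move=> x; rewrite normc_mul_eu.
  - have [_] := L1_tf [tuple 0 | i < l] b (conj mf f1).
    apply: eq_integrable => // x _; rewrite !normc_sqrt nsqM nsq_eu mul1r//.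
rewrite -shift -cintZ//; apply: eq_cint => x.
rewrite /F /tsub !euDr !euDl !euNl !euNr !conjcM !conjcK.
move: (euV b xi) (euV b a) (eu x xi) => h1 h2 exi.
rewrite [eu a x]euC; move: (eu x a) (eu b xi) (eu b a) h1 h2 => exa u v h1 h2.
transitivity (exa * f (tadd x (topp b)) * conjc exi * (u * conjc u) * (v * conjc v)).
  by rewrite h1 h2; ring.
by ring.
Qed.

Lemma fourierL1_combo s f : L1 f -> fourierL1 (combo s f) =1 combo (map hatq s) (fourierL1 f).
Proof.
move=> lf xi; rewrite fourierL1E.
rewrite (_ : (fun x => _) = fun x => \sum_(q <- s)
    (q.1 * (eu q.2.1 x * f (tsub x q.2.2))) * conjc (eu x xi)); last first.
  by apply/funext => x; rewrite mulr_suml.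
have it q : cintegrable lam (fun x => (eu q.2.1 x * f (tsub x q.2.2)) * conjc (eu x xi)).
  have [mt it] := L1_tf q.2.1 q.2.2 lf.
  by apply: (le_cintegrable (cmeas_mul_eu xi mt) _ it) => x; rewrite normc_mul_eu.
rewrite cint_sum; last first.
  by move=> q; under eq_fun do rewrite -mulrA; exact: cintegrableZ.
rewrite /combo big_map; apply: eq_bigr => q _.
under eq_cint do rewrite -mulrA.
rewrite cintZ// -fourierL1E fourierL1_tf//.
transitivity (q.1 * eu q.2.2 q.2.1 * (eu (topp q.2.2) xi * fourierL1 f (tsub xi q.2.1)));
  last by [].
by rewrite {1}/tsub euDr euNr conjcM conjcK euNl; ring.
Qed.

Lemma Plancherel_combo s f : L1 f -> L2 lam f ->
  N2 lam (combo (map hatq s) (fourierL1 f)) = N2 lam (combo s f).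
Proof.
move=> l1 l2; have [G zG] := zak_exists (L2_combo s l2).
rewrite -(Plancherel_L1 (L2_combo s l2) (L1_combo s l1).2 zG).
by apply: eq_N2 => x; rewrite fourierL1_combo.
Qed.

End time_frequency.

(** * Plancherel duality in L^2 and transfer of the Riesz bounds *)

Section Fourier_duality.
Context {R : realType} {l : nat}.
Notation X := (l.-tuple R).
Notation Z := (l.-tuple int).
Notation zv := (@int_tuple R l).
Notation lam := (lebesgueT R l).
Implicit Types (f g h : X -> R[i]).

Lemma poweR2 (x : \bar R) : (0 <= x)%E -> (x `^ 2 = x * x)%E.
Proof.
case: x => [r| |]; rewrite ?lee_fin => // r0.
  by rewrite poweR_EFin powR_mulrn// expr2 EFinM.
by rewrite /= pnatr_eq0 /= mulyy.
Qed.

Lemma cLnorm_ge0 p f : (0 <= cLnorm p f)%E.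
Proof. exact: Lnorm_ge0. Qed.

Lemma cLnorm2_sqr f : (cLnorm 2 f * cLnorm 2 f = N2 lam f)%E.
Proof.
rewrite -poweR2 ?cLnorm_ge0// /cLnorm powR_Lnorm ?pnatr_eq0//.
apply: eq_integral => x _ /=.
by rewrite powR_mulrn ?normr_ge0// real_normK ?num_real// nsqE.
Qed.

Lemma cLnorm2_lty f : (cLnorm 2 f < +oo)%E = (N2 lam f < +oo)%E.
Proof.
rewrite -cLnorm2_sqr; have := cLnorm_ge0 2 f; case: (cLnorm 2 f) => [r| |] _ //.
by rewrite -EFinM !ltry.
Qed.

Lemma memL2E f : memL 2 f <-> L2 lam f.
Proof.
split=> -[mf hf]; split => //.
  by rewrite -cLnorm2_lty.
by rewrite cLnorm2_lty.
Qed.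

Lemma memL1_L1 f : memL 1 f -> L1 f.
Proof.
move=> [mf hf]; split => //; apply/integrableP; split.
  by apply/measurable_EFinP; exact: measurable_normc.
move: hf; rewrite /cLnorm Lnorm1; apply: le_lt_trans.
by rewrite le_eqVlt; apply/orP; left; apply/eqP; exact: eq_integral.
Qed.

Lemma cLnorm2_cvg0 (u : nat -> X -> R[i]) :
  (fun n => cLnorm 2 (u n)) @ \oo --> 0%E -> (fun n => N2 lam (u n)) @ \oo --> 0%E.
Proof.
move=> cu; rewrite (_ : (fun n => _) = (fun n => cLnorm 2 (u n) * cLnorm 2 (u n))%E).
  by rewrite -[X in _ --> X](mule0 0%E); apply: cvgeM => //; rewrite mule_def_fin.
by apply/funext => n; rewrite cLnorm2_sqr.
Qed.

(** What is retained of a Fourier pair. This family of identities passes to L^2 limits, carries the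
    Riesz bounds from g to h, and yields the multiplier formulas in both directions without Fourier
    inversion. *)
Definition dual g h : Prop := forall s, N2 lam (combo s g) = N2 lam (combo (map hatq s) h).

(** [Plancherel_combo] settles the approximating functions in L^1; combinations are continuous in
    L^2, so [N2_cvg_le] transfers both inequalities to the limit. *)
Lemma fourier_dual g gh : is_fourierL2 g gh -> dual g gh.
Proof.
move=> [/memL2E lg /memL2E lgh [u [hu /cLnorm2_cvg0 cu /cLnorm2_cvg0 cuh]]] s.
have u1 n : L1 (u n) by apply: memL1_L1; case: (hu n).
have u2 n : L2 lam (u n) by apply/memL2E; case: (hu n).
have mf n : cmeas (fourierL1 (u n)).
  by have [G zG] := zak_exists (u2 n); exact: (cmeas_fourierL1 (u2 n)).
have mu n : cmeas (u n) by case: (u2 n).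
have c1 := combo_cvg s mu lg.1 cu.
have c2 := combo_cvg (map hatq s) mf lgh.1 cuh.
apply/eqP; rewrite eq_le; apply/andP; split.
  apply: (N2_cvg_le _ _ _ _ _ c1 c2) => [n|n|||n];
    [exact: cmeas_combo|exact: cmeas_combo|exact: cmeas_combo lg.1|exact: cmeas_combo lgh.1|].
  by rewrite Plancherel_combo.
apply: (N2_cvg_le _ _ _ _ _ c2 c1) => [n|n|||n];
  [exact: cmeas_combo|exact: cmeas_combo|exact: cmeas_combo lgh.1|exact: cmeas_combo lg.1|].
by rewrite Plancherel_combo.
Qed.

Definition riesz_bounds g (A B : R) : Prop :=
  forall (s : seq (Z * Z)) (c : Z * Z -> R[i]), uniq s ->
  ((A * \sum_(i <- s) nsq (c i))%:E <= N2 lam (combo [seq (c i, (zv i.2, zv i.1)) | i <- s] g))%E /\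
  (N2 lam (combo [seq (c i, (zv i.2, zv i.1)) | i <- s] g) <= (B * \sum_(i <- s) nsq (c i))%:E)%E.

Lemma gaborE g mn x : gabor g mn x = eu (zv mn.2) x * g (tsub x (zv mn.1)).
Proof.
rewrite /gabor mulrC /eu; congr (_ * g _); apply: eq_from_tnth => i.
by rewrite !tnth_mktuple.
Qed.

Lemma riesz_basis_bounds g : riesz_basis (gabor g) ->
  exists A B, [/\ 0 < A, 0 < B & riesz_bounds g A B].
Proof.
move=> [_ _ [A [B [A0 B0 h]]]]; exists A, B; split => // s c us.
have := h s c us => /=.
rewrite (eq_bigr (fun i => nsq (c i))); last by move=> i _; exact: nsqE.
rewrite cLnorm2_sqr (eq_N2 lam (g := combo [seq (c i, (zv i.2, zv i.1)) | i <- s] g))//.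
move=> x; rewrite /combo big_map; apply: eq_bigr => i _.
by rewrite gaborE.
Qed.

(** The Fourier transform rotates the lattice: the atom of g with translation -n and frequency m
    goes to the atom of h with translation m and frequency n, with phase 1 because m.n is an
    integer. *)
Lemma riesz_bounds_dual g h A B : dual g h -> riesz_bounds g A B -> riesz_bounds h A B.
Proof.
move=> gh rg s c us.
pose phi (i : Z * Z) := (zopp i.2, i.1); pose psi (i : Z * Z) := (i.2, zopp i.1).
have phiK : cancel phi psi by move=> [m n]; rewrite /phi /psi /= zoppK.
have := rg (map phi s) (c \o psi).
rewrite map_inj_uniq ?us; last exact: can_inj phiK.
move=> /(_ isT); rewrite big_map.
under eq_bigr do rewrite /= phiK.
set t := [seq (c i, (zv i.2, zv i.1)) | i <- s].
rewrite (gh _) (_ : map hatq _ = t)// /t -!map_comp; apply: eq_map => i /=.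
rewrite -/(phi i) phiK /hatq /= zv_opp toppK; congr (_, _).
by rewrite euNl -[eu _ _]/(ch i.2 (zv i.1)) ch_zv conjc1 mulr1.
Qed.

End Fourier_duality.

(** * Riesz bounds of the Zak transform *)

Section Zak_bounds.
Context {R : realType} {l : nat}.
Notation X := (l.-tuple R).
Notation Z := (l.-tuple int).
Notation zv := (@int_tuple R l).
Notation kap := (kap R l).
Notation kap2 := (kap2 R l).
Notation lam := (lebesgueT R l).

Definition ch2 (i : Z * Z) (z : X * X) : R[i] := ch i.1 z.1 * ch i.2 z.2.
Definition zadd2 (i j : Z * Z) : Z * Z := (zadd i.1 j.1, zadd i.2 j.2).

Lemma ch2D i j z : ch2 (zadd2 i j) z = ch2 i z * ch2 j z.
Proof. by rewrite /ch2 !chD; ring. Qed.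

Lemma cmeas_ch2 i : cmeas (ch2 i).
Proof.
apply: cmeasM; apply: cmeas_eu => //; exact: measurable_cst.
Qed.

Lemma nsq_ch2 i z : nsq (ch2 i z) = 1.
Proof. by rewrite nsqM !nsq_ch mulr1. Qed.

Lemma L2_kap2_unit (f : X * X -> R[i]) : cmeas f -> (forall z, nsq (f z) = 1) -> L2 kap2 f.
Proof.
move=> mf f1; split => //; rewrite /N2; under eq_integral do rewrite f1.
by rewrite integral_cst// mul1e [X in (X < _)%E](@kap2_setT R l) ltry.
Qed.

Lemma L2_ch2 i : L2 kap2 (ch2 i).
Proof. by apply: L2_kap2_unit; [exact: cmeas_ch2|exact: nsq_ch2]. Qed.

Lemma cint_kap2_shift (f : X * X -> R[i]) (s t : X) : cmeas f ->
  (forall x y m, f (tadd x (zv m), y) = f (x, y)) ->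
  (forall x y m, f (x, tadd y (zv m)) = f (x, y)) ->
  cint kap2 (fun z => f (tadd z.1 s, tadd z.2 t)) = cint kap2 f.
Proof.
move=> [m1 m2] p1 p2.
have key (h : X * X -> R) : measurable_fun setT h ->
    (forall x y m, h (tadd x (zv m), y) = h (x, y)) ->
    (forall x y m, h (x, tadd y (zv m)) = h (x, y)) ->
    \int[kap2]_z h (tadd z.1 s, tadd z.2 t) = \int[kap2]_z h z.
  move=> mh q1 q2; pose H z := (h z)%:E.
  have mH : measurable_fun setT H by exact/measurable_EFinP.
  rewrite /Rintegral; congr fine; rewrite [LHS]integralE [RHS]integralE; congr (_ - _)%E.
    transitivity (\int[kap2]_z (H^\+)%E (tadd z.1 s, tadd z.2 t))%E.
      by apply: eq_integral => z _; rewrite !funeposE.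
    apply: (ge0_integral_kap2_shift s t (F := H^\+%E)); first exact: measurable_funepos.
    + exact: funepos_ge0.
    + by move=> x y m; rewrite !funeposE /H q1.
    + by move=> x y m; rewrite !funeposE /H q2.
  transitivity (\int[kap2]_z (H^\-)%E (tadd z.1 s, tadd z.2 t))%E.
    by apply: eq_integral => z _; rewrite !funenegE.
  apply: (ge0_integral_kap2_shift s t (F := H^\-%E)); first exact: measurable_funeneg.
  + exact: funeneg_ge0.
  + by move=> x y m; rewrite !funenegE /H q1.
  + by move=> x y m; rewrite !funenegE /H q2.
apply: eq_ReIm; apply: key => // x y m; by rewrite ?p1 ?p2.
Qed.

Lemma ch2_orthogonal i j : ip kap2 (ch2 i) (ch2 j) = (i == j)%:R.
Proof.
have [->|ij] := eqVneq i j.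
  rewrite ip_self (_ : N2 kap2 (ch2 j) = 1%E)//.
  rewrite /N2; under eq_integral do rewrite nsq_ch2.
  by rewrite integral_cst// mul1e [LHS](@kap2_setT R l).
pose k := (zsub i.1 j.1, zsub i.2 j.2).
have -> : ip kap2 (ch2 i) (ch2 j) = cint kap2 (ch2 k).
  apply: eq_cint => z; rewrite /ch2 -[k.1]/(zsub i.1 j.1) -[k.2]/(zsub i.2 j.2).
  by rewrite !chB conjcM; ring.
have [s [t est]] : exists s t : X, ch k.1 s * ch k.2 t = -1 :> R[i].
  have h1 m : ch m [tuple 0 | i < l] = 1 :> R[i].
    rewrite -(ch_zv m [tuple 0 | i < l]); congr (ch m _).
    by apply: eq_from_tnth => q; rewrite !tnth_mktuple.
  have [e1|n1] := eqVneq i.1 j.1.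
    have n2 : i.2 != j.2.
      by apply: contraNneq ij => e2; case: i j e1 e2 {k} => [? ?] [? ?] /= -> ->.
    have [t et] := @ch_eqN1 R l _ (zsub_neq0 n2).
    by exists [tuple 0 | i < l], t; rewrite h1 mul1r.
  have [s es] := @ch_eqN1 R l _ (zsub_neq0 n1).
  by exists s, [tuple 0 | i < l]; rewrite h1 mulr1.
apply: eq_opp0; rewrite -[LHS](cint_kap2_shift s t (cmeas_ch2 k)); last 2 first.
- by move=> x y m; rewrite /ch2 /= ch_period.
- by move=> x y m; rewrite /ch2 /= ch_period.
rewrite -mulN1r -cintZ.
  apply: eq_cint => z; rewrite -est /ch2 /=; rewrite /ch !euDr; ring.
apply: (@le_cintegrable _ _ _ _ _ (fun=> 1)); first exact: cmeas_ch2.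
  by move=> x; rewrite normc_sqrt nsq_ch2 sqrtr1.
exact: finite_measure_integrable_cst.
Qed.

Variables (g : X -> R[i]) (G : X * X -> R[i]).
Hypothesis lg : L2 lam g.
Hypothesis zG : zak g G.

(** An integer translation or modulation of g multiplies its Zak transform by a character, so a
    combination of Gabor atoms becomes a trigonometric polynomial times G. *)
Lemma N2_trig_zak (s : seq (Z * Z)) (c : Z * Z -> R[i]) :
  N2 kap2 (fun z => (\sum_(i <- s) c i * ch2 i z) * G z) =
  N2 lam (combo [seq (c i, (zv i.1, zv (zopp i.2))) | i <- s] g).
Proof.
set f := combo _ _.
have mG := zak_cmeas zG.
have mp : cmeas (fun z => (\sum_(i <- s) c i * ch2 i z) * G z).
  by apply: cmeasM => //; apply: cmeas_sum => i; apply: cmeasZ; exact: cmeas_ch2.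
have mf : cmeas f by apply: cmeas_combo; exact: lg.1.
rewrite (N2_kap2_CR (a := fun x m => f (tsub x (zv m))) mp).
- rewrite [RHS]/N2 unfold_integral//; first exact: measurable_ensq.
  by move=> x; rewrite lee_fin nsq_ge0.
- by move=> m; exact: cmeas_comp (measurable_tsub (zv m)) mf.
apply: filterS (zak_CR lg zG) => x hx.
rewrite (_ : (fun y => _) = fun y => \sum_(i <- s)
    (c i * ch i.1 x) * (conjc (ch (zopp i.2) y) * G (x, y))); last first.
  apply/funext => y; rewrite mulr_suml; apply: eq_bigr => i _.
  by rewrite chN conjcK /ch2 /=; ring.
rewrite (_ : (fun m => _) = fun m => \sum_(i <- s)
    (c i * ch i.1 x) * g (tsub x (zv (zadd m (zopp i.2))))); last first.
  apply/funext => m; rewrite /f /combo big_map; apply: eq_bigr => i _ /=.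
  rewrite -[eu (zv i.1) (tsub x (zv m))]/(ch i.1 (tsub x (zv m))) -mulrA; congr (_ * (_ * g _)).
    by rewrite (zperiodic_sub (F := ch i.1))//; exact: ch_period.
  apply: eq_from_tnth => j; rewrite !tnth_mktuple intrD intrN; lra.
by apply: CR_sum => i; apply: CR_Z; exact: (CR_ch (zopp i.2) hx).
Qed.

Variables (A B : R).
Hypothesis A0 : 0 < A.
Hypothesis B0 : 0 < B.
Hypothesis rg : riesz_bounds g A B.

Lemma trig2_bounds (P : X * X -> R[i]) : trig ch2 P ->
  (A%:E * N2 kap2 P <= N2 kap2 (fun z => P z * G z)%R)%E /\
  (N2 kap2 (fun z => P z * G z)%R <= B%:E * N2 kap2 P)%E.
Proof.
move=> tP; have [s [c [us Ps]]] := trig_uniq tP.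
have NP : N2 kap2 P = (\sum_(i <- s) nsq (c i))%:E.
  have lP : L2 kap2 (fun z => \sum_(i <- s) c i * ch2 i z).
    by apply: L2_sum => i; apply: L2Z; exact: L2_ch2.
  rewrite (eq_N2 kap2 Ps) -(fineK (N2_fin lP)); congr EFin.
  have := N2_sub_orthonormal L2_ch2 ch2_orthogonal c (@L2_0 _ _ _ kap2) us.
  under eq_N2 do rewrite sub0r.
  rewrite N2N N2_eq0 /= => ->.
  have e m : ip kap2 (fun=> 0) (ch2 m) = 0.
    by rewrite /ip; under eq_fun do rewrite mul0r; exact: cint0.
  under eq_bigr do rewrite e nsq0.
  under [X in _ - _ + X]eq_bigr do rewrite e sub0r nsqN.
  by rewrite big1// subr0 add0r.
rewrite NP (eq_N2 kap2 (g := fun z => (\sum_(i <- s) c i * ch2 i z) * G z)); last first.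
  by move=> z; rewrite Ps.
rewrite N2_trig_zak -!EFinM.
pose phi (i : Z * Z) := (zopp i.2, i.1); pose psi (i : Z * Z) := (i.2, zopp i.1).
have phiK : cancel phi psi by move=> [m n]; rewrite /phi /psi /= zoppK.
have := rg (s := map phi s) (c \o psi).
rewrite map_inj_uniq ?us; last exact: can_inj phiK.
move=> /(_ isT); rewrite big_map.
under eq_bigr do rewrite /= phiK.
rewrite -map_comp (_ : [seq _ | i <- s] = [seq (c i, (zv i.1, zv (zopp i.2))) | i <- s])//.
by apply: eq_map => i /=; rewrite -/(phi i) phiK.
Qed.

(* The bounds pass from trigonometric polynomials P to the indicator of E because
   the weight W controls both P - 1_E and (P - 1_E) G. *)
Lemma zak_set_bounds (E : set (X * X)) : measurable E ->
  (A%:E * kap2 E <= N2 kap2 (fun z => cind E z * G z)%R)%E /\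
  (N2 kap2 (fun z => cind E z * G z)%R <= B%:E * kap2 E)%E.
Proof.
move=> mE; have mG := zak_cmeas zG.
pose W z : R[i] := ((Num.sqrt (1 + nsq (G z)))%:C)%C.
have nW z : nsq (W z) = 1 + nsq (G z).
  by rewrite nsq_real sqr_sqrtr// addr_ge0// nsq_ge0.
have lW : L2 kap2 W.
  split.
    apply: cmeas_real; apply: (measurableT_comp (continuous_measurable_fun (@sqrt_continuous R))).
    by apply: measurable_funD => //; exact: measurable_nsq.
  rewrite /N2; under eq_integral do rewrite nW EFinD.
  rewrite ge0_integralD//; last 2 first.
  - by move=> x _; rewrite lee_fin nsq_ge0.
  - exact: measurable_ensq.
  rewrite integral_cst// mul1e [X in (X + _)%E](@kap2_setT R l).
  by rewrite lte_add_pinfty ?ltry//; exact: (zak_L2 lg zG).2.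
have aE : apx kap2 W (trig ch2) (cind E).
  apply: (@dense_indic _ _ _ _ _ _ lW _ _ _ _ _ ('I_l + 'I_l)%type
    (fun j (z : X * X) => match j with inl j => tnth z.1 j | inr j => tnth z.2 j end)) => //.
  - by move=> P; apply: trig_cmeas; exact: cmeas_ch2.
  - by move=> P; apply: trig_bdd; exact: nsq_ch2.
  - move=> c; apply: (trig_cst (i0 := ([tuple 0 | i < l], [tuple 0 | i < l]))) => z.
    by rewrite /ch2 !ch0 mulr1.
  - by move=> P Q; exact: trigD.
  - by move=> P Q; apply: trigM; exact: ch2D.
  - case=> j; first exact: (measurableT_comp (measurable_tnth j) measurable_fst).
    exact: (measurableT_comp (measurable_tnth j) measurable_snd).
  - by case=> j; apply: filterS (@ae_kap2_cube R l) => z [h1 h2].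
  - case=> j c; under eq_fun do rewrite cos_ch.
      rewrite (_ : (fun z : X * X => _) = fun z =>
        (expi (- (2 * pi * c)) / 2) * ch2 (zdelta j, [tuple 0 | i < l]) z +
        (expi (2 * pi * c) / 2) * ch2 (zopp (zdelta j), [tuple 0 | i < l]) z).
        by apply: trigD; exact: trig_char.
      by apply/funext => z; rewrite /ch2 /= ch0 !mulr1.
    rewrite (_ : (fun z : X * X => _) = fun z =>
        (expi (- (2 * pi * c)) / 2) * ch2 ([tuple 0 | i < l], zdelta j) z +
        (expi (2 * pi * c) / 2) * ch2 ([tuple 0 | i < l], zopp (zdelta j)) z).
      by apply: trigD; exact: trig_char.
    by apply/funext => z; rewrite /ch2 /= ch0 !mul1r.
  - by move=> M sM hM; apply: prod_measurable_gen => // j; [exact: (hM (inl j))|exact: (hM (inr j))].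
have hQ (n : nat) : exists P, trig ch2 P /\
    (N2 kap2 (fun z => W z * (cind E z - P z))%R < (n.+1%:R^-1)%:E)%E.
  have n0 : (0 : R) < n.+1%:R^-1 by rewrite invr_gt0.
  by have [Q tQ eQ] := aE.2 _ n0; exists Q.
have [P hP] := choice hQ.
have mc := cmeas_cind (R := R) mE.
have mP n : cmeas (P n) by apply: trig_cmeas (hP n).1; exact: cmeas_ch2.
have mW n : cmeas (fun z => W z * (cind E z - P n z)) by apply: cmeasM; [exact: lW.1|exact: cmeasB].
have small (H : X * X -> R[i]) : cmeas H -> (forall z, nsq (H z) <= nsq (W z)) ->
    (fun n => N2 kap2 (fun z => P n z * H z - cind E z * H z)) @ \oo --> 0%E.
  move=> mH HW.
  apply: (@squeeze_cvge _ _ _ _ (cst 0%E) _ (fun n => (n.+1%:R^-1)%:E)).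
  - apply: nearW => n; rewrite N2_ge0 /=.
    apply: le_trans (ltW (hP n).2); apply: N2_le => //.
      by apply: cmeasB; exact: cmeasM.
    by move=> z; rewrite -mulrBl !nsqM nsqB mulrC ler_wpM2r ?nsq_ge0.
  - exact: cvg_cst.
  - by apply: cvg_EFin; [exact: nearW|exact: cvg_harmonic].
have cG : (fun n => N2 kap2 (fun z => P n z * G z - cind E z * G z)) @ \oo --> 0%E.
  by apply: small => // z; rewrite nW lerDr.
have c1 : (fun n => N2 kap2 (fun z => P n z * 1 - cind E z * 1)) @ \oo --> 0%E.
  by apply: (small (fun=> 1)) => [|z]; [exact: cmeas_cst|rewrite nW nsq1 lerDl nsq_ge0].
have cs (a : R) : (fun n => N2 kap2 (fun z => a%:C%C * P n z - a%:C%C * cind E z)) @ \oo --> 0%E.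
  rewrite (_ : (fun n => _) = fun n => ((nsq a%:C%C)%:E * N2 kap2 (fun z => P n z * 1 - cind E z * 1)%R)%E).
    by rewrite -(mule0 (nsq a%:C%C)%:E); apply: cvgeZl.
  apply/funext => n; rewrite -N2Z; last by apply: cmeasB; apply: cmeasM => //; exact: cmeas_cst.
  by apply: eq_N2 => z; rewrite !mulr1 mulrBr.
have N2s (a : R) (f : X * X -> R[i]) : 0 <= a -> cmeas f ->
    N2 kap2 (fun z => (Num.sqrt a)%:C%C * f z) = (a%:E * N2 kap2 f)%E.
  by move=> a0 mf; rewrite N2Z// nsq_real sqr_sqrtr.
have NE : N2 kap2 (cind E) = kap2 E.
  rewrite /N2; under eq_integral do rewrite nsq_cind.
  by rewrite integral_indic// setIT.
rewrite -NE -(N2s A (cind E) (ltW A0) mc) -(N2s B (cind E) (ltW B0) mc); split.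
  apply: (N2_cvg_le _ _ _ _ _ (cs _) cG) => [n|n|||n].
  - exact: cmeasZ.
  - exact: cmeasM.
  - exact: cmeasZ.
  - exact: cmeasM.
  - by rewrite (N2s A _ (ltW A0) (mP n)); exact: (trig2_bounds (hP n).1).1.
apply: (N2_cvg_le _ _ _ _ _ cG (cs _)) => [n|n|||n].
- exact: cmeasM.
- exact: cmeasZ.
- exact: cmeasM.
- exact: cmeasZ.
- by rewrite (N2s B _ (ltW B0) (mP n)); exact: (trig2_bounds (hP n).1).2.
Qed.

Lemma N2_cind_le (E : set (X * X)) (F : X * X -> R[i]) (c : R) : measurable E -> cmeas F -> 0 <= c ->
  (forall z, E z -> nsq (F z) <= c) ->
  (N2 kap2 (fun z => cind E z * F z)%R <= c%:E * kap2 E)%E.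
Proof.
move=> mE mF c0 hF.
have -> : (c%:E * kap2 E = \int[kap2]_z (c * \1_E z)%:E)%E.
  under eq_integral do rewrite EFinM.
  rewrite ge0_integralZl//; first by rewrite integral_indic// setIT.
  by apply/measurable_EFinP; exact: measurable_indic.
apply: ge0_le_integral => //.
- by move=> z _; rewrite lee_fin nsq_ge0.
- by apply: measurable_ensq; apply: cmeasM => //; exact: cmeas_cind.
- apply/measurable_EFinP; apply: measurable_funM => //; exact: measurable_indic.
- move=> z _; rewrite lee_fin nsqM nsq_cind mulrC indicE.
  case: (boolP (z \in E)) => zE; last by rewrite !mulr0.
  by rewrite !mulr1; apply: hF; rewrite inE in zE.
Qed.

Lemma N2_cind_ge (E : set (X * X)) (F : X * X -> R[i]) (c : R) : measurable E -> cmeas F -> 0 <= c ->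
  (forall z, E z -> c <= nsq (F z)) ->
  (c%:E * kap2 E <= N2 kap2 (fun z => cind E z * F z)%R)%E.
Proof.
move=> mE mF c0 hF.
have -> : (c%:E * kap2 E = \int[kap2]_z (c * \1_E z)%:E)%E.
  under eq_integral do rewrite EFinM.
  rewrite ge0_integralZl//; first by rewrite integral_indic// setIT.
  by apply/measurable_EFinP; exact: measurable_indic.
apply: ge0_le_integral => //.
- by move=> z _; rewrite lee_fin mulr_ge0// indicE ler0n.
- apply/measurable_EFinP; apply: measurable_funM => //; exact: measurable_indic.
- by apply: measurable_ensq; apply: cmeasM => //; exact: cmeas_cind.
- move=> z _; rewrite lee_fin nsqM nsq_cind mulrC indicE.
  case: (boolP (z \in E)) => zE; last by rewrite ?mul0r ?mulr0 ?mul0r ?mulr0.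
  by rewrite ?mul1r ?mulr1; apply: hF; rewrite inE in zE.
Qed.

(** The factors 2 leave a gap: on each exceptional set E the definition of E and [zak_set_bounds]
    together give a |E| <= b |E| with b < a, hence |E| = 0. *)
Lemma zak_bounded : {ae kap2, forall z, A / 2 <= nsq (G z) <= 2 * B}.
Proof.
have mG := measurable_nsq (zak_cmeas zG).
pose E1 := [set z | nsq (G z) < A / 2].
pose E2 := [set z | 2 * B < nsq (G z)].
have mE1 : measurable E1 by apply: (measurable_lt_set (g := cst (A / 2))).
have mE2 : measurable E2 by apply: (measurable_lt_set (f := cst (2 * B))).
have fin E : measurable E -> kap2 E \is a fin_num by move=> mE; exact: fin_num_measure.
have null E (a b : R) : measurable E -> b < a -> (a%:E * kap2 E <= b%:E * kap2 E)%E ->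
    kap2 E = 0%E.
  move=> mE ba; rewrite -(fineK (fin E mE)) -!EFinM lee_fin => h; congr EFin.
  have : 0 <= fine (kap2 E) by rewrite fine_ge0.
  nra.
have n1 : kap2 E1 = 0%E.
  apply: (@null _ A (A / 2)) => //; first by rewrite ltr_pdivrMr // ltr_pMr // ltr1n.
  apply: le_trans (zak_set_bounds mE1).1 _.
  by apply: N2_cind_le => [||| z /ltW] //; [exact: zak_cmeas zG|rewrite divr_ge0 // ltW].
have n2 : kap2 E2 = 0%E.
  apply: (@null _ (2 * B) B) => //; first by rewrite ltr_pMl // ltr1n.
  apply: le_trans _ (zak_set_bounds mE2).2.
  by apply: N2_cind_ge => [||| z /ltW] //; [exact: zak_cmeas zG|rewrite mulr_ge0 // ltW].
exists (E1 `|` E2); split; first exact: measurableU.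
  exact: etrans (measureU0 mE1 mE2 n2) n1.
move=> z /= /negP; rewrite negb_and -!ltNge => /orP[|]; [left|right] => //.
Qed.

End Zak_bounds.

(** * Winding on a grid *)

Section Winding.
Context {R : realType}.
Implicit Types (z w : R[i]) (t a : R).

Lemma normcM z w : normc (z * w) = normc z * normc w.
Proof. by rewrite !normc_sqrt nsqM sqrtrM ?nsq_ge0. Qed.

Lemma normc_real t : normc t%:C%C = `|t|.
Proof. by rewrite normc_sqrt nsq_real sqrtr_sqr. Qed.

Lemma normc_eq0 z : normc z = 0 -> z = 0.
Proof. by move=> h; apply: nsq_eq0; rewrite -nsqE h expr0n. Qed.

Lemma expi_eq1 t : `|t| < 2 * pi -> expi t = 1 -> t = 0.
Proof.
have pos (s : R) : 0 <= s -> s < 2 * pi -> expi s = 1 -> s = 0.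
  move=> s0 s1 [cs _]; have pi0 := @pi_gt0 R.
  have p2 : 0 < 2 * pi :> R by rewrite mulr_gt0.
  have e : s = 2 * pi * (s / (2 * pi)).
    by rewrite mulrC divfK ?gt_eqF.
  have x01 : 0 <= s / (2 * pi) < 1.
    by apply/andP; split; [rewrite divr_ge0// ltW|rewrite ltr_pdivrMr ?mul1r].
  have := cos_lt1 x01; rewrite -e cs ltxx => /esym/negbFE/eqP h.
  by rewrite e h mulr0.
move=> t2 et; have [t0|t0] := leP 0 t; first by apply: pos => //; rewrite -(ger0_norm t0).
apply/eqP; rewrite -oppr_eq0; apply/eqP; apply: pos; first by rewrite oppr_ge0 ltW.
  by rewrite -(ltr0_norm t0).
by rewrite expiN et /= oppr0.
Qed.

Lemma expi_proportional (r s t u : R) : 0 < r -> 0 < s -> `|t - u| < 2 * pi ->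
  r%:C%C * expi t = s%:C%C * expi u -> t = u.
Proof.
move=> r0 s0 tu h.
have rs : r = s.
  have := congr1 (@normc R) h.
  by rewrite !normcM !normc_expi !mulr1 !normc_real !gtr0_norm.
apply/eqP; rewrite -subr_eq0; apply/eqP; apply: expi_eq1 => //.
have rn : r%:C%C != 0 :> R[i] by rewrite eq_complex /= eqxx andbT gt_eqF.
have e : expi t = expi u by apply: (mulfI rn); rewrite h rs.
by rewrite expiD expiN e mul_conjc nsq_expi.
Qed.

(** The argument of w / z whenever its real part is positive; by construction always below pi / 2 in
    absolute value. *)
Definition step_arg z w : R := atan (complex.Im (w / z) / complex.Re (w / z)).

Lemma step_arg_bound z w : `|step_arg z w| < pi / 2.
Proof. by rewrite ltr_norml atan_gtNpi2 atan_ltpi2. Qed.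

Lemma polar_Re_gt0 w : 0 < complex.Re w ->
  w = (normc w)%:C%C * expi (atan (complex.Im w / complex.Re w)).
Proof.
case: w => x y /= x0.
set t := y / x.
have ct : cos (atan t) = (Num.sqrt (1 + t ^+ 2))^-1 by exact: cos_atan.
have q0 : 0 < Num.sqrt (1 + t ^+ 2) by rewrite sqrtr_gt0 ltr_pwDl// sqr_ge0.
have st : sin (atan t) = t * cos (atan t).
  have e : sin (atan t) / cos (atan t) = t by exact: atanK.
  by rewrite -[LHS](@divfK _ (cos (atan t))) ?e// ct invr_eq0 gt_eqF.
have n : Num.sqrt (x ^+ 2 + y ^+ 2) = x * Num.sqrt (1 + t ^+ 2).
  rewrite -{2}(ger0_norm (ltW x0)) -sqrtr_sqr -sqrtrM ?sqr_ge0//; congr Num.sqrt.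
  by rewrite /t; field; rewrite gt_eqF.
apply: eq_ReIm; rewrite ?ReM ?ImM /= n mul0r ?subr0 ?addr0 ?st ct.
  by field; rewrite gt_eqF.
by rewrite /t; field; rewrite !gt_eqF.
Qed.

(** w / z lies in the open disc of radius 1 around 1, hence in the right half-plane, where
    [step_arg] is an exact argument. *)
Lemma step_argE a z w : a <= normc z -> normc (w - z) < a ->
  exists2 r, 0 < r & w = r%:C%C * expi (step_arg z w) * z.
Proof.
move=> az wz.
have z0 : z != 0.
  by apply: contraTneq wz => z0; rewrite -leNgt (le_trans az)// z0 normc_sqrt nsq0 sqrtr0 normc_ge0.
have nz : 0 < normc z by rewrite lt_neqAle normc_ge0 andbT eq_sym; apply: contraNneq z0 => /normc_eq0 ->.
have re : 0 < complex.Re (w / z).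
  have -> : w / z = 1 + (w - z) / z by field.
  rewrite ReD /=.
  have h : normc ((w - z) / z) < 1.
    have e : normc ((w - z) / z) * normc z = normc (w - z) by rewrite -normcM divfK.
    by rewrite -(ltr_pM2r nz) e mul1r (lt_le_trans wz).
  by have := norm_Re_normc ((w - z) / z); rewrite ler_norml => /andP[]; lra.
have wn : w / z != 0 by apply: contraTneq re => ->; rewrite ltxx.
exists (normc (w / z)).
  by rewrite lt_neqAle normc_ge0 andbT eq_sym; apply: contraNneq wn => /normc_eq0 ->.
by rewrite -polar_Re_gt0// divfK.
Qed.

(* Without a jump the increments of the argument along the columns i = 0 and
   i = K have the same sum, whereas the twist adds 2 pi to the latter. *)
Lemma grid_jump (K L : nat) (a : R) (c : R[i]) (z : nat -> nat -> R[i]) :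
  (2 < L)%N -> 0 < a -> normc c = 1 ->
  (forall i j, a <= normc (z i j)) ->
  (forall i, z i L = z i 0%N) ->
  (forall j, z K j = c * expi (2 * pi * (j%:R / L%:R)) * z 0%N j) ->
  (exists i j, [/\ (i < K)%N, (j <= L)%N & a <= normc (z i.+1 j - z i j)]) \/
  (exists i j, [/\ (i <= K)%N, (j < L)%N & a <= normc (z i j.+1 - z i j)]).
Proof.
move=> L2 a0 c1 az zL zK; apply: contrapT => /not_orP[nH nV].
have pi0 := @pi_gt0 R.
have hH i j : (i < K)%N -> (j <= L)%N -> normc (z i.+1 j - z i j) < a.
  by move=> iK jL; rewrite ltNge; apply/negP => h; apply: nH; exists i, j.
have hV i j : (i <= K)%N -> (j < L)%N -> normc (z i j.+1 - z i j) < a.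
  by move=> iK jL; rewrite ltNge; apply/negP => h; apply: nV; exists i, j.
have zn i j : z i j != 0.
  apply: contraTneq (az i j) => ->.
  by rewrite -ltNge normc_sqrt nsq0 sqrtr0.
pose H i j := step_arg (z i j) (z i.+1 j).
pose V i j := step_arg (z i j) (z i j.+1).
have bH i j : `|H i j| < pi / 2 by exact: step_arg_bound.
have bV i j : `|V i j| < pi / 2 by exact: step_arg_bound.
(* Both ways from corner (i, j) of a cell to the opposite corner give the same value of z. Each sum
   of two arguments is below pi in absolute value, so the two sums differ by less than 2 pi and must
   be equal. *)
have cell i j : (i < K)%N -> (j < L)%N -> H i j + V i.+1 j = V i j + H i j.+1.
  move=> iK jL.
  have [r1 r10 e1] := step_argE (az i j) (hH i j iK (ltnW jL)).
  have [r2 r20 e2] := step_argE (az i.+1 j) (hV i.+1 j iK jL).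
  have [r3 r30 e3] := step_argE (az i j) (hV i j (ltnW iK) jL).
  have [r4 r40 e4] := step_argE (az i j.+1) (hH i j.+1 iK jL).
  apply: (@expi_proportional (r1 * r2) (r3 * r4)); rewrite ?mulr_gt0//.
    have := bH i j; have := bV i.+1 j; have := bV i j; have := bH i j.+1.
    rewrite !ltr_norml => /andP[? ?] /andP[? ?] /andP[? ?] /andP[? ?].
    by apply/andP; split; lra.
  apply: (mulIf (zn i j)); rewrite !expiD !rmorphM /=.
  move: e1 e2 e3 e4; rewrite -/(H i j) -/(V i.+1 j) -/(V i j) -/(H i j.+1).
  move: (H i j) (V i.+1 j) (V i j) (H i j.+1) => h1 v1 v2 h2 e1 e2 e3 e4.
  transitivity (z i.+1 j.+1); first by rewrite e2 e1; ring.
  by rewrite e4 e3; ring.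
pose C i := \sum_(j < L) V i j.
(* The differences of V between neighbouring columns telescope in j and cancel, because the rows 0
   and L of z coincide. *)
have CK i : (i <= K)%N -> C i = C 0%N.
  elim: i => [//|i ih] iK; rewrite -ih; last exact: ltnW.
  apply/eqP; rewrite -subr_eq0 -sumrB; apply/eqP.
  rewrite (eq_bigr (fun j : 'I_L => H i j.+1 - H i j)).
    rewrite -(big_mkord xpredT (fun j => H i j.+1 - H i j)) telescope_sumr// /H.
    by rewrite !zL subrr.
  by move=> j _; have := cell i j iK (ltn_ord j); lra.
have L0 : 0 < L%:R :> R by rewrite ltr0n; lia.
(* Column K is column 0 twisted by e^(2 pi i j / L). The two increments differ by less than pi, and
   2 pi / L <= 2 pi / 3, which excludes an error of 2 pi. *)
have VK j : (j < L)%N -> V K j = V 0%N j + 2 * pi / L%:R.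
  move=> jL.
  have [r1 r10 e1] := step_argE (az K j) (hV K j (leqnn K) jL).
  have [r2 r20 e2] := step_argE (az 0%N j) (hV 0%N j (leq0n K) jL).
  apply: (expi_proportional r10 r20).
    have h3 : 3 <= L%:R :> R by rewrite ler_nat.
    have hL : 2 * pi / L%:R <= 2 * pi / 3 :> R.
      by rewrite ler_pM2l ?mulr_gt0// lef_pV2 ?posrE.
    have hL0 : 0 < 2 * pi / L%:R :> R by rewrite divr_gt0// mulr_gt0.
    have := bV K j; have := bV 0%N j.
    rewrite !ltr_norml => /andP[? ?] /andP[? ?].
    by apply/andP; split; lra.
  have e (q : R) : q * (j.+1%:R / L%:R) = q * (j%:R / L%:R) + q / L%:R.
    by rewrite -natr1; ring.
  apply: (mulIf (zn K j)); rewrite -[LHS]e1 !zK {1}e2 e.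
  by rewrite -/(V 0%N j) (expiD (V 0%N j)) (expiD (2 * pi * (j%:R / L%:R))); ring.
have := CK K (leqnn K); rewrite /C (eq_bigr (fun j : 'I_L => V 0%N j + 2 * pi / L%:R)).
  rewrite big_split sumr_const card_ord => h.
  have p0 : 0 < 2 * pi :> R by rewrite mulr_gt0.
  have : C 0%N + (2 * pi / L%:R) *+ L = C 0%N + 0 by rewrite addr0; exact: h.
  move=> /addrI; rewrite -[LHS]mulr_natr divfK ?gt_eqF// => e.
  by rewrite e ltxx in p0.
by move=> j _; exact: VK.
Qed.

End Winding.

(** * Averaging kernels *)

Section Kernels.
Context {R : realType}.
Implicit Types (P Q : {poly R[i]}) (u : nat -> R[i]) (a b c t : R).

Lemma normc0 : normc 0 = 0 :> R.
Proof. by rewrite normc_sqrt nsq0 sqrtr0. Qed.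

Lemma normc1 : normc 1 = 1 :> R.
Proof. by rewrite normc_sqrt nsq1 sqrtr1. Qed.

Lemma normcX (z : R[i]) n : normc (z ^+ n) = normc z ^+ n.
Proof. by elim: n => [|n ih]; rewrite ?normc1// !exprS normcM ih. Qed.

(* Polynomials act on sequences, 'X being the left shift. *)
Definition act P u (n : nat) : R[i] := \sum_(j < size P) P`_j * u (n + j)%N.

Lemma act_wide P u n N : (size P <= N)%N -> act P u n = \sum_(j < N) P`_j * u (n + j)%N.
Proof.
move=> h; rewrite /act (big_ord_widen N (fun j => P`_j * u (n + j)%N) h) big_mkcond /=.
apply: eq_bigr => j _; case: ltnP => // /(nth_default 0) ->; by rewrite mul0r.
Qed.

Lemma actD P Q u n : act (P + Q) u n = act P u n + act Q u n.
Proof.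
set N := maxn (size P) (size Q).
rewrite !(@act_wide _ _ _ N) ?leq_maxl ?leq_maxr//; last exact: size_polyD.
by rewrite -big_split; apply: eq_bigr => j _; rewrite coefD mulrDl.
Qed.

Lemma actC (c : R[i]) u n : act c%:P u n = c * u n.
Proof.
rewrite (@act_wide _ _ _ 1) ?size_polyC; last by case: (c != 0).
by rewrite big_ord_recl big_ord0 coefC /= addn0 addr0.
Qed.

Lemma actMX P u n : act (P * 'X) u n = act P u n.+1.
Proof.
rewrite (@act_wide _ _ _ (size P).+1).
  rewrite big_ord_recl coefMX /= mul0r add0r; apply: eq_bigr => j _.
  by rewrite coefMX /= addSnnS.
have [->|P0] := eqVneq P 0; first by rewrite mul0r size_poly0.
by rewrite size_mulX.
Qed.

Lemma actCM (c : R[i]) P u n : act (c%:P * P) u n = c * act P u n.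
Proof.
rewrite (@act_wide _ _ _ (size P)); last by rewrite mul_polyC size_scale_leq.
by rewrite mulr_sumr; apply: eq_bigr => j _; rewrite mul_polyC coefZ mulrA.
Qed.

Lemma actM P Q u n : act (P * Q) u n = act P (act Q u) n.
Proof.
elim/poly_ind: P n => [|P c ih] n.
  by rewrite mul0r /act size_poly0 !big_ord0.
by rewrite mulrDl !actD actMX -ih actCM actC -mulrA [in X in X + _](mulrC 'X) mulrA actMX.
Qed.

Lemma actB P Q u n : act (P - Q) u n = act P u n - act Q u n.
Proof. by rewrite actD -mulN1r -[-1]polyCN actCM mulN1r. Qed.

Lemma act1 u n : act 1 u n = u n.
Proof. by rewrite -[1]/(1%:P) actC mul1r. Qed.

(** An upper bound for the operator norm in the supremum norm. It is subadditive and
    submultiplicative, so kernels are estimated by algebra in the polynomial ring. *)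
Definition act_bound P c : Prop := forall u b,
  (forall n, normc (u n) <= b) -> forall n, normc (act P u n) <= c * b.

Lemma act_bound_le P a b : a <= b -> act_bound P a -> act_bound P b.
Proof.
move=> ab h u c hu n; apply: le_trans (h u c hu n) _; apply: ler_wpM2r => //.
exact: le_trans (normc_ge0 _) (hu 0%N).
Qed.

Lemma act_boundD P Q a b : act_bound P a -> act_bound Q b -> act_bound (P + Q) (a + b).
Proof.
move=> hP hQ u c hu n; rewrite actD (le_trans (le_normcD _ _))// mulrDl.
by rewrite lerD ?hP ?hQ.
Qed.

Lemma act_boundM P Q a b : act_bound P a -> act_bound Q b -> act_bound (P * Q) (a * b).
Proof. by move=> hP hQ u c hu n; rewrite actM -mulrA; apply: hP; exact: hQ. Qed.

Lemma act_boundC (c : R[i]) : act_bound c%:P (normc c).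
Proof. by move=> u b hu n; rewrite actC normcM ler_wpM2l ?normc_ge0. Qed.

Lemma act_boundX : act_bound 'X 1.
Proof. by move=> u b hu n; rewrite -(mul1r 'X) actMX act1 mul1r. Qed.

Lemma act_boundN P a : act_bound P a -> act_bound (- P) a.
Proof.
move=> h u b hu n; rewrite -mulN1r -[-1]polyCN actCM mulN1r normcN; exact: h.
Qed.

Lemma act_bound_sum (I : Type) (s : seq I) (F : I -> {poly R[i]}) (c : I -> R) :
  (forall i, act_bound (F i) (c i)) ->
  act_bound (\sum_(i <- s) F i) (\sum_(i <- s) c i).
Proof.
move=> h; elim: s => [|i s ih]; last by rewrite !big_cons; exact: act_boundD.
by rewrite !big_nil => u b hu n; rewrite /act size_poly0 big_ord0 normc0 mul0r.
Qed.

Lemma act_bound1 : act_bound 1 1.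
Proof. by move=> u b hu n; rewrite act1 mul1r. Qed.

Lemma act_boundXn P n : act_bound P 1 -> act_bound (P ^+ n) 1.
Proof.
move=> h; elim: n => [|n ih]; first by rewrite expr0; exact: act_bound1.
by rewrite exprS -[X in act_bound _ X]mul1r; exact: act_boundM.
Qed.

(** A mean of M shifts, twisted so as to reproduce the frequency t: its value is 1 at e^(2 pi i t)
    and has modulus at most 1 on the unit circle. Being a geometric sum, it nearly absorbs one
    twisted shift. *)
Definition avg (M : nat) t : {poly R[i]} :=
  (M%:R^-1)%:C%C%:P * \sum_(j < M) ((expi (- (2 * pi * t)))%:P * 'X) ^+ j.

Variable M : nat.
Hypothesis M0 : (0 < M)%N.

Let MR : M%:R != 0 :> R. Proof. by rewrite pnatr_eq0; lia. Qed.
Let MC : (M%:R : R[i]) * (M%:R^-1)%:C%C = 1.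
Proof.
have -> : (M%:R : R[i]) = (M%:R : R)%:C%C by rewrite rmorph_nat.
by rewrite -rmorphM /= mulfV// rmorph1.
Qed.

Lemma act_bound_twist t : act_bound ((expi (- (2 * pi * t)))%:P * 'X) 1.
Proof.
rewrite -[X in act_bound _ X]mul1r; apply: act_boundM; last exact: act_boundX.
by rewrite -[X in act_bound _ X](normc_expi (- (2 * pi * t))); exact: act_boundC.
Qed.

Lemma act_bound_avg t : act_bound (avg M t) 1.
Proof.
rewrite (_ : 1 = normc (M%:R^-1)%:C%C * \sum_(j < M) 1); last first.
  by rewrite normc_real ger0_norm// sumr_const card_ord mulVf.
apply: act_boundM; first exact: act_boundC.
by apply: act_bound_sum => j; apply: act_boundXn; exact: act_bound_twist.
Qed.

Lemma act_bound_step_avg t :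
  act_bound (('X - 1) * avg M t) (2 / M%:R + normc (expi (2 * pi * t) - 1)).
Proof.
set w := expi (- (2 * pi * t)); set Y : {poly R[i]} := w%:P * 'X.
(* With Y = w X one has X - 1 = (Y - 1) + (1 - w) X; the first part telescopes against the geometric
   sum to (Y^M - 1) / M. *)
have -> : ('X - 1) * avg M t =
    (M%:R^-1)%:C%C%:P * (Y ^+ M + - 1) + (1 - w)%:P * ('X * avg M t).
  rewrite subrX1 /avg -/w -/Y polyCB -[1%:P]/(1 : {poly R[i]}).
  set S := \sum_(j < M) _; rewrite /Y; ring.
apply: act_boundD.
  apply: (@act_bound_le _ (normc (M%:R^-1)%:C%C * (1 + 1))).
    by rewrite normc_real ger0_norm// mulrC.
  apply: act_boundM; first exact: act_boundC.
  apply: act_boundD; last by apply: act_boundN; exact: act_bound1.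
  by apply: act_boundXn; exact: act_bound_twist.
apply: (@act_bound_le _ (normc (1 - w) * (1 * 1))).
  rewrite !mulr1 /w expiN.
  have -> : 1 - conjc (expi (2 * pi * t)) = - conjc (expi (2 * pi * t) - 1).
    by apply: eq_ReIm => /=; ring.
  by rewrite normcN !normc_sqrt nsq_conj.
apply: act_boundM; first exact: act_boundC.
by apply: act_boundM; [exact: act_boundX|exact: act_bound_avg].
Qed.

Lemma horner_avg t s :
  (avg M t).[expi (2 * pi * s)] = (M%:R^-1)%:C%C * \sum_(j < M) (expi (2 * pi * (s - t))) ^+ j.
Proof.
rewrite /avg hornerM hornerC horner_sum; congr (_ * _); apply: eq_bigr => j _.
by rewrite horner_exp hornerM hornerC hornerX -expiD; congr (expi _ ^+ _); ring.
Qed.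

Lemma horner_avg_same t : (avg M t).[expi (2 * pi * t)] = 1.
Proof.
rewrite horner_avg subrr mulr0 expi0 (eq_bigr (fun=> 1)).
  by rewrite sumr_const card_ord mulrC MC.
by move=> j _; rewrite expr1n.
Qed.

Lemma normc_1Bavg_le2 t s : normc (1 - (avg M t).[expi (2 * pi * s)]) <= 2.
Proof.
rewrite (le_trans (le_normcD _ _))// normcN.
rewrite normc1 -[2]/(1 + 1) lerD2l horner_avg normcM normc_real ger0_norm//.
rewrite ler_pdivrMl ?ltr0n// mulr1.
apply: le_trans (normc_sum _ _) _.
rewrite (eq_bigr (fun=> 1)) ?sumr_const ?card_ord// => j _.
by rewrite normcX normc_expi expr1n.
Qed.

Lemma normc_1Bavg_le t s :
  normc (1 - (avg M t).[expi (2 * pi * s)]) <= 2 * pi * M%:R * `|s - t|.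
Proof.
rewrite horner_avg; set w := expi _.
have -> : 1 - (M%:R^-1)%:C%C * \sum_(j < M) w ^+ j =
    (M%:R^-1)%:C%C * \sum_(j < M) (1 - w ^+ j).
  by rewrite sumrB sumr_const card_ord mulrBr [_ * M%:R]mulrC MC.
have nw n : normc (w ^+ n) = 1 by rewrite normcX normc_expi expr1n.
have p0 : 0 <= 2 * pi :> R by rewrite mulr_ge0// pi_ge0.
have h n : normc (1 - w ^+ n) <= n%:R * (2 * pi * `|s - t|).
  elim: n => [|n ih]; first by rewrite expr0 subrr mul0r normc_sqrt nsq0 sqrtr0.
  have -> : 1 - w ^+ n.+1 = (1 - w ^+ n) + w ^+ n * (1 - w) by rewrite exprS; ring.
  rewrite (le_trans (le_normcD _ _))// normcM nw mul1r -natr1 mulrDl mul1r lerD//.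
  by rewrite normcB (le_trans (normc_expi1_le _))// normrM ger0_norm.
rewrite normcM normc_real ger0_norm// ler_pdivrMl ?ltr0n//.
apply: le_trans (normc_sum _ _) _.
apply: (@le_trans _ _ (\sum_(j < M) (M%:R * (2 * pi * `|s - t|)))).
  apply: ler_sum => j _; apply: le_trans (h j) _.
  by apply: ler_wpM2r; [exact: mulr_ge0|rewrite ler_nat ltnW].
by rewrite sumr_const card_ord -mulr_natl; nra.
Qed.

(* 1 - kern M s vanishes at e^(2 pi i t) for t in s, while ('X - 1) * kern M s is
   small when M is large and the elements of s are close to 0. *)
Definition kern (s : seq R) : {poly R[i]} := 1 - \prod_(t <- s) (1 - avg M t).

Lemma horner_1Bkern s w :
  (1 - kern s).[w] = \prod_(t <- s) (1 - (avg M t).[w]).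
Proof.
rewrite /kern opprB addrC subrK horner_prod.
by apply: eq_bigr => t _; rewrite hornerD hornerN hornerC.
Qed.

(** A further node turns [kern s] into avg + kern s - avg kern s, so the bound E becomes 2 E + d;
    starting from 0 this gives 2^n - 1 times d for n nodes. *)
Lemma act_bound_kern (s : seq R) (d : R) :
  (forall t, t \in s -> 2 / M%:R + normc (expi (2 * pi * t) - 1) <= d) ->
  act_bound (('X - 1) * kern s) ((2 ^+ size s - 1) * d).
Proof.
elim: s => [|t s ih] hs.
  rewrite /kern big_nil subrr mulr0 expr0 subrr mul0r => u b hu n.
  by rewrite /act size_poly0 big_ord0 normc0 mul0r.
have -> : ('X - 1) * kern (t :: s) =
    ('X - 1) * avg M t + (('X - 1) * kern s + - (avg M t * (('X - 1) * kern s))).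
  by rewrite /kern big_cons; ring.
rewrite (_ : (2 ^+ size (t :: s) - 1) * d =
    d + ((2 ^+ size s - 1) * d + 1 * ((2 ^+ size s - 1) * d))); last first.
  by rewrite /= exprS; ring.
have hs' : act_bound (('X - 1) * kern s) ((2 ^+ size s - 1) * d).
  by apply: ih => r rs; apply: hs; rewrite inE rs orbT.
apply: act_boundD.
  by apply: act_bound_le (act_bound_step_avg t); apply: hs; rewrite inE eqxx.
apply: act_boundD => //; apply: act_boundN; apply: act_boundM => //.
exact: act_bound_avg.
Qed.

End Kernels.

(** * The grid inequality *)

Section Norm_identities.
Context {R : realType} {l : nat}.
Notation X := (l.-tuple R).
Notation Z := (l.-tuple int).
Notation zv := (@int_tuple R l).
Notation kap := (kap R l).
Notation kap2 := (kap2 R l).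
Notation lam := (lebesgueT R l).
Implicit Types (f g : X -> R[i]).

Lemma N2_kap2_shift2 (F : X * X -> R[i]) (t : X) : cmeas F ->
  (forall x y m, F (x, tadd y (zv m)) = F (x, y)) ->
  N2 kap2 (fun z => F (z.1, tadd z.2 t)) = N2 kap2 F.
Proof.
move=> mF pF.
have ms : cmeas (fun z : X * X => F (z.1, tadd z.2 t)).
  have mh : measurable_fun setT (fun z : X * X => (z.1, tadd z.2 t)).
    apply/measurable_fun_pairP; split => /=; first exact: measurable_fst.
    exact: (measurableT_comp (measurable_tadd t) measurable_snd).
  exact: cmeas_comp mh mF.
have p1 (H : X * X -> R[i]) z : (0 <= (nsq (H z))%:E)%E by rewrite lee_fin nsq_ge0.
rewrite /N2 (ge0_integral_kap2 (measurable_ensq ms))// (ge0_integral_kap2 (measurable_ensq mF))//.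
apply: eq_integral => x _ /=.
apply: (ge0_integral_kap_shift t (F := fun y => (nsq (F (x, y)))%:E)) => //.
  exact: measurable_ensq (cmeas_section1 x mF).
by move=> y m; rewrite pF.
Qed.

Lemma int_kap_fold_shift (F : X -> \bar R) s : measurable_fun setT F -> (forall x, 0 <= F x)%E ->
  ((\int[kap]_x \esum_(m in [set: Z]) F (tsub (tadd x s) (zv m))) = \int[lam]_x F x)%E.
Proof.
move=> mF F0; rewrite -(ge0_integral_lebesgueT_shift s mF F0) unfold_integral//; last first.
  exact: (measurableT_comp mF (measurable_tadd s)).
apply: eq_integral => x _; apply: eq_esum => m _; congr F.
by apply: eq_from_tnth => i; rewrite !tnth_mktuple addrAC.
Qed.

Variables (g : X -> R[i]) (G : X * X -> R[i]).
Hypothesis lg : L2 lam g.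
Hypothesis zG : zak g G.

Lemma zak_periodic2 x y m : G (x, tadd y (zv m)) = G (x, y).
Proof. by case: zG. Qed.

Lemma cmeas_zak_shift s : cmeas (fun z : X * X => G (tadd z.1 s, z.2)).
Proof.
have mh : measurable_fun setT (fun z : X * X => (tadd z.1 s, z.2)).
  apply/measurable_fun_pairP; split => /=; last exact: measurable_snd.
  exact: (measurableT_comp (measurable_tadd s) measurable_fst).
exact: cmeas_comp mh (zak_cmeas zG).
Qed.

Lemma cmeas_zak_shift2 s t : cmeas (fun z : X * X => G (tadd z.1 s, tadd z.2 t)).
Proof. exact: cmeas_comp (measurable_shift2 s t) (zak_cmeas zG). Qed.

(** A combination of translates of G in x is the Zak transform of the same combination of translates
    of g. The value is independent of s and t, so all grid points contribute equally. *)
Lemma zak_N2_shift1 (n : nat) (c : nat -> R[i]) (b : nat -> X) (s t : X) :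
  N2 kap2 (fun z => \sum_(j < n) c j * G (tadd (tadd z.1 s) (b j), tadd z.2 t)) =
  N2 lam (fun x => \sum_(j < n) c j * g (tadd x (b j))).
Proof.
pose F (z : X * X) := \sum_(j < n) c j * G (tadd (tadd z.1 s) (b j), z.2).
have mF : cmeas F.
  apply: cmeas_sum => j; apply: cmeasZ; under eq_fun do rewrite -taddA.
  exact: cmeas_zak_shift.
have mf : cmeas (fun x => \sum_(j < n) c j * g (tadd x (b j))).
  by apply: cmeas_sum => j; apply: cmeasZ; exact: cmeas_comp (measurable_tadd _) lg.1.
rewrite (N2_kap2_shift2 t mF); last first.
  by move=> x y m; apply: eq_bigr => j _; rewrite zak_periodic2.
rewrite (N2_kap2_CR (a := fun x m => \sum_(j < n) c j * g (tadd (tsub (tadd x s) (zv m)) (b j))) mF).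
- rewrite (int_kap_fold_shift (F := fun x => (nsq (\sum_(j < n) c j * g (tadd x (b j))))%:E))//.
  + exact: measurable_ensq.
  + by move=> x; rewrite lee_fin nsq_ge0.
- move=> m; apply: (cmeas_comp (f := fun x => \sum_(j < n) c j * g (tadd x (b j)))) mf.
  exact: (measurableT_comp (measurable_tsub (zv m)) (measurable_tadd s)).
have := ae_foralln (fun j => zak_CR_shift lg zG (tadd s (b j))).
apply: filterS => x hx; apply: CR_sum => j; apply: CR_Z.
have := hx j; rewrite taddA.
rewrite (_ : (fun m => _) = fun m => g (tadd (tsub (tadd x s) (zv m)) (b j)))//.
apply/funext => m; congr g; apply: eq_from_tnth => i.
by rewrite !tnth_mktuple addrAC.
Qed.

(** A shift of y by b multiplies the m-th coefficient by e^(2 pi i m.b). Here s remains, because the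
    multiplier depends on m and not on the point x + s - m. *)
Lemma zak_N2_shift2 (n : nat) (c : nat -> R[i]) (b : nat -> X) (s t : X) :
  N2 kap2 (fun z => \sum_(j < n) c j * G (tadd z.1 s, tadd (tadd z.2 t) (b j))) =
  (\int[kap]_x \esum_(m in [set: Z])
    (nsq (g (tsub (tadd x s) (zv m))) * nsq (\sum_(j < n) c j * ch m (b j)))%:E)%E.
Proof.
pose F (z : X * X) := \sum_(j < n) c j * G (tadd z.1 s, tadd z.2 (b j)).
have mF : cmeas F by apply: cmeas_sum => j; apply: cmeasZ; exact: cmeas_zak_shift2.
rewrite (N2_kap2_shift2 t mF); last first.
  move=> x y m; apply: eq_bigr => j _.
  by rewrite -taddA (taddC (zv m)) taddA zak_periodic2.
rewrite (N2_kap2_CR (a := fun x m => \sum_(j < n) c j * (g (tsub (tadd x s) (zv m)) * ch m (b j))) mF).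
- apply: eq_integral => x _; apply: eq_esum => m _; rewrite -nsqM mulr_sumr.
  by congr (nsq _)%:E; apply: eq_bigr => j _; rewrite mulrCA.
- move=> m; apply: cmeas_sum => j; apply: cmeasZ; apply: cmeasM; last exact: cmeas_cst.
  apply: (cmeas_comp (f := g)) lg.1.
  exact: (measurableT_comp (measurable_tsub (zv m)) (measurable_tadd s)).
have := zak_CR_shift lg zG s.
apply: filterS => x hx; apply: CR_sum => j; apply: CR_Z.
by apply: (CR_shift (b j) hx) => y m; rewrite zak_periodic2.
Qed.

End Norm_identities.

Section Grid_defect.
Context {R : realType}.
Implicit Types (P Q : {poly R[i]}) (a b d : R).

(** The image under P moves by at most a / 2, so the remainder (1 - P) v moves by at least a / 2.
    Its two moduli then sum to at least a / 2, and their squares to at least a^2 / 8. *)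
Lemma act_jump P (v : nat -> R[i]) a b d i : act_bound (('X - 1) * P) d -> 0 <= a ->
  (forall n, normc (v n) <= b) -> d * b <= a / 2 -> a <= normc (v i.+1 - v i) ->
  a ^+ 2 / 8 <= nsq (act (1 - P) v i.+1) + nsq (act (1 - P) v i).
Proof.
move=> hP a0 vb db h.
have e : v i.+1 - v i = act (('X - 1) * P) v i +
    (act (1 - P) v i.+1 + - act (1 - P) v i).
  rewrite actM actB -{1}(mul1r 'X) actMX !act1 !actB !act1; ring.
have h1 : a <= a / 2 + (normc (act (1 - P) v i.+1) + normc (act (1 - P) v i)).
  apply: le_trans h _; rewrite e (le_trans (le_normcD _ _))// lerD//.
    exact: le_trans (hP v b vb i) db.
  by rewrite (le_trans (le_normcD _ _))// normcN.
rewrite -!nsqE; set s := normc _ in h1 *; set t := normc _ in h1 *.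
have := sqr_ge0 (s - t); nra.
Qed.

Lemma grid_defect (K L : nat) P Q (u : nat -> nat -> R[i]) (c : R[i]) a b d :
  (2 < L)%N -> 0 < a -> normc c = 1 ->
  act_bound (('X - 1) * P) d -> act_bound (('X - 1) * Q) d -> d * b <= a / 2 ->
  (forall i j, a <= normc (u i j)) -> (forall i j, normc (u i j) <= b) ->
  (forall i, u i L = u i 0%N) ->
  (forall j, u K j = c * expi (2 * pi * (j%:R / L%:R)) * u 0%N j) ->
  a ^+ 2 / 16 <= \sum_(i < K.+1) \sum_(j < L.+1)
    (nsq (act (1 - P) (u^~ j) i) + nsq (act (1 - Q) (u i) j)).
Proof.
move=> L2 a0 c1 hP hQ db ua ub uL uK.
set S := \sum_(i < _) _.
(* The summands are nonnegative, so each is at most S. A jump involves two grid points, which turns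
   8 into 16. *)
have hS i j : (i <= K)%N -> (j <= L)%N ->
    nsq (act (1 - P) (u^~ j) i) + nsq (act (1 - Q) (u i) j) <= S.
  move=> iK jL; rewrite /S (bigD1 (inord i))//= (bigD1 (inord j))//= !inordK// -addrA lerDl.
  by rewrite addr_ge0// sumr_ge0// => ? _; rewrite ?sumr_ge0// => *; rewrite addr_ge0 ?nsq_ge0.
have [[i [j [iK jL h]]]|[i [j [iK jL h]]]] := grid_jump L2 a0 c1 ua uL uK.
  have := act_jump hP (ltW a0) (fun n => ub n j) db h.
  have := hS i j (ltnW iK) jL; have := hS i.+1 j iK jL.
  have := nsq_ge0 (act (1 - Q) (u i) j); have := nsq_ge0 (act (1 - Q) (u i.+1) j); lra.
have := act_jump hQ (ltW a0) (ub i) db h.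
have := hS i j iK (ltnW jL); have := hS i j.+1 iK jL.
have := nsq_ge0 (act (1 - P) (u^~ j) i); have := nsq_ge0 (act (1 - P) (u^~ j.+1) i); lra.
Qed.

End Grid_defect.

(** * Integration of the grid defect over the two cubes *)

Section Uncertainty.
Context {R : realType} {l : nat}.
Notation X := (l.-tuple R).
Notation Z := (l.-tuple int).
Notation zv := (@int_tuple R l).
Notation kap := (kap R l).
Notation kap2 := (kap2 R l).
Notation lam := (lebesgueT R l).
Variable k : 'I_l.

Definition ek (c : R) : X := [tuple if i == k then c else 0 | i < l].

Lemma tadd_ek c d : tadd (ek c) (ek d) = ek (c + d).
Proof.
by apply: eq_from_tnth => i; rewrite !tnth_mktuple; case: eqP; rewrite ?addr0.
Qed.

Lemma tadd_ek0 x : tadd x (ek 0) = x.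
Proof. by apply: eq_from_tnth => i; rewrite !tnth_mktuple if_same addr0. Qed.

Lemma ek1 : ek 1 = zv (zdelta k).
Proof. by apply: eq_from_tnth => i; rewrite !tnth_mktuple; case: eqP. Qed.

Lemma ch_ek m c : ch m (ek c) = expi (2 * pi * ((tnth m k)%:~R * c)).
Proof.
rewrite /ch /eu /dot (bigD1 k)//= !tnth_mktuple eqxx big1 ?addr0// => i ik.
by rewrite !tnth_mktuple (negbTE ik) mulr0.
Qed.

Variables (f : X -> R[i]) (G : X * X -> R[i]) (A B : R).
Hypothesis lf : L2 lam f.
Hypothesis zG : zak f G.
Hypothesis A0 : 0 < A.
Hypothesis bG : {ae kap2, forall z, A / 2 <= nsq (G z) <= 2 * B}.

Variables (K L : nat).
Hypothesis K0 : (0 < K)%N.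
Hypothesis L_gt2 : (2 < L)%N.

Definition grid (z : X * X) (i j : nat) : R[i] :=
  G (tadd z.1 (ek (i%:R / K%:R)), tadd z.2 (ek (j%:R / L%:R))).

Lemma grid_bounds : {ae kap2, forall z, forall i j, A / 2 <= nsq (grid z i j) <= 2 * B}.
Proof.
apply: ae_foralln => i; apply: ae_foralln => j.
apply: (ae_kap2_shift (P := fun z => A / 2 <= nsq (G z) <= 2 * B)) bG => x y m.
  by case: zG => _ -> _ _; rewrite nsqM nsq_ch mul1r.
by rewrite (zak_periodic2 zG).
Qed.

Lemma grid_top z i : grid z i L = grid z i 0%N.
Proof.
have L0 : L%:R != 0 :> R by rewrite pnatr_eq0; lia.
by rewrite /grid divff// mul0r tadd_ek0 ek1 (zak_periodic2 zG).
Qed.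

Lemma grid_right z j : grid z K j =
  expi (2 * pi * tnth z.2 k) * expi (2 * pi * (j%:R / L%:R)) * grid z 0%N j.
Proof.
have KN0 : K%:R != 0 :> R by rewrite pnatr_eq0; lia.
rewrite /grid divff// mul0r tadd_ek0 ek1; case: zG => _ -> _ _.
rewrite ch_zdelta -expiD !tnth_mktuple eqxx; congr (expi _ * _); ring.
Qed.

Variables (P Q : {poly R[i]}) (d : R).
Hypothesis hP : act_bound (('X - 1) * P) d.
Hypothesis hQ : act_bound (('X - 1) * Q) d.
Hypothesis hd : d * Num.sqrt (2 * B) <= Num.sqrt (A / 2) / 2.

Let D1 z i j := act (1 - P) (grid z ^~ j) i.
Let D2 z i j := act (1 - Q) (grid z i) j.

Lemma cmeas_grid i j : cmeas (fun z => grid z i j).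
Proof. exact: (cmeas_zak_shift2 zG). Qed.

(* A / 32 is a^2 / 16 for the lower bound a = sqrt (A / 2) of |G|. *)
Lemma defect_ae : {ae kap2, forall z, A / 32 <=
  \sum_(i < K.+1) \sum_(j < L.+1) (nsq (D1 z i j) + nsq (D2 z i j))}.
Proof.
apply: filterS grid_bounds => z hz.
have sA : 0 < Num.sqrt (A / 2) by rewrite sqrtr_gt0 divr_gt0.
have -> : A / 32 = Num.sqrt (A / 2) ^+ 2 / 16.
  by rewrite sqr_sqrtr ?divr_ge0 ?ltW//; field.
apply: (grid_defect L_gt2 sA (normc_expi _) hP hQ hd _ _ (grid_top z) (grid_right z)) => i j;
  by rewrite normc_sqrt; have /andP[h1 h2] := hz i j; rewrite ler_wsqrtr.
Qed.

Lemma N2_D1 i j : N2 kap2 (fun z => D1 z i j) =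
  N2 lam (fun x => \sum_(n < size (1 - P)) (1 - P)`_n * f (tadd x (ek (n%:R / K%:R)))).
Proof.
rewrite -(zak_N2_shift1 lf zG _ (fun n => (1 - P)`_n) (fun n => ek (n%:R / K%:R))
  (ek (i%:R / K%:R)) (ek (j%:R / L%:R))).
apply: eq_N2 => z; apply: eq_bigr => n _.
by rewrite /grid -taddA tadd_ek -mulrDl natrD.
Qed.

Variable W : R -> R.
Hypothesis W0 : forall x, 0 <= W x.
Hypothesis mW : measurable_fun setT W.
Hypothesis homoW : forall x y, 0 <= x -> x <= y -> W x <= W y.
Hypothesis hW : forall m : int,
  nsq ((1 - Q).[expi (2 * pi * (m%:~R / L%:R))]) <= W `|m%:~R|.

Let V t := nsq (f t) * W (`|tnth t k| + 2).

Lemma measurable_V : measurable_fun setT V.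
Proof.
apply: measurable_funM; first exact: measurable_nsq lf.1.
apply: (measurableT_comp mW); apply: measurable_funD => //.
by apply: (measurableT_comp (@normr_measurable R setT)); exact: measurable_tnth.
Qed.

(* If x is in the unit cube and t = x + s - m with 0 <= s_k <= 1, then
   |m_k| <= |t_k| + 2. *)
Lemma N2_D2 i j : (i <= K)%N ->
  (N2 kap2 (fun z => D2 z i j) <= \int[lam]_x (V x)%:E)%E.
Proof.
move=> iK.
have V0 x : (0 <= (V x)%:E)%E by rewrite lee_fin mulr_ge0 ?nsq_ge0.
have mV : measurable_fun setT (fun x => (V x)%:E) by apply/measurable_EFinP; exact: measurable_V.
have s01 : 0 <= (i%:R / K%:R : R) <= 1.
  by rewrite divr_ge0//= ler_pdivrMr ?ltr0n// mul1r ler_nat.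
have -> : N2 kap2 (fun z => D2 z i j) = N2 kap2 (fun z => \sum_(n < size (1 - Q)) (1 - Q)`_n *
    G (tadd z.1 (ek (i%:R / K%:R)), tadd (tadd z.2 (ek (j%:R / L%:R))) (ek (n%:R / L%:R)))).
  apply: eq_N2 => z; apply: eq_bigr => n _.
  by rewrite /grid -taddA tadd_ek -mulrDl natrD.
rewrite (zak_N2_shift2 lf zG _ (fun n => (1 - Q)`_n) (fun n => ek (n%:R / L%:R))).
rewrite -(int_kap_fold_shift (ek (i%:R / K%:R)) mV V0).
have mt m : measurable_fun setT (fun x => tsub (tadd x (ek (i%:R / K%:R))) (zv m)).
  exact: (measurableT_comp (measurable_tsub (zv m)) (measurable_tadd _)).
apply: ae_ge0_le_integral => //.
- by move=> x _; apply: esum_ge0 => m _; rewrite lee_fin mulr_ge0 ?nsq_ge0.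
- apply: measurable_esum => [m x|m]; first by rewrite lee_fin mulr_ge0 ?nsq_ge0.
  apply/measurable_EFinP; apply: measurable_funM => //.
  exact: measurable_nsq (cmeas_comp (mt m) lf.1).
- by move=> x _; apply: esum_ge0.
- apply: measurable_esum => [m x|m]; first exact: V0.
  exact: (measurableT_comp mV (mt m)).
apply: filterS (@kap_ae R l) => x xc _; apply: le_esum => m _.
rewrite lee_fin ler_wpM2l ?nsq_ge0//.
(* A shift by n / L acts on the m-th coefficient as the n-th power of e^(2 pi i m_k / L), so the
   combination evaluates 1 - Q there. *)
have -> : \sum_(n < size (1 - Q)) (1 - Q)`_n * ch m (ek (n%:R / L%:R)) =
    (1 - Q).[expi (2 * pi * ((tnth m k)%:~R / L%:R))].
  rewrite horner_coef; apply: eq_bigr => n _; congr (_ * _); rewrite ch_ek.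
  elim: (n : nat) => [|p ih]; first by rewrite mul0r !mulr0 expi0 expr0.
  by rewrite exprS -ih -expiD -natr1; congr expi; ring.
apply: le_trans (hW _) _; apply: homoW => //.
have := xc k; rewrite !tnth_mktuple eqxx; move: s01.
set s := _ / _; set n := (tnth m k)%:~R => /andP[s0 s1] /andP[x0 x1].
by rewrite ler_norml; have := ler_norm (tnth x k + s - n); have := ler_norm (- (tnth x k + s - n));
  rewrite normrN; lra.
Qed.

Lemma defect_inequality : ((A / 32)%:E <= ((K.+1 * L.+1)%:R)%:E *
  (N2 lam (fun x => \sum_(n < size (1 - P)) (1 - P)`_n * f (tadd x (ek (n%:R / K%:R))))%R +
   \int[lam]_x (nsq (f x) * W (`|tnth x k| + 2))%:E))%E.
Proof.
set I1 := N2 lam _; set I2 := integral _ _ _.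
have m1 i j : cmeas (fun z => D1 z i j).
  by apply: cmeas_sum => n; apply: cmeasZ; exact: cmeas_grid.
have m2 i j : cmeas (fun z => D2 z i j).
  by apply: cmeas_sum => n; apply: cmeasZ; exact: cmeas_grid.
have p12 z i j : (0 <= (nsq (D1 z i j))%:E + (nsq (D2 z i j))%:E)%E.
  by rewrite adde_ge0// lee_fin nsq_ge0.
have m12 i j : measurable_fun setT (fun z => (nsq (D1 z i j))%:E + (nsq (D2 z i j))%:E)%E.
  by apply: emeasurable_funD; exact: measurable_ensq.
pose S z := (\sum_(i < K.+1) \sum_(j < L.+1) ((nsq (D1 z i j))%:E + (nsq (D2 z i j))%:E))%E.
have h1 : ((A / 32)%:E <= \int[kap2]_z S z)%E.
  have -> : ((A / 32)%:E = \int[kap2]_z (A / 32)%:E)%E.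
    by rewrite integral_cst// [X in (_ * X)%E](@kap2_setT R l) mule1.
  apply: ae_ge0_le_integral => //.
  - by move=> z _; rewrite lee_fin divr_ge0// ltW.
  - by move=> z _; apply: sume_ge0 => i _; apply: sume_ge0.
  - by apply: emeasurable_sum => i; apply: emeasurable_sum => j; exact: m12.
  apply: filterS defect_ae => z hz _.
  suff -> : S z = (\sum_(i < K.+1) \sum_(j < L.+1) (nsq (D1 z i j) + nsq (D2 z i j)))%:E.
    by rewrite lee_fin.
  by rewrite -sumEFin; apply: eq_bigr => i _; rewrite -sumEFin; exact: eq_bigr.
apply: le_trans h1 _.
rewrite ge0_integral_sum//; last 2 first.
- by move=> i; apply: emeasurable_sum => j; exact: m12.
- by move=> i z _; apply: sume_ge0.
apply: (@le_trans _ _ (\sum_(i < K.+1) \sum_(j < L.+1) (I1 + I2))%E).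
  apply: lee_sum => i _; rewrite ge0_integral_sum//.
  apply: lee_sum => j _; rewrite ge0_integralD//; last 4 first.
  - by move=> z _; rewrite lee_fin nsq_ge0.
  - exact: measurable_ensq.
  - by move=> z _; rewrite lee_fin nsq_ge0.
  - exact: measurable_ensq.
  apply: leeD; first by rewrite /I1 -(N2_D1 i j).
  by apply: N2_D2; rewrite -ltnS.
have e n (x : \bar R) : (x *+ n)%R = (n%:R%:E * x)%E.
  by rewrite mule_natl; elim: n => [|[|n] ih] //; rewrite mulrS ih.
by rewrite !sumr_const !card_ord !e natrM EFinM muleA.
Qed.

End Uncertainty.

(** * Asymptotics *)

Section Cutoff.
Context {R : realType}.
Implicit Types (c n x y u s q : R) (N : nat).

(** Majorant of |1 - kern|^2 at the frequency x / n, for the node 0 taken N times: each factor has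
    modulus at most min (2, 2 c x / n) with c = pi M. It is monotone in x, so it can also serve as
    the weight W. *)
Definition cutoff N c n x : R := 4 ^+ N * Num.min 1 (c * x / n) ^+ N.*2.

Lemma cutoff_ge0 N c n x : 0 <= cutoff N c n x.
Proof.
apply: mulr_ge0; first exact: exprn_ge0.
by rewrite -mul2n exprM exprn_ge0// sqr_ge0.
Qed.

Lemma cutoff_homo N c n x y : 0 <= c -> 0 < n -> 0 <= x -> x <= y ->
  cutoff N c n x <= cutoff N c n y.
Proof.
move=> c0 n0 x0 xy; rewrite /cutoff ler_wpM2l ?exprn_ge0//.
have h0 : 0 <= c * x / n by rewrite divr_ge0 ?mulr_ge0// ltW.
have h1 : c * x / n <= c * y / n by apply: ler_wpM2r; [rewrite invr_ge0 ltW|exact: ler_wpM2l].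
apply: lerXn2r; rewrite ?nnegrE ?le_min ?ler01 ?h0 ?(le_trans h0 h1)//.
by rewrite ge_min lexx/= ge_min h1 orbT.
Qed.

Lemma measurable_cutoff N c n : measurable_fun [set: R] (cutoff N c n).
Proof.
apply: measurable_funM => //; apply: measurable_funX.
by apply: measurable_minr => //; apply: measurable_funM => //; exact: measurable_funM.
Qed.

Lemma minr1_powR_le N u s : 0 <= u -> 0 < s <= N.*2%:R -> Num.min 1 u ^+ N.*2 <= u `^ s.
Proof.
move=> u0 /andP[s0 sN].
have [->|un0] := eqVneq u 0.
  rewrite minEle ler10 expr0n; case: N sN => [|N] sN; last by rewrite powR_ge0.
  by rewrite leNgt s0 in sN.
have {u0 un0}u0 : 0 < u by rewrite lt_neqAle eq_sym un0.
have [u1|u1] := leP 1 u.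
  by rewrite expr1n -(powRr0 u) ler_powR// ltW.
rewrite -powR_mulrn; last exact: ltW.
by apply: ger_powR => //; rewrite u0 ltW.
Qed.

Lemma cutoff_le N c n x q : 0 <= c -> 0 < n -> 0 <= x -> 0 < q <= N.*2%:R ->
  n `^ q * cutoff N c n x <= 4 ^+ N * (c * x) `^ q.
Proof.
move=> c0 n0 x0 qN; rewrite /cutoff mulrCA ler_wpM2l ?exprn_ge0//.
have cx0 : 0 <= c * x by exact: mulr_ge0.
apply: (@le_trans _ _ (n `^ q * (c * x / n) `^ q)).
  by rewrite ler_wpM2l ?powR_ge0// minr1_powR_le// divr_ge0// ltW.
rewrite -powRM; [|exact: ltW|by rewrite divr_ge0// ltW].
by rewrite [n * _]mulrC divfK ?gt_eqF.
Qed.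

Lemma cutoff_vanish N c n x q : 0 <= c -> 0 < n -> 0 <= x -> 0 < q -> q + 1 <= N.*2%:R ->
  n `^ q * cutoff N c n x <= 4 ^+ N * (c * x) `^ (q + 1) / n.
Proof.
move=> c0 n0 x0 q0 qN.
have e : n `^ q * n = n `^ (q + 1).
  by rewrite powRD ?(gt_eqF n0) ?implybT// powRr1// ltW.
rewrite ler_pdivlMr// mulrAC e.
by apply: cutoff_le => //; rewrite addr_gt0.
Qed.

Lemma kern_cutoff (M N : nat) n x : (0 < M)%N -> 0 < n ->
  nsq ((1 - kern M (nseq N 0)).[expi (2 * pi * (x / n))]) <= cutoff N (pi * M%:R) n `|x|.
Proof.
move=> M0 n0; rewrite horner_1Bkern.
have h : nsq (1 - (avg M 0).[expi (2 * pi * (x / n))]) <=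
    4 * Num.min 1 (pi * M%:R * `|x| / n) ^+ 2.
  rewrite -nsqE (_ : 4 * _ = (2 * Num.min 1 (pi * M%:R * `|x| / n)) ^+ 2); last first.
    by rewrite exprMn; congr (_ * _); rewrite expr2 -natrM.
  have p0 : 0 <= pi * M%:R * `|x| / n by rewrite !mulr_ge0 ?pi_ge0// invr_ge0 ltW.
  apply: lerXn2r; rewrite ?nnegrE ?normc_ge0//.
    by rewrite mulr_ge0// le_min ler01 p0.
  have [_|_] := leP 1 (pi * M%:R * `|x| / n); first by rewrite mulr1; exact: normc_1Bavg_le2.
  have e : 2 * pi * M%:R * `|x / n - 0| = 2 * (pi * M%:R * `|x| / n) :> R.
    by rewrite subr0 normrM [`|n^-1|]ger0_norm ?invr_ge0 1?ltW// !mulrA.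
  by rewrite -e; exact: normc_1Bavg_le.
rewrite /cutoff -mul2n exprM -exprMn.
elim: N => [|N ih]; first by rewrite big_nil nsq1 expr0.
by rewrite /= big_cons nsqM exprS; apply: ler_pM; rewrite ?nsq_ge0.
Qed.

End Cutoff.

(** After multiplication by n^q the integrand is dominated by a multiple of w^q |h|^2, integrable by
    assumption, and tends to 0 pointwise since the order 2 N of vanishing is at least q + 1.
    Dominated convergence gives o(n^-q). *)
Lemma cutoff_decay {R : realType} d (T : measurableType d) (mu : {measure set T -> \bar R})
    (h : T -> R[i]) (w : T -> R) (c q : R) (N : nat) :
  cmeas h -> measurable_fun setT w -> (forall x, 0 <= w x) -> 0 <= c ->
  0 < q -> q + 1 <= N.*2%:R ->
  (\int[mu]_x (w x `^ q * nsq (h x))%:E < +oo)%E ->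
  forall e, 0 < e -> exists n0 : nat, forall n : nat, (n0 < n)%N ->
    (\int[mu]_x (nsq (h x) * cutoff N c n%:R (w x))%:E <= (e / n%:R `^ q)%:E)%E.
Proof.
move=> mh mw w0 c0 q0 qN fin e e0.
have mn := measurable_nsq mh.
have mwq : measurable_fun setT (fun x => w x `^ q).
  exact: (measurableT_comp (@measurable_powR R q) mw).
have mc n : measurable_fun setT (fun x => nsq (h x) * cutoff N c n (w x)).
  by apply: measurable_funM => //; exact: (measurableT_comp (measurable_cutoff N c n) mw).
pose u (n : nat) x := n.+1%:R `^ q * (nsq (h x) * cutoff N c n.+1%:R (w x)).
pose H x := (4 ^+ N * c `^ q) * (w x `^ q * nsq (h x)).
have qN' : 0 < q <= N.*2%:R by rewrite q0 (le_trans _ qN)// lerDl.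
have iH : mu.-integrable setT (fun x => (H x)%:E).
  under eq_fun do rewrite EFinM; apply: integrableZl => //; apply/integrableP; split.
    by apply/measurable_EFinP; exact: measurable_funM.
  under eq_integral do rewrite gee0_abs ?lee_fin ?mulr_ge0 ?powR_ge0 ?nsq_ge0//.
  exact: fin.
have uH n x : 0 <= u n x <= H x.
  rewrite /u /H; apply/andP; split.
    apply: mulr_ge0; first exact: powR_ge0.
    by apply: mulr_ge0; [exact: nsq_ge0|exact: cutoff_ge0].
  rewrite mulrCA [leRHS](_ : _ = nsq (h x) * (4 ^+ N * (c * w x) `^ q)); last first.
    by rewrite powRM//; ring.
  by rewrite ler_wpM2l ?nsq_ge0// cutoff_le.
have mu_ n : measurable_fun setT (u n) by exact: measurable_funM.
have u0 : {ae mu, forall x, u n x @[n --> \oo] --> (0 : R)}.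
  apply: aeW => x.
  apply: (@squeeze_cvgr _ _ _ _ (cst 0)
    (fun n => nsq (h x) * (4 ^+ N * (c * w x) `^ (q + 1)) * n.+1%:R^-1)).
  - apply: nearW => n; have /andP[-> _] := uH n x.
    by rewrite /= /u mulrCA -mulrA ler_wpM2l ?nsq_ge0// cutoff_vanish.
  - exact: cvg_cst.
  - rewrite -[X in _ --> X](mulr0 (nsq (h x) * (4 ^+ N * (c * w x) `^ (q + 1)))).
    by apply: cvgM; [exact: cvg_cst|exact: cvg_harmonic].
have := ge0_dominated_cvg0 mu_ iH uH u0.
move=> /fine_cvgP[fin_ cv].
have [n0 _ hn0] : \forall n \near \oo, (\int[mu]_x (u n x)%:E <= e%:E)%E.
  near=> n.
  rewrite -(fineK (_ : \int[mu]_x (u n x)%:E \is a fin_num)%E); last by near: n.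
  rewrite lee_fin; apply: ltW.
  have : `|0 - fine (\int[mu]_x (u n x)%:E)%E| < e.
    by near: n; move/cvgrPdist_lt : cv; exact.
  by rewrite sub0r normrN; apply: le_lt_trans; exact: ler_norm.
exists n0 => -[//|n] nn0.
have := hn0 n nn0; rewrite /= /u.
under eq_integral do rewrite EFinM.
rewrite ge0_integralZl//; last 2 first.
- by apply/measurable_EFinP; exact: mc.
- by move=> x _; rewrite lee_fin; apply: mulr_ge0; [exact: nsq_ge0|exact: cutoff_ge0].
by move=> le; rewrite EFinM lee_pdivlMr// muleC.
Unshelve. all: by end_near.
Qed.

Section Pairs.
Context {R : realType} {l : nat}.
Notation X := (l.-tuple R).
Notation Z := (l.-tuple int).
Notation zv := (@int_tuple R l).
Notation kap2 := (kap2 R l).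
Notation lam := (lebesgueT R l).
Variable k : 'I_l.

(* Both orderings of a Fourier pair satisfy this, with opposite signs [sg]. *)
Definition freq_mult (f h : X -> R[i]) (sg : R) : Prop :=
  forall (n : nat) (c : nat -> R[i]) (K : R),
  N2 lam (fun x => \sum_(j < n) c j * f (tadd x (ek k (j%:R / K)))) =
  N2 lam (fun xi => (\sum_(j < n) c j * expi (2 * pi * (sg * tnth xi k / K)) ^+ j) * h xi).

Lemma eu_ek a (x : X) : eu (ek k a) x = expi (2 * pi * (a * tnth x k)).
Proof.
rewrite /eu /dot (bigD1 k)//= !tnth_mktuple eqxx big1 ?addr0// => i ik.
by rewrite !tnth_mktuple (negbTE ik) mul0r.
Qed.

Lemma expi_natM (n : nat) (t : R) : expi (n%:R * t) = expi t ^+ n.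
Proof.
elim: n => [|n ih]; first by rewrite mul0r expi0 expr0.
by rewrite exprS -ih -expiD -natr1; congr expi; ring.
Qed.

Lemma eu0l (x : X) : eu (ek k 0) x = 1.
Proof. by rewrite eu_ek mul0r mulr0 expi0. Qed.

Lemma topp_ek (a : R) : topp (ek k a) = ek k (- a).
Proof.
by apply: eq_from_tnth => i; rewrite !tnth_mktuple; case: eqP => _; rewrite ?oppr0.
Qed.

Lemma tsub_ek (x : X) a : tsub x (ek k a) = tadd x (ek k (- a)).
Proof. by rewrite -topp_ek; apply: eq_from_tnth => i; rewrite !tnth_mktuple. Qed.

Let shifts n (c : nat -> R[i]) (K : R) : seq (R[i] * (X * X)) :=
  [seq (c j, (ek k 0, ek k (- (j%:R / K)))) | j <- index_iota 0 n].

Let combo_shifts n c K f x :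
  combo (shifts n c K) f x = \sum_(j < n) c j * f (tadd x (ek k (j%:R / K))).
Proof.
rewrite /combo big_map big_mkord.
by apply: eq_bigr => j _; rewrite /= eu0l mul1r tsub_ek opprK.
Qed.

Lemma dual_freq_mult f h : dual f h -> freq_mult f h 1.
Proof.
move=> fh n c K; have := fh (shifts n c K).
rewrite (eq_N2 lam (combo_shifts n c K f)) => ->; apply: eq_N2 => x.
rewrite /combo -map_comp big_map big_mkord mulr_suml.
apply: eq_bigr => j _ /=.
rewrite euC eu0l mulr1 topp_ek opprK eu_ek tsub_ek oppr0 tadd_ek0 -expi_natM mulrA.
by congr (_ * expi _ * _); ring.
Qed.

(** Translates of h are images of modulations of f, so the list of shifts is pulled back by
    [unhatq]; the modulations carry the opposite sign. *)
Lemma dual_freq_multV f h : dual f h -> freq_mult h f (-1).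
Proof.
move=> fh n c K; have := fh (map unhatq (shifts n c K)).
rewrite (mapK unhatqK).
rewrite (eq_N2 lam (combo_shifts n c K h)) => <-; apply: eq_N2 => x.
rewrite /combo -map_comp big_map big_mkord mulr_suml.
apply: eq_bigr => j _ /=.
rewrite eu0l mulr1 topp_ek eu_ek tsub_ek !oppr0 tadd_ek0 -expi_natM mulrA.
by congr (_ * expi _ * _); ring.
Qed.

Variables (f h : X -> R[i]) (A B sg : R).
Hypothesis lf : L2 lam f.
Hypothesis A0 : 0 < A.
Hypothesis B0 : 0 < B.
Hypothesis rf : riesz_bounds f A B.
Hypothesis fm : freq_mult f h sg.

Lemma pair_inequality (K L : nat) (P Q : {poly R[i]}) (d : R) (W : R -> R) :
  (0 < K)%N -> (2 < L)%N ->
  act_bound (('X - 1) * P) d -> act_bound (('X - 1) * Q) d ->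
  d * Num.sqrt (2 * B) <= Num.sqrt (A / 2) / 2 ->
  (forall x, 0 <= W x) -> measurable_fun setT W ->
  (forall x y, 0 <= x -> x <= y -> W x <= W y) ->
  (forall m : int, nsq ((1 - Q).[expi (2 * pi * (m%:~R / L%:R))]) <= W `|m%:~R|) ->
  ((A / 32)%:E <= ((K.+1 * L.+1)%:R)%:E *
  ((\int[lam]_x (nsq (h x) * nsq ((1 - P).[expi (2 * pi * (sg * tnth x k / K%:R))]))%:E) +
   \int[lam]_x (nsq (f x) * W (`|tnth x k| + 2))%:E))%E.
Proof.
move=> K0 L3 hP hQ hd W0 mW homoW hW.
have [G zG] := zak_exists lf.
have bG := zak_bounded lf zG A0 B0 rf.
have := defect_inequality k lf zG A0 bG K0 L3 hP hQ hd W0 mW homoW hW.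
rewrite (fm (size (1 - P)) (fun n => (1 - P)`_n)).
rewrite [X in (_ <= _ * (X + _))%E -> _](_ : _ = \int[lam]_x
  (nsq (h x) * nsq ((1 - P).[expi (2 * pi * (sg * tnth x k / K%:R))]))%:E)%E//.
by apply: eq_integral => x _; rewrite nsqM mulrC horner_coef.
Qed.


End Pairs.

Section Exponents.
Context {R : realType}.
Implicit Types (x p q : R).

Lemma powR_addr2_le x p : 0 <= x -> 0 < p -> (x + 2) `^ p <= 2 `^ p * x `^ p + 4 `^ p.
Proof.
move=> x0 p0; have le y z : 0 <= y -> y <= z -> y `^ p <= z `^ p.
  by move=> y0 yz; apply: ge0_ler_powR; rewrite ?nnegrE ?(le_trans y0 yz)// ltW.
have h1 := @powR_ge0 R 2 p; have h2 := powR_ge0 x p; have h3 := @powR_ge0 R 4 p.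
have [x2|/ltW x2] := leP x 2.
  by apply: le_trans (le _ 4 _ _) _; [lra|lra|rewrite lerDr mulr_ge0].
apply: le_trans (le _ (2 * x) _ _) _; [lra|lra|].
by rewrite powRM// lerDl.
Qed.

(* Since (q - 1) (p - 1) = 1, the choice L ~ K^(q-1) makes K L comparable both to
   K^q and to L^p. *)
Lemma mesh_rate p q (K : nat) : 0 < p - 1 -> 0 < q - 1 -> (q - 1) * (p - 1) = 1 ->
  (0 < K)%N -> let L := (Num.truncn (K%:R `^ (q - 1))).+3 in
  [/\ K%:R `^ (q - 1) <= L%:R :> R, (K.+1 * L.+1)%:R <= 10 * K%:R `^ q &
      (K.+1 * L.+1)%:R <= 4 * L%:R `^ p].
Proof.
move=> p1 q1 pq K0; set x : R := K%:R `^ (q - 1) => L.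
have K1 : 1 <= K%:R :> R by rewrite ler1n.
have Kr : 0 < K%:R :> R by rewrite ltr0n.
have x1 : 1 <= x by rewrite -(powRr0 (K%:R : R)) ler_powR// ltW.
have x0 : 0 <= x by exact: powR_ge0.
have /andP[t1 t2] := truncn_itv x0.
have eL : L%:R = (Num.truncn x)%:R + 3 :> R by rewrite -natrD addn3.
have eL1 : (Num.truncn x).+1%:R = (Num.truncn x)%:R + 1 :> R by rewrite natr1.
have xL : x <= L%:R by move: t2; rewrite eL eL1; lra.
have Ln : L%:R != 0 :> R by rewrite gt_eqF// (lt_le_trans ltr01).
have e : (K.+1 * L.+1)%:R = (K%:R + 1) * (L%:R + 1) :> R by rewrite natrM !natr1.
have Kq : K%:R `^ q = K%:R * x :> R.
  rewrite -{2}(powRr1 (ltW Kr)) -powRD; first by congr (_ `^ _); ring.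
  by rewrite (gt_eqF Kr) implybT.
have KL : K%:R <= L%:R `^ (p - 1) :> R.
  have -> : K%:R = x `^ (p - 1) by rewrite -powRrM pq powRr1// ltW.
  by apply: ge0_ler_powR; rewrite ?nnegrE// ltW.
have Lp : L%:R `^ p = L%:R * L%:R `^ (p - 1) :> R.
  rewrite -{2}(powRr1 (ler0n R L)) -powRD; first by congr (_ `^ _); ring.
  by rewrite Ln implybT.
(* K + 1 <= 2 K and L + 1 <= x + 4 <= 5 x give the constant 10; L + 1 <= 2 L and K <= L^(p-1) give
   4. *)
split=> //; rewrite e.
  by rewrite Kq eL; move: t1; nra.
by rewrite Lp; nra.
Qed.

Definition nodes (D : nat) (L : R) : seq R :=
  [seq (i%:R - D%:R) / L | i <- iota 0 D.*2.+1].

Lemma mem_nodes (D : nat) (L : R) (z : int) :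
  `|z%:~R| <= D%:R :> R -> z%:~R / L \in nodes D L.
Proof.
rewrite -intr_norm -[D%:R]/((D : int)%:~R) ler_int => zD.
have zE : z = (absz (z + D%:Z))%:Z - D%:Z by lia.
apply/mapP; exists (absz (z + D%:Z)); first by rewrite mem_iota; lia.
by rewrite {1}zE intrD intrN.
Qed.

Lemma nodes_le (D : nat) (L t : R) : t \in nodes D L -> 0 < L -> `|t| <= D%:R / L.
Proof.
move=> /mapP [i iD ->] L0; rewrite mem_iota in iD.
have {}iD : (i <= 2 * D)%N by lia.
rewrite normrM [`|L^-1|]gtr0_norm ?invr_gt0//; apply: ler_wpM2r; first by rewrite invr_ge0 ltW.
have : i%:R <= 2 * D%:R :> R by rewrite -natrM ler_nat.
by rewrite ler_norml; have := ler0n R i; lra.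
Qed.

End Exponents.

(** * Contradiction from finite moments *)

Section Balian_Low.
Context {R : realType} {l : nat}.
Notation X := (l.-tuple R).
Notation lam := (lebesgueT R l).
Variables (k : 'I_l) (f h : X -> R[i]) (A B sg : R).
Hypothesis lf : L2 lam f.
Hypothesis lh : L2 lam h.
Hypothesis A0 : 0 < A.
Hypothesis B0 : 0 < B.
Hypothesis rf : riesz_bounds f A B.
Hypothesis fm : freq_mult k f h sg.
Hypothesis sg1 : `|sg| = 1.

(** The almost everywhere bounds of |G| from [zak_bounded]: a is the size of the forced jump, b the
    bound fed to the averages. *)
Let a := Num.sqrt (A / 2).
Let b := Num.sqrt (2 * B).

Let a0 : 0 < a. Proof. by rewrite sqrtr_gt0 divr_gt0. Qed.
Let b0 : 0 <= b. Proof. exact: sqrtr_ge0. Qed.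

(** The value a / 4 is half of what the condition on d b allows: in [no_first_moment] d has two
    parts, made small through M and through L. *)
Lemma exists_small_mesh (C : R) : 0 <= C -> exists M : nat,
  forall n : nat, (M <= n)%N -> (0 < n)%N -> C / n%:R <= a / 4.
Proof.
move=> C0; exists (Num.truncn (4 * C / a)).+1 => n Mn n0.
have nr : 0 < n%:R :> R by rewrite ltr0n.
have h1 : 4 * C / a <= n%:R.
  by apply: le_trans (ltW (truncnS_gt _)) _; rewrite ler_nat.
by rewrite ler_pdivrMr//; move: h1; rewrite ler_pdivrMr//; lra.
Qed.

Lemma measurable_abs_coord : measurable_fun setT (fun x : X => `|tnth x k|).
Proof. by apply: (measurableT_comp (@normr_measurable R setT)); exact: measurable_tnth. Qed.

Lemma le_cutoff_term (N M K : nat) : (0 < M)%N -> (0 < K)%N ->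
  (\int[lam]_x (nsq (h x) * nsq ((1 - kern M (nseq N 0)).[expi (2 * pi * (sg * tnth x k / K%:R))]))%:E
   <= \int[lam]_x (nsq (h x) * cutoff N (pi * M%:R) K%:R `|tnth x k|)%:E)%E.
Proof.
move=> M0 K0; have Kr : 0 < K%:R :> R by rewrite ltr0n.
apply: ge0_le_integral => //.
- by move=> x _; rewrite lee_fin mulr_ge0 ?nsq_ge0.
- apply/measurable_EFinP; apply: measurable_funM; first exact: measurable_nsq lh.1.
  apply: measurable_nsq; under eq_fun do rewrite horner_coef.
  apply: cmeas_sum => j; apply: cmeasZ.
  under eq_fun do rewrite -expi_natM; apply: cmeas_expi.
  apply: measurable_funM => //; apply: measurable_funM => //; apply: measurable_funM => //.
  by apply: measurable_funM => //; exact: measurable_tnth.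
- apply/measurable_EFinP; apply: measurable_funM; first exact: measurable_nsq lh.1.
  exact: (measurableT_comp (measurable_cutoff _ _ _) measurable_abs_coord).
move=> x _; rewrite lee_fin ler_wpM2l ?nsq_ge0//.
have := kern_cutoff N (sg * tnth x k) M0 Kr.
by rewrite normrM sg1 mul1r.
Qed.

Lemma kern0_bound (N M : nat) : (0 < M)%N ->
  act_bound (('X - 1) * @kern R M (nseq N 0)) ((2 ^+ N - 1) * (2 / M%:R)).
Proof.
move=> M0; have := @act_bound_kern R M M0 (nseq N 0) (2 / M%:R).
rewrite size_nseq; apply => t /nseqP[-> _].
by rewrite mulr0 expi0 subrr normc0 addr0.
Qed.

Lemma no_dual_moments (p q : R) : 1 < p -> p^-1 + q^-1 = 1 ->
  (\int[lam]_x (`|tnth x k| `^ p * nsq (f x))%:E < +oo)%E ->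
  ~ (\int[lam]_x (`|tnth x k| `^ q * nsq (h x))%:E < +oo)%E.
Proof.
move=> p1 pq fp hq.
have p0 : 0 < p by apply: lt_trans p1.
have pn : p != 0 by rewrite gt_eqF.
have iq : q^-1 = (p - 1) / p by rewrite (_ : q^-1 = 1 - p^-1) ?mulrBl ?divff ?mul1r// -pq addrC addKr.
have q0 : 0 < q by rewrite -invr_gt0 iq divr_gt0// subr_gt0.
have pq1 : (q - 1) * (p - 1) = 1.
  have qn : q != 0 by rewrite gt_eqF.
  have : p * q * (p^-1 + q^-1) = p * q by rewrite pq mulr1.
  rewrite mulrDr mulfK// mulrAC divff// mul1r => e; lra.
have q1 : 0 < q - 1.
  by rewrite -(pmulr_lgt0 _ (_ : 0 < p - 1)) ?pq1 ?ltr01// subr_gt0.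
(* One order serves both kernels: 2 N is at least p + 1 and q + 1, as [cutoff_decay] requires. *)
pose N := (Num.truncn (p + q + 1)).+1.
have pqN : p + q + 1 <= N.*2%:R.
  apply: le_trans (ltW (truncnS_gt _)) _.
  by rewrite ler_nat -addnn leq_addr.
have C0 : 0 <= 2 * (2 ^+ N - 1) * b.
  by rewrite !mulr_ge0// subr_ge0 exprn_ege1// ler1n.
have [m hm] := exists_small_mesh C0; pose M := m.+1.
have M0 : (0 < M)%N by [].
have hd : (2 ^+ N - 1) * (2 / M%:R) * b <= a / 2.
  have := hm M (leqnSn m) M0; rewrite (_ : 2 * (2 ^+ N - 1) * b / M%:R =
    (2 ^+ N - 1) * (2 / M%:R) * b); last by ring.
  by move/le_trans; apply; rewrite ler_pM2l// lef_pV2 ?posrE// ler_nat.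
pose c : R := pi * M%:R.
have c0 : 0 <= c by rewrite mulr_ge0// pi_ge0.
(* By [mesh_rate] the two integrals contribute at most 10 e and 4 e, and 14 < 16. *)
pose e := A / 32 / 16.
have A32 : 0 < A / 32 by rewrite divr_gt0.
have e0 : 0 < e by rewrite divr_gt0.
have mw2 : measurable_fun setT (fun x : X => `|tnth x k| + 2).
  by apply: measurable_funD => //; exact: measurable_abs_coord.
have mf : measurable_fun setT (fun x => nsq (f x)) := measurable_nsq lf.1.
have mp (w : X -> R) r : measurable_fun setT w -> measurable_fun setT (fun x => w x `^ r).
  by move=> mw; exact: (measurableT_comp (@measurable_powR R r) mw).
(* The weight in [pair_inequality] is evaluated at |t_k| + 2, and a finite moment of order p
   survives this shift. *)
have fp2 : (\int[lam]_x ((`|tnth x k| + 2) `^ p * nsq (f x))%:E < +oo)%E.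
  apply: (@le_lt_trans _ _ (\int[lam]_x ((2 `^ p)%:E * (`|tnth x k| `^ p * nsq (f x))%:E +
    (4 `^ p)%:E * (nsq (f x))%:E))%E).
    apply: ge0_le_integral => //.
    - by move=> x _; rewrite lee_fin mulr_ge0 ?powR_ge0 ?nsq_ge0.
    - by apply/measurable_EFinP; apply: measurable_funM => //; exact: mp.
    - apply: emeasurable_funD; apply: measurable_funeM; apply/measurable_EFinP => //.
      by apply: measurable_funM => //; apply: mp; exact: measurable_abs_coord.
    - move=> x _; rewrite -!EFinM -EFinD lee_fin mulrA -mulrDl ler_wpM2r ?nsq_ge0//.
      exact: powR_addr2_le.
  rewrite ge0_integralD//; last 4 first.
  - by move=> x _; rewrite -EFinM lee_fin !mulr_ge0 ?powR_ge0 ?nsq_ge0.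
  - apply: measurable_funeM; apply/measurable_EFinP.
    by apply: measurable_funM => //; apply: mp; exact: measurable_abs_coord.
  - by move=> x _; rewrite -EFinM lee_fin mulr_ge0 ?powR_ge0 ?nsq_ge0.
  - by apply: measurable_funeM; apply/measurable_EFinP.
  rewrite ge0_integralZl//; last 2 first.
  - apply/measurable_EFinP.
    by apply: measurable_funM => //; apply: mp; exact: measurable_abs_coord.
  - by move=> x _; rewrite lee_fin mulr_ge0 ?powR_ge0 ?nsq_ge0.
  rewrite ge0_integralZl//; last 2 first.
  - by apply/measurable_EFinP.
  - by move=> x _; rewrite lee_fin nsq_ge0.
  by apply: lte_add_pinfty; apply: lte_mul_pinfty => //; rewrite ?lee_fin ?powR_ge0//; exact: lf.2.
have qN : q + 1 <= N.*2%:R by apply: le_trans pqN; lra.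
have pN : p + 1 <= N.*2%:R by apply: le_trans pqN; lra.
have [n1 h1] := cutoff_decay lh.1 measurable_abs_coord (fun x => normr_ge0 _) c0 q0 qN hq e0.
have w0 (x : X) : 0 <= `|tnth x k| + 2 by rewrite addr_ge0.
have [n2 h2] := cutoff_decay lf.1 mw2 w0 c0 p0 pN fp2 e0.
(* K > n1 serves the first integral. K >= n2^(p-1) gives K^(q-1) >= n2 and hence L > n2, which
   serves the second. *)
pose K := (maxn n1 (Num.truncn (n2%:R `^ (p - 1) : R))).+1.
have K0 : (0 < K)%N by [].
have p1' : 0 < p - 1 by rewrite subr_gt0.
have [] := mesh_rate p1' q1 pq1 K0; set L := _.+3 => KL rK rL.
have L3 : (2 < L)%N by [].
have Lr : 0 < L%:R :> R by rewrite ltr0n.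
have nK : (n1 < K)%N by rewrite ltnS leq_maxl.
have nL : (n2 < L)%N.
  have t : n2%:R `^ (p - 1) <= K%:R :> R.
    apply: le_trans (ltW (truncnS_gt _)) _; rewrite ler_nat ltnS; exact: leq_maxr.
  have : n2%:R <= K%:R `^ (q - 1) :> R.
    have -> : n2%:R = (n2%:R `^ (p - 1)) `^ (q - 1) :> R.
      by rewrite -powRrM mulrC pq1 powRr1.
    by apply: ge0_ler_powR; rewrite ?nnegrE ?powR_ge0// ltW.
  have /andP[_] := truncn_itv (powR_ge0 (K%:R : R) (q - 1)).
  move=> t2 /le_lt_trans /(_ t2); rewrite ltr_nat => t3.
  exact: leq_trans t3 (leqW (leqnSn _)).
have := pair_inequality lf A0 B0 rf fm K0 L3 (kern0_bound N M0) (kern0_bound N M0) hd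
  (cutoff_ge0 N c L%:R) (measurable_cutoff N c L%:R)
  (fun x y => @cutoff_homo R N c L%:R x y c0 Lr) (fun m => kern_cutoff N m%:~R M0 Lr).
set n := ((K.+1 * L.+1)%:R : R) in rK rL *.
move=> ineq.
have : ((A / 32)%:E <= n%:E * ((e / K%:R `^ q)%:E + (e / L%:R `^ p)%:E))%E.
  apply: le_trans ineq _; rewrite lee_wpmul2l ?lee_fin//; apply: leeD; last exact: h2.
  by apply: le_trans (le_cutoff_term N M0 K0) _; exact: h1.
rewrite -EFinD -EFinM lee_fin.
have Kq0 : 0 < K%:R `^ q :> R by rewrite powR_gt0.
have Lp0 : 0 < L%:R `^ p :> R by rewrite powR_gt0.
have i1 : n * (e / K%:R `^ q) <= 10 * e.
  by rewrite mulrA ler_pdivrMr// [leRHS]mulrAC ler_wpM2r// ltW.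
have i2 : n * (e / L%:R `^ p) <= 4 * e.
  by rewrite mulrA ler_pdivrMr// [leRHS]mulrAC ler_wpM2r// ltW.
rewrite mulrDr => i3; have : A / 32 <= 14 * e by lra.
by move: A32; rewrite /e; move: (A / 32) => u; lra.
Qed.

Lemma nsq_kern_le (M : nat) (s : seq R) (t : R) : (0 < M)%N ->
  nsq ((1 - kern M s).[expi (2 * pi * t)]) <= 4 ^+ size s.
Proof.
move=> M0; rewrite horner_1Bkern; elim: s => [|r s ih]; first by rewrite big_nil nsq1.
rewrite big_cons nsqM exprS; apply: ler_pM; rewrite ?nsq_ge0//.
rewrite -nsqE (_ : 4 = 2 ^+ 2); last by rewrite expr2 -natrM.
by apply: lerXn2r; rewrite ?nnegrE ?normc_ge0//; exact: normc_1Bavg_le2.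
Qed.

Lemma kern_node (M : nat) (s : seq R) (t : R) : (0 < M)%N -> t \in s ->
  (1 - kern M s).[expi (2 * pi * t)] = 0.
Proof.
by move=> M0 ts; rewrite horner_1Bkern (big_rem t)//= horner_avg_same// subrr mul0r.
Qed.

Lemma no_first_moment (D : nat) :
  {ae lam, forall x, D%:R < `|tnth x k| -> f x = 0} ->
  ~ (\int[lam]_x (`|tnth x k| * nsq (h x))%:E < +oo)%E.
Proof.
(* The 2 is the displacement in W(|t_k| + 2), and n counts the integers of modulus at most D'. *)
move=> fD hq; pose D' := (D + 2)%N; pose n := D'.*2.+1.
have p0 : 0 <= 2 * pi * D'%:R :> R by rewrite !mulr_ge0// pi_ge0.
have E0 : 0 <= 2 ^+ n - 1 :> R by rewrite subr_ge0 exprn_ege1// ler1n.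
have E1 : 1 <= 2 ^+ n - 1 :> R.
  have h2 : 1 <= 2 ^+ D'.*2 :> R by rewrite exprn_ege1// ler1n.
  by rewrite /n exprS; lra.
have C0 : 0 <= 2 * (2 ^+ n - 1) * b by rewrite !mulr_ge0.
have C1 : 0 <= 2 * pi * D'%:R * (2 ^+ n - 1) * b.
  by apply: mulr_ge0 => //; apply: mulr_ge0.
have [m hm] := exists_small_mesh C0; pose M := m.+1.
have [r hr] := exists_small_mesh C1; pose L := r.+3.
have M0 : (0 < M)%N by [].
have L3 : (2 < L)%N by [].
pose s : seq R := nodes D' L%:R.
have size_s : size s = n by rewrite size_map size_iota.
have mem_s z : `|z%:~R| <= D'%:R :> R -> z%:~R / L%:R \in s by exact: mem_nodes.
have s_small t : t \in s -> normc (expi (2 * pi * t) - 1) <= 2 * pi * D'%:R / L%:R.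
  move=> /nodes_le ts; apply: le_trans (normc_expi1_le _) _.
  rewrite normrM ger0_norm ?mulr_ge0 ?pi_ge0// -mulrA ler_wpM2l ?mulr_ge0 ?pi_ge0//.
  by apply: ts.
(* The summands come from averaging over M shifts and from the nodes, which lie within D' / L of 0.
   Neither involves K, so M and L are fixed before K grows. *)
pose d : R := (2 ^+ n - 1) * (2 / M%:R + 2 * pi * D'%:R / L%:R).
have pL0 : 0 <= 2 * pi * D'%:R / L%:R :> R by exact: divr_ge0.
have hd : d * b <= a / 2.
  have := hm M (leqnSn m) M0.
  have := hr L (leq_trans (leqnSn r) (leq_trans (leqnSn r.+1) (leqnSn r.+2))) (ltn0Sn _).
  have -> : d * b = 2 * pi * D'%:R * (2 ^+ n - 1) * b / L%:R + 2 * (2 ^+ n - 1) * b / M%:R.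
    by rewrite /d; ring.
  by move: (_ / L%:R) (_ / M%:R) => u v; lra.
(* On the frequency side the single node 0 suffices; since 2^n - 1 >= 1, the same d bounds both
   kernels. *)
have hP : act_bound (('X - 1) * @kern R M (nseq 1 0)) d.
  apply: act_bound_le (kern0_bound 1 M0).
  have h2 : 0 <= 2 / M%:R :> R by rewrite divr_ge0.
  by rewrite /d expr1; nra.
have hQ : act_bound (('X - 1) * @kern R M s) d.
  by rewrite /d -size_s; apply: act_bound_kern => // t ts; rewrite lerD2l; exact: s_small.
(* Evaluated at |t_k| + 2, this is positive only for |t_k| > D, where f vanishes almost everywhere,
   so the crude bound 4^n does no harm. *)
pose W (x : R) : R := 4 ^+ n * (D'%:R < x)%R%:R.
have W0 x : 0 <= W x by rewrite mulr_ge0 ?exprn_ge0.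
have mW : measurable_fun setT W.
  apply: measurable_funM => //.
  rewrite (_ : (fun x => _) = \1_(`]D'%:R, +oo[ : set R)).
    by apply: measurable_indic; exact: measurable_itv.
  by apply/funext => x; rewrite indicE mem_setE in_itv /= andbT.
have homoW x y : 0 <= x -> x <= y -> W x <= W y.
  move=> _ xy; rewrite ler_wpM2l ?exprn_ge0// ler_nat.
  by case: (ltP D'%:R x) => // h1; rewrite (lt_le_trans h1 xy).
have hW (z : int) : nsq ((1 - kern M s).[expi (2 * pi * (z%:~R / L%:R))]) <= W `|z%:~R|.
  rewrite /W; case: ltP => h1; last by rewrite kern_node ?mem_s// nsq0 mulr0.
  by rewrite mulr1 -size_s nsq_kern_le.
have I2 : (\int[lam]_x (nsq (f x) * W (`|tnth x k| + 2))%:E = 0)%E.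
  rewrite -(integral0 lam setT); apply: ge0_ae_eq_integral => //.
  - apply/measurable_EFinP; apply: measurable_funM; first exact: measurable_nsq lf.1.
    apply: (measurableT_comp mW).
    by apply: measurable_funD => //; exact: measurable_abs_coord.
  - by move=> x _; rewrite lee_fin mulr_ge0 ?nsq_ge0.
  apply: filterS fD => x fx _; congr EFin; rewrite /W; case: ltP => h1; last by rewrite !mulr0.
  by rewrite fx ?nsq0 ?mul0r//; move: h1; rewrite /D' natrD; lra.
pose c : R := pi * M%:R.
have c0 : 0 <= c by rewrite mulr_ge0// pi_ge0.
(* With (K + 1) / K <= 2, the right-hand side becomes at most half of A / 32. *)
pose e := A / 32 / (4 * L.+1%:R).
have A32 : 0 < A / 32 by rewrite divr_gt0.
have e0 : 0 < e by rewrite divr_gt0// mulr_gt0.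
have hq1 : (\int[lam]_x (`|tnth x k| `^ 1 * nsq (h x))%:E < +oo)%E.
  by under eq_integral do rewrite powRr1//.
have qN : 1 + 1 <= 1.*2%:R :> R by exact: lexx.
have [n1 h1] := cutoff_decay lh.1 measurable_abs_coord (fun x => normr_ge0 _) c0
  (@ltr01 R) qN hq1 e0.
pose K := n1.+1; have K0 : (0 < K)%N by [].
have := pair_inequality lf A0 B0 rf fm K0 L3 hP hQ hd W0 mW homoW hW.
rewrite I2 adde0 => ineq.
have : ((A / 32)%:E <= (K.+1 * L.+1)%:R%:E * (e / K%:R `^ 1)%:E)%E.
  apply: le_trans ineq _; rewrite lee_wpmul2l ?lee_fin//.
  by apply: le_trans (le_cutoff_term 1 M0 K0) _; exact: h1.
rewrite powRr1// -EFinM lee_fin.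
have -> : (K.+1 * L.+1)%:R * (e / K%:R) = A / 32 * (K.+1%:R / K%:R) / 4.
  by rewrite /e natrM; field; rewrite !gt_eqF.
have : K.+1%:R / K%:R <= 2 :> R.
  by rewrite ler_pdivrMr// -natrM ler_nat mul2n -addnn -[K.+1]addn1 leq_add2l.
by move: A32; move: (A / 32) (_ / K%:R) => v u; nra.
Qed.

End Balian_Low.

Lemma compactly_supported_coord (R : realType) (l : nat) (f : l.-tuple R -> R[i]) (k : 'I_l) :
  compactly_supported f -> exists D : nat,
  {ae lebesgueT R l, forall x, D%:R < `|tnth x k| -> f x = 0}.
Proof.
move=> [K /compact_bounded [M [_ hM]] fK].
(* The norm bound holds for every constant above M, hence for M + 1; the maximum norm of a row
   vector dominates each coordinate. *)
exists (Num.truncn (M + 1)).+1; apply: filterS fK => x hx Dx; apply: hx => Kx.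
have MM : M < M + 1 by rewrite ltrDl.
have := hM _ MM _ Kx; apply/negP; rewrite -ltNge.
apply: lt_trans (truncnS_gt _) _; apply: lt_le_trans Dx _.
rewrite [leRHS]mx_normrE.
by apply: le_trans (le_bigmax _ _ (ord0, k)); rewrite /= mxE.
Qed.

Theorem theorem1p11 (R : realType) (l : nat) (hl : (1 <= l)%N)
  (g gh : l.-tuple R -> R[i])
  (hg : memL 2 g)
  (hgh : is_fourierL2 g gh)
  (hG : riesz_basis (gabor g))
  (k : 'I_l) :
  (forall p q : R, 1 < p -> p^-1 + q^-1 = 1 ->
     (\int[lebesgueT R l]_x
        (`|tnth x k| `^ p * normc (g x) ^+ 2)%:E = +oo)%E \/
     (\int[lebesgueT R l]_xi
        (`|tnth xi k| `^ q * normc (gh xi) ^+ 2)%:E = +oo)%E) /\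
  (compactly_supported g ->
     (\int[lebesgueT R l]_xi
        (`|tnth xi k| * normc (gh xi) ^+ 2)%:E = +oo)%E) /\
  (compactly_supported gh ->
     (\int[lebesgueT R l]_x
        (`|tnth x k| * normc (g x) ^+ 2)%:E = +oo)%E).
Proof.
have lg : L2 (lebesgueT R l) g by apply/memL2E.
have lgh : L2 (lebesgueT R l) gh by case: hgh => _ /memL2E.
have [A [B [A0 B0 rg]]] := riesz_basis_bounds hG.
have dg := fourier_dual hgh.
have infty (w : l.-tuple R -> R) (f : l.-tuple R -> R[i]) :
    ~ (\int[lebesgueT R l]_x (w x * nsq (f x))%:E < +oo)%E ->
    (\int[lebesgueT R l]_x (w x * normc (f x) ^+ 2)%:E = +oo)%E.
  move=> h; under eq_integral do rewrite nsqE.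
  by apply/eqP; apply: contrapT => /negP; rewrite -ltey.
have fm := dual_freq_mult k dg; have fmV := dual_freq_multV k dg.
have n1 : `|1 : R| = 1 by exact: normr1.
have nN1 : `|-1 : R| = 1 by rewrite normrN1.
split; [|split].
- move=> p q p1 pq.
  have [hp|hp] := pselect (\int[lebesgueT R l]_x (`|tnth x k| `^ p * nsq (g x))%:E < +oo)%E.
    by right; apply: infty; exact: (no_dual_moments lg lgh A0 B0 rg fm n1 p1 pq hp).
  by left; exact: infty.
- move=> /(compactly_supported_coord k)[D hD]; apply: infty.
  exact: (no_first_moment lg lgh A0 B0 rg fm n1 hD).
- move=> /(compactly_supported_coord k)[D hD]; apply: infty.
  exact: (no_first_moment lgh lg A0 B0 (riesz_bounds_dual dg rg) fmV nN1 hD).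
Qed.
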